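(* Let $(X,d_X)$ be a complete separable metric space. Let $\Phi:X\to[0,\infty)$ be globally Lipschitz with Lipschitz constant $K:=\operatorname{Lip}(\Phi)$ and $\inf_{x\in X}\Phi(x)=0$, and set $L:=e^{-\Phi}$. Let $p>1$ and $p':=p/(p-1)$. For $B,M\ge0$ define $$\mathfrak C_p(B,M;\Phi):=\{\mu\in\mathcal P_p(X): C_{\mathrm P,p'}(\mu)\le B,\ \operatorname{osc}_\mu(\Phi)\le M\}.$$ Then, for all $\mu,\nu\in\mathfrak C_p(B,M;\Phi)$, $$W_p\bigl(\mathcal B_L(\mu),\mathcal B_L(\nu)\bigr)\le\left(e^{M/p}+\gamma_p K B^{1/p'}e^{M}\right)W_p(\mu,\nu),$$ where $\gamma_p$ is the constant, depending only on $p$, given by $$\gamma_p:=\max_{0\le s\le1}\bigl(s^{p-1}+(1-s)^{p-1}\bigr)^{1/p}\bigl(s^{p'-1}+(1-s)^{p'-1}\bigr)^{1/p'},$$ which satisfies $\gamma_p<2$, and $\gamma_p=1$ when $p=2$.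
   Context: $\mathcal P(X)$ is the set of Borel probability measures on $X$, and $\mathcal P_p(X)$ is the set of $\mu\in\mathcal P(X)$ with $\int_X d_X(x,x_* )^p\,\mu(\mathrm dx)<\infty$ for a fixed reference point $x_*\in X$. For $\mu,\nu\in\mathcal P_p(X)$, $W_p(\mu,\nu):=\left(\inf_{\pi\in\Pi(\mu,\nu)}\int_{X\times X}d_X(x,x')^p\,\pi(\mathrm dx,\mathrm dx')\right)^{1/p}$, where $\Pi(\mu,\nu)$ is the set of couplings of $\mu$ and $\nu$. With $\mu(L):=\int_X L\,\mathrm d\mu>0$, the posterior is the probability measure $\mathcal B_L(\mu)(\mathrm dx):=\mu(L)^{-1}L(x)\,\mu(\mathrm dx)$. $\operatorname{Lip}(\Phi):=\sup_{x\ne x'}|\Phi(x)-\Phi(x')|/d_X(x,x')$ (zero if $X$ has at most one point); $\Phi$ is globally Lipschitz when this is finite. For a bounded Lipschitz $f:X\to\mathbb R$, the pointwise local Lipschitz constant is $|\mathrm Df|(x):=\limsup_{x'\to x,\,x'\ne x}\frac{|f(x')-f(x)|}{d_X(x',x)}$, with value $0$ at isolated points. For $r>1$ and $\mu\in\mathcal P(X)$, the $L^r$-Poincar\'e constant $C_{\mathrm P,r}(\mu)$ is the infimum of all $C\ge0$ such that $$\inf_{a\in\mathbb R}\int_X|f(x)-a|^r\,\mu(\mathrm dx)\le C\int_X|\mathrm Df|^r(x)\,\mu(\mathrm dx)\quad\text{for every bounded Lipschitz }f:X\to\mathbb R,$$ where the infimum of the empty set is $+\infty$. For a measurable $f:X\to\mathbb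 R$, the $\mu$-essential oscillation is $\operatorname{osc}_\mu(f):=\operatorname{ess\,sup}_\mu f-\operatorname{ess\,inf}_\mu f\in[0,\infty]$. *)

(* Defs.v *)
From HB Require Import structures.
From mathcomp Require Import all_boot all_order all_algebra.
From mathcomp Require Import all_classical all_reals all_analysis.
From mathcomp Require Import measurable_realfun ess_sup_inf.

Set Implicit Arguments.
Unset Strict Implicit.
Unset Printing Implicit Defensive.

Import Order.TTheory GRing.Theory Num.Theory.
Import numFieldNormedType.Exports.

Local Open Scope classical_set_scope.
Local Open Scope ring_scope.
Local Open Scope ereal_scope.

#[short(type="completeMetricType")]
HB.structure Definition CompleteMetric (R : numDomainType) :=
  {T of Metric R T & Complete T}.

Definition separable (T : topologicalType) :=
  exists2 D : set T, countable D & dense D.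

(* For a separable metric space the product sigma-algebra on
   [borel X * borel X] is the Borel sigma-algebra of the product space. *)
Notation borel X := (g_sigma_algebraType (@open X)).

Section posterior.
Context d (T : measurableType d) (R : realType).

(* The measure A |-> \int_A L dmu. The guard makes it a measure for every L;
   it is 0 when L is not a nonnegative measurable function. *)
Definition mdensity (mu : {measure set T -> \bar R}) (L : T -> R) (A : set T) :
    \bar R :=
  if `[< measurable_fun setT L /\ forall x, (0 <= L x)%R >]
  then \int[mu]_(x in A) (L x)%:E else 0.

Section mdensity_measure.
Variables (mu : {measure set T -> \bar R}) (L : T -> R).

Let mdensity0 : mdensity mu L set0 = 0.
Proof. by rewrite /mdensity; case: asboolP => // _; rewrite integral_set0. Qed.

Let mdensity_ge0 A : 0 <= mdensity mu L A.
Proof.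
rewrite /mdensity; case: asboolP => // -[_ L0].
by apply: integral_ge0 => x _; rewrite lee_fin.
Qed.

Let mdensity_sigma_additive : semi_sigma_additive (mdensity mu L).
Proof.
rewrite /mdensity; case: asboolP => [[mL L0]|_].
  apply: semi_sigma_additive_nng_induced; first exact/measurable_EFinP.
  by move=> x; rewrite lee_fin.
exact: (@measure_semi_sigma_additive _ _ _ (@mzero d T R)).
Qed.

HB.instance Definition _ := isMeasure.Build _ _ _ (mdensity mu L)
  mdensity0 mdensity_ge0 mdensity_sigma_additive.

End mdensity_measure.

(* The second argument of [mnormalize] is its value when the evidence
   \int L dmu is 0 or +oo; [posteriorE] gives the value in all other cases. *)
Definition posterior (mu : probability T R) (L : T -> R) : probability T R :=
  mnormalize (mdensity mu L) mu.

Lemma posteriorE (mu : probability T R) (L : T -> R) (A : set T) :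
  measurable_fun setT L -> (forall x, 0 <= L x)%R ->
  0 < \int[mu]_x (L x)%:E -> \int[mu]_x (L x)%:E < +oo ->
  posterior mu L A =
    ((fine (\int[mu]_x (L x)%:E))^-1)%:E * \int[mu]_(x in A) (L x)%:E.
Proof.
move=> mL L0 evi0 eviy.
have densE B : mdensity mu L B = \int[mu]_(x in B) (L x)%:E.
  by rewrite /mdensity asboolT.
rewrite /posterior /= /mnormalize /= densE gt_eqF //= lt_eqF //= muleC.
by rewrite densE.
Qed.

End posterior.

Section metric_measure.
Context (R : realType) (X : completeMetricType R).
Implicit Types (f : X -> R) (mu nu : probability (borel X) R).

(* The maximum with 0 only matters when there are no two distinct points, where
   the supremum of the empty set is -oo. *)
Definition lip_const f : \bar R :=
  maxe 0 (ereal_sup [set (`|f xy.1 - f xy.2| / mdist xy.1 xy.2)%:E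
                    | xy in [set xy : X * X | xy.1 != xy.2]]).

Definition local_lip f (x : X) : \bar R :=
  if `[< isolated [set: X] x >] then 0
  else limf_esup (fun y => (`|f y - f x| / mdist y x)%:E) x^'.

Definition poincare_const (r : R) mu : \bar R :=
  ereal_inf [set C%:E | C in [set C : R | (0 <= C)%R /\
    forall f, bounded_fun (f : X -> R) -> lip_const f < +oo ->
      ereal_inf [set \int[mu]_x (`|f x - a| `^ r)%:E | a in [set: R]]
        <= C%:E * \int[mu]_x (local_lip f x `^ r)]].

Definition ess_osc mu f : \bar R :=
  ess_sup mu (EFin \o f) - ess_inf mu (EFin \o f).

Definition finite_moment (xstar : X) (p : R) mu :=
  \int[mu]_x (mdist x xstar `^ p)%:E < +oo.

Definition couplings mu nu :=
  [set pi : probability (borel X * borel X)%type R | forall A : set (borel X), measurable A ->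
     pushforward pi fst A = mu A /\ pushforward pi snd A = nu A].

Definition wasserstein (p : R) mu nu : \bar R :=
  ereal_inf [set \int[pi]_xy (mdist (xy.1 : X) (xy.2 : X) `^ p)%:E
            | pi in couplings mu nu] `^ p^-1.

End metric_measure.

Definition conj_exp (R : realType) (p : R) : R := (p / (p - 1))%R.

Definition prior_class (R : realType) (X : completeMetricType R) (xstar : X)
    (p B M : R) (Phi : X -> R) : set (probability (borel X) R) :=
  [set mu | [/\ finite_moment xstar p mu,
                poincare_const (conj_exp p) mu <= B%:E &
                ess_osc mu Phi <= M%:E]].

Definition gamma_fun (R : realType) (p s : R) : R :=
  let p' := conj_exp p in
  ((s `^ (p - 1) + (1 - s) `^ (p - 1)) `^ p^-1
   * (s `^ (p' - 1) + (1 - s) `^ (p' - 1)) `^ p'^-1)%R.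

Definition gamma_const (R : realType) (p : R) : R :=
  sup [set gamma_fun p s | s in `[0%R, 1%R]].

(* Main.v *)
Require Import Defs.
From HB Require Import structures.
From mathcomp Require Import all_boot all_order all_algebra.
From mathcomp Require Import all_classical all_reals all_analysis.
From mathcomp Require Import measurable_realfun ess_sup_inf.
From mathcomp Require Import ring lra.

Set Implicit Arguments.
Unset Strict Implicit.
Unset Printing Implicit Defensive.

Import Order.TTheory GRing.Theory Num.Theory.
Import numFieldNormedType.Exports.

Local Open Scope classical_set_scope.
Local Open Scope ring_scope.

(** Let [pi] be a coupling of [mu] and [nu] with cost [w], let [W = w ^ (1/p)],
    and let [q] be the conjugate exponent of [p].  Reweighting [pi] by
    [exp (- Phi x)] turns its first marginal into the posterior of [mu], and
    reweighting it by [exp (- Phi y)] turns its second marginal into the posterior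
    of [nu].  As these are two different measures on the product, the route from
    one posterior to the other has two legs, meeting in the second marginal of the
    coupling reweighted by [exp (- Phi x)].

    The first leg is the displacement along that reweighted coupling.  Since [Phi]
    oscillates by at most [M], the normalised weight is at most [exp M], so the
    leg has length [A = exp (M / p) * W].

    The second leg follows the second marginals [nu_t] of the couplings with weight
    [exp (- (u + t * (v - u)))], where [u = Phi x], [v = Phi y] and [0 <= t <= 1].
    The derivative of [t |-> \int g d(nu_t)] is the covariance of [g y] and
    [u - v], which Hoelder's inequality bounds by the norm of [g - c] in [L^q]
    times the norm of the centered [u - v] in [L^p], for any constant [c].
    Centering multiplies a norm in [L^p] by at most [gamma] ([centering_bound];
    the extremal case is a two-point space, hence the shape of [gamma_fun]), and
    [|u - v|] is at most [K] times the distance.  The Poincare inequality of [nu]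
    bounds the norm of [g - c] by [B ^ (1/q)] times that of the slope of [g].  In
    passing between weighted and unweighted integrals the two norms lose the
    factors [exp (M / p)] and [exp (M / q)].  So [nu_t] moves with speed at most
    [V = gamma * K * B ^ (1/q) * exp M * W], and the theorem is the bound [A + V].

    Lengths are measured by duality.  By [kantorovich_coupling] it suffices to
    bound [\int (Q 1 f) d(nu') - \int f d(mu')] by the [p]-th power of the length,
    for the posteriors [mu'] and [nu'] and all bounded measurable [f], where
    [Q t f] is the Hopf-Lax evolution of [f].  The evolution runs along the route:
    up to time [tau] on the first leg and from [tau] to [1] on the second.  The
    inequality [hopf_lax_hamilton_jacobi] says that [Q t f] decreases at least at
    the rate of a multiple of the [q]-th power of its slope, and by Young's
    inequality this decrease absorbs the Poincare term ([pairing_step], summed up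
    in [pairing_increment]).  The legs contribute [A ^ p / tau ^ (p - 1)] and
    [V ^ p / (1 - tau) ^ (p - 1)], whose sum is [(A + V) ^ p] for the best [tau]
    ([split_time]).

    Duality itself comes from a partition into finitely many small cells and a
    remainder of small moment: Farkas' lemma solves the finite transport problem,
    and the plan is spread over the cells ([coupling_of_plan]).

    The assertions on [gamma_const] follow from the continuity of [gamma_fun] on
    the unit interval, where both sums in its definition are less than [2]; both
    are [1] when [p = 2]. *)

(** * Conjugate exponents and Young's inequality *)

Section conjugate_exponents.
Context {R : realType} (p : R) (p1 : 1 < p).
Local Notation q := (conj_exp p).
Ltac plra := let H := fresh in have H := p1; lra.

Lemma conj_exp_gt1 : 1 < q.
Proof. by rewrite /conj_exp ltr_pdivlMr ?subr_gt0// mul1r; plra. Qed.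

Lemma conj_exp_addV : p^-1 + q^-1 = 1.
Proof. by rewrite /conj_exp; field; apply/andP; split; apply: lt0r_neq0; plra. Qed.

Lemma conj_expB1 : q - 1 = (p - 1)^-1.
Proof. by rewrite /conj_exp; field; apply: lt0r_neq0; plra. Qed.

Lemma conj_exp_mulV : p^-1 * q = q - 1.
Proof. by rewrite /conj_exp; field; apply/andP; split; apply: lt0r_neq0; plra. Qed.

Lemma mul_conj_expV : q^-1 * p = p - 1.
Proof. by rewrite /conj_exp; field; apply/andP; split; apply: lt0r_neq0; plra. Qed.

Lemma mul_conj_expB1 : (q - 1) * (p - 1) = 1.
Proof. by rewrite conj_expB1 mulVf// subr_eq0 gt_eqF. Qed.

Lemma powR_expR (x a : R) : 0 < x -> x `^ a = expR (a * ln x).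
Proof. by move=> x0; rewrite /powR gt_eqF. Qed.

Lemma powR_mulN (x a : R) : 0 < x -> x `^ a * x `^ (- a) = 1.
Proof. by move=> x0; rewrite powRN mulfV// gt_eqF// powR_gt0. Qed.

Lemma powRD_gt0 (x a b : R) : 0 < x -> x `^ (a + b) = x `^ a * x `^ b.
Proof. by move=> x0; rewrite powRD//; apply/implyP => _; rewrite gt_eqF. Qed.

(** The value at [y] of the Legendre transform of [x |-> x ^ p] is
    [legendre_const * y ^ q]. *)
Definition legendre_const := (p - 1) * p `^ (- q).
Local Notation c := legendre_const.

Lemma legendre_const_gt0 : 0 < c.
Proof. by rewrite mulr_gt0 ?powR_gt0//; plra. Qed.

Lemma young_legendre (x y : R) : 0 <= x -> 0 <= y ->
  x * y <= x `^ p + c * y `^ q.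
Proof.
move=> x0 y0; have p0 : 0 < p by plra.
have q1 := conj_exp_gt1. have q0 : 0 < q by lra.
have := @conjugate_powR R (p `^ p^-1 * x) (y * p `^ (- p^-1)) p q.
rewrite !mulr_ge0 ?powR_ge0// => /(_ isT isT p0 q0 conj_exp_addV).
rewrite !powRM ?powR_ge0// -!powRrM mulVf ?gt_eqF// powRr1 ?(ltW p0)//.
have -> : p `^ p^-1 * x * (y * p `^ (- p^-1)) = x * y.
  have <- : p `^ p^-1 * p `^ (- p^-1) * (x * y) = x * y.
    by rewrite powR_mulN// mul1r.
  ring.
move=> /le_trans; apply; rewrite [p * _]mulrC mulfK ?gt_eqF// lerD2l.
rewrite le_eqVlt; apply/orP; left; apply/eqP.
have -> : - p^-1 * q = - q + 1 by rewrite mulNr conj_exp_mulV opprB addrC.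
rewrite powRD_gt0// powRr1 ?(ltW p0)// /legendre_const.
have -> : q^-1 = (p - 1) / p by rewrite /conj_exp invf_div.
by field; rewrite gt_eqF.
Qed.

(** Young's inequality with a free scale [s]; choosing [s] later plays the part
    of optimising Hoelder's inequality. *)
Lemma young_legendre_scale (s x y : R) : 0 < s -> 0 <= x -> 0 <= y ->
  x * y <= s `^ p * x `^ p + c * s `^ (- q) * y `^ q.
Proof.
move=> s0 x0 y0.
have := @young_legendre (s * x) (y / s).
rewrite !mulr_ge0 ?invr_ge0 ?(ltW s0)// => /(_ isT isT).
have -> : s * x * (y / s) = x * y by field; rewrite gt_eqF.
move=> /le_trans; apply.
rewrite !powRM ?invr_ge0 ?(ltW s0)//.
by rewrite -[s^-1]powR_inv1 ?(ltW s0)// -powRrM mulN1r mulrA -[c * _ * _]mulrA [_ * (s `^ _)]mulrC mulrA.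
Qed.

End conjugate_exponents.

(** The absolute value removes the jump of [powR] at [0], where negative
    bases are sent to [1]. *)
Lemma continuous_norm_powR (R : realType) (a : R) : 0 < a ->
  continuous (fun x : R => `|x| `^ a).
Proof.
move=> a0 x; have [->|x0] := eqVneq x 0.
  apply/cvgrPdist_lt => e e0; rewrite normr0 powR0 ?gt_eqF//.
  near=> y; rewrite sub0r normrN ger0_norm ?powR_ge0//.
  have -> : e = (e `^ a^-1) `^ a.
    by rewrite -powRrM mulVf ?gt_eqF// powRr1// ltW.
  rewrite gt0_ltr_powR// ?nnegrE ?powR_ge0//.
  near: y; apply/nbhs_normP; exists (e `^ a^-1) => /=; first exact: powR_gt0.
  by move=> y /=; rewrite sub0r normrN.
apply: (@continuous_comp R R R Num.norm (fun y => y `^ a) x).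
  exact: norm_continuous.
apply: differentiable_continuous; apply/derivable1_diffP.
by apply: derivable_powR; rewrite in_itv/= normr_gt0 x0.
Unshelve. all: by end_near. Qed.

(** * The centering constant *)

Section gamma.
Context {R : realType} (p : R) (p1 : 1 < p).
Local Notation q := (conj_exp p).
Local Notation G := (gamma_fun p).
Local Notation gamma := (gamma_const p).
Ltac plra := let H := fresh in have H := p1; lra.

Lemma gamma_fun_continuous : {within `[0, 1], continuous (gamma_fun p)}.
Proof.
have q1' := conj_exp_gt1 p1.
pose N (a x : R) := `|x| `^ a.
have sub s : {for s, continuous (fun s : R => 1 - s)}.
  by apply: cvgB; [exact: cvg_cst|exact: cvg_id].
have cN (a : R) : 0 < a -> forall x, {for x, continuous (N a)}.
  by move=> a0 x; exact: continuous_norm_powR.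
have sum (a : R) : 0 < a -> continuous (fun s => N a s + N a (1 - s)).
  move=> a0 s; have h := @continuous_comp R R R (fun s => 1 - s) (N a) s (sub s) (cN _ a0 _).
  exact: (cvgD (cN _ a0 s) h).
have comp (a b : R) : 0 < a -> 0 < b -> continuous (fun s => N b (N a s + N a (1 - s))).
  move=> a0 b0 s.
  exact: (@continuous_comp R R R (fun s => N a s + N a (1 - s)) (N b) s (sum _ a0 s) (cN _ b0 _)).
pose F s := N p^-1 (N (p - 1) s + N (p - 1) (1 - s)) *
            N q^-1 (N (q - 1) s + N (q - 1) (1 - s)).
have cF : continuous F.
  by move=> s; apply: cvgM; apply: comp; rewrite ?invr_gt0; plra.
apply: (@subspace_eq_continuous _ _ _ F); last exact: continuous_subspaceT.
move=> s; rewrite inE/= in_itv/= => /andP[s0 s1]; rewrite /F /gamma_fun/= /from_subspace /N.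
by rewrite !(ger0_norm (addr_ge0 (powR_ge0 _ _) (powR_ge0 _ _))) !ger0_norm ?subr_ge0.
Qed.

Lemma gamma_const_max : exists2 s : R, 0 <= s <= 1 & gamma = G s.
Proof.
have [s s01 Gs] := EVT_max ler01 gamma_fun_continuous.
exists s; first by rewrite in_itv in s01.
apply/eqP; rewrite eq_le; apply/andP; split.
  apply: ge_sup; first by exists (G s), s.
  by move=> _ [t t01 <-]; exact: Gs.
apply: ub_le_sup; last by exists s.
by exists (G s) => _ [t t01 <-]; exact: Gs.
Qed.

Lemma gamma_fun_le (s : R) : 0 <= s <= 1 -> G s <= gamma.
Proof.
move=> s01; have [t t01 Gt] := EVT_max ler01 gamma_fun_continuous.
apply: ub_le_sup; last by exists s.
by exists (G t) => _ [u u01 <-]; exact: Gt.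
Qed.

Let q1 := conj_exp_gt1 p1.

Lemma gamma_fun0 : G 0 = 1.
Proof.
rewrite /gamma_fun subr0 !powR1 !powR0 ?add0r ?powR1 ?mulr1//.
  by rewrite gt_eqF// subr_gt0.
by rewrite gt_eqF// subr_gt0.
Qed.

Lemma gamma_ge1 : 1 <= gamma.
Proof. by rewrite -gamma_fun0 gamma_fun_le// lexx ler01. Qed.

Let sum_pow_lt2 (a s : R) : 0 < a -> 0 <= s <= 1 -> s `^ a + (1 - s) `^ a < 2.
Proof.
move=> a0 /andP[s0 s1].
have pow_lt1 (r : R) : 0 <= r < 1 -> r `^ a < 1.
  move=> /andP[r0 r1']; rewrite (_ : 1 = 1 `^ a); last by rewrite powR1.
  by rewrite gt0_ltr_powR// nnegrE.
have pow_le1 (r : R) : 0 <= r <= 1 -> r `^ a <= 1.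
  move=> /andP[r0 r1']; rewrite (_ : 1 = 1 `^ a); last by rewrite powR1.
  by rewrite ge0_ler_powR ?nnegrE// ltW.
have [s0'|s0'] := eqVneq s 0.
  rewrite s0' powR0 ?gt_eqF// add0r subr0 powR1; plra.
have s0P : 0 < s by rewrite lt_neqAle eq_sym s0'.
have : (1 - s) `^ a < 1 by apply: pow_lt1; lra.
have : s `^ a <= 1 by apply: pow_le1; rewrite s0 s1.
plra.
Qed.

(** Both sums in [gamma_fun] are less than [2], and the outer exponents add up to
    [1]. *)
Lemma gamma_lt2 : gamma < 2.
Proof.
have [s s01 ->] := gamma_const_max; rewrite /gamma_fun.
have q1' := q1. have a0 : 0 < p - 1 by plra.
have b0 : 0 < q - 1 by lra.
have -> : 2 = 2 `^ p^-1 * 2 `^ q^-1 :> R.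
  by rewrite -powRD ?conj_exp_addV ?powRr1// pnatr_eq0 implybT.
have ? : 0 < q by plra.
have ? : 0 < p by plra.
apply: ltr_pM; rewrite ?powR_ge0//; apply: gt0_ltr_powR;
  rewrite ?invr_gt0 ?nnegrE ?addr_ge0 ?powR_ge0//; exact: sum_pow_lt2.
Qed.

(** Hoelder's inequality on a two-point space; this is where the expression
    defining [gamma_fun] comes from. *)
Lemma gamma_fun_two_point (a x y : R) : 0 < a < 1 -> 0 <= x -> 0 <= y ->
  a * (1 - a) * (a `^ (p - 1) + (1 - a) `^ (p - 1)) * (x + y) `^ p
    <= G a `^ p * (a * x `^ p + (1 - a) * y `^ p).
Proof.
move=> /andP[a0 a1] x0 y0.
have b0 : 0 < 1 - a by lra.
have q1' := q1; have p0 : 0 < p by plra.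
have q0 : 0 < q by lra.
set b := 1 - a in b0 *.
set S := a `^ (q - 1) + b `^ (q - 1).
have S0 : 0 < S by rewrite addr_gt0// powR_gt0.
set N := a * x `^ p + b * y `^ p.
have N0 : 0 <= N by rewrite addr_ge0// mulr_ge0 ?powR_ge0// ltW.
set U := a `^ (p - 1) + b `^ (p - 1).
have U0 : 0 < U by rewrite addr_gt0// powR_gt0.
have GE : G a `^ p = U * S `^ (p - 1).
  rewrite /gamma_fun -/b -/U -/S powRM ?powR_ge0// -!powRrM mulVf ?gt_eqF//.
  by rewrite powRr1 ?(ltW U0)// mul_conj_expV.
have T : (x + y) `^ p <= N * (S / (a * b) `^ (q - 1)) `^ (p - 1).
  have := @hoelder2 R (a `^ p^-1 * x) (b `^ p^-1 * y) (a `^ (- p^-1)) (b `^ (- p^-1)) p q.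
  rewrite !mulr_ge0 ?powR_ge0// => /(_ isT isT isT isT p0 q0 (conj_exp_addV p1)).
  have E (c z : R) : 0 < c -> c `^ p^-1 * z * c `^ (- p^-1) = z.
    by move=> c0; rewrite mulrAC powR_mulN// mul1r.
  have E2 (c z : R) : 0 < c -> 0 <= z -> (c `^ p^-1 * z) `^ p = c * z `^ p.
    by move=> c0 z0; rewrite powRM ?powR_ge0// -powRrM mulVf ?gt_eqF// powRr1// ltW.
  have E3 (c : R) : 0 < c -> (c `^ (- p^-1)) `^ q = c `^ (- (q - 1)).
    by move=> c0; rewrite -powRrM mulNr conj_exp_mulV.
  rewrite !E// !E2// !E3// -/N.
  have -> : a `^ (- (q - 1)) + b `^ (- (q - 1)) = S / (a * b) `^ (q - 1).
    rewrite !powRN powRM ?ltW// /S; field.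
    by rewrite !gt_eqF ?powR_gt0.
  move=> h.
  have := @ge0_ler_powR R p (ltW p0) _ _ _ _ h.
  rewrite !nnegrE addr_ge0// mulr_ge0 ?powR_ge0// => /(_ isT isT) /le_trans; apply.
  rewrite powRM ?powR_ge0// -!powRrM mulVf ?gt_eqF// powRr1//.
  by rewrite mul_conj_expV.
rewrite GE.
have ab0 : 0 < a * b by rewrite mulr_gt0.
have E : (S / (a * b) `^ (q - 1)) `^ (p - 1) = S `^ (p - 1) / (a * b).
  rewrite powRM ?(ltW S0) ?invr_ge0 ?powR_ge0//; congr (_ * _).
  by rewrite -powRN -powRrM mulNr mul_conj_expB1// powR_inv1// ltW.
rewrite {}E in T.
have := ler_wpM2l (ltW (mulr_gt0 ab0 U0)) T => /le_trans; apply.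
rewrite le_eqVlt; apply/orP; left; apply/eqP; field.
by rewrite !gt_eqF.
Qed.

End gamma.

Lemma gamma_const2 (R : realType) : gamma_const 2 = 1 :> R.
Proof.
have two1 : 1 < 2 :> R by lra.
have c2 : conj_exp 2 = 2 :> R by rewrite /conj_exp (_ : 2 - 1 = 1)%R; lra.
have [s /andP[s0 s1] ->] := gamma_const_max two1.
rewrite /gamma_fun c2.
have -> : 2 - 1 = 1 :> R by lra.
by rewrite !powRr1// ?subr_ge0// addrC subrK !powR1 mulr1.
Qed.

(** * Bounded measurable functions and their expectations *)

Section bounded_measurable.
Context d (T : measurableType d) (R : realType).
Implicit Types f g : T -> R.

(** The class in which expectations are computed: it is closed under the algebraic
    operations and integrable against every probability measure. *)
Definition bmeas f := measurable_fun setT f /\ exists C : R, forall x, `|f x| <= C.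

Lemma bmeas_cst (c : R) : bmeas (fun=> c).
Proof. by split => //; exists `|c|. Qed.

Lemma bmeasD f g : bmeas f -> bmeas g -> bmeas (fun x => f x + g x).
Proof.
move=> [mf [C fC]] [mg [D gD]]; split; first exact: measurable_funD.
by exists (C + D) => x; rewrite (le_trans (ler_normD _ _))// lerD.
Qed.

Lemma bmeasN f : bmeas f -> bmeas (fun x => - f x).
Proof.
move=> [mf [C fC]]; split; first exact: measurableT_comp.
by exists C => x; rewrite normrN.
Qed.

Lemma bmeasB f g : bmeas f -> bmeas g -> bmeas (fun x => f x - g x).
Proof. by move=> bf bg; apply: bmeasD => //; exact: bmeasN. Qed.

Lemma bmeasM f g : bmeas f -> bmeas g -> bmeas (fun x => f x * g x).
Proof.
move=> [mf [C fC]] [mg [D gD]]; split; first exact: measurable_funM.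
by exists (C * D) => x; rewrite normrM ler_pM.
Qed.

Lemma bmeas_expR f : bmeas f -> bmeas (fun x => expR (f x)).
Proof.
move=> [mf [C fC]]; split; first exact: measurableT_comp.
exists (expR C) => x; rewrite ger0_norm ?expR_ge0// ler_expR.
by rewrite (le_trans (ler_norm _)).
Qed.

Lemma bmeas_norm_powR (a : R) f : 0 <= a -> bmeas f -> bmeas (fun x => `|f x| `^ a).
Proof.
move=> a0 [mf [C fC]]; split.
  by apply: (measurableT_comp (measurable_powR _)) => //; exact: measurableT_comp.
exists (C `^ a) => x; rewrite ger0_norm ?powR_ge0// ge0_ler_powR ?nnegrE//.
by rewrite (le_trans _ (fC x)).
Qed.

Variable P : probability T R.

Let total_mass : (P : {measure set T -> \bar R}) setT = 1%E.
Proof. exact: probability_setT. Qed.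

Lemma bmeas_integrable f : bmeas f -> P.-integrable setT (EFin \o f).
Proof.
move=> [mf [C fC]].
apply: (@le_integrable _ _ _ P setT measurableT (EFin \o f) (EFin \o cst C)).
- exact/measurable_EFinP.
- by move=> x _ /=; rewrite lee_fin (le_trans (fC x))// ler_norm.
- apply/integrableP; split; first exact/measurable_EFinP.
  by rewrite /= integral_cst// total_mass mule1 ltry.
Qed.

Lemma expectation_cst (c : R) : \int[P]_x c = c.
Proof. by rewrite Rintegral_cst// total_mass mulr1. Qed.

Lemma expectationD f g : bmeas f -> bmeas g ->
  \int[P]_x (f x + g x) = \int[P]_x f x + \int[P]_x g x.
Proof. by move=> bf bg; rewrite RintegralD//; exact: bmeas_integrable. Qed.

Lemma expectationB f g : bmeas f -> bmeas g ->
  \int[P]_x (f x - g x) = \int[P]_x f x - \int[P]_x g x.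
Proof. by move=> bf bg; rewrite RintegralB//; exact: bmeas_integrable. Qed.

Lemma expectationZ (c : R) f : bmeas f -> \int[P]_x (c * f x) = c * \int[P]_x f x.
Proof. by move=> bf; rewrite RintegralZl//; exact: bmeas_integrable. Qed.

Lemma le_expectation f g : bmeas f -> bmeas g -> (forall x, f x <= g x) ->
  \int[P]_x f x <= \int[P]_x g x.
Proof. by move=> bf bg fg; apply: le_Rintegral => //; exact: bmeas_integrable. Qed.

Lemma EFin_expectation f : bmeas f ->
  ((\int[P]_x f x)%:E = \int[P]_x (f x)%:E)%E.
Proof.
move=> bf; rewrite /Rintegral fineK//; apply: integrable_fin_num => //.
exact: bmeas_integrable.
Qed.

Lemma expectation_gt0 f : bmeas f -> (forall x, 0 < f x) -> 0 < \int[P]_x f x.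
Proof.
move=> bf f0; have [mf _] := bf.
rewrite lt_neqAle Rintegral_ge0 ?andbT; last by move=> z _; exact: ltW.
apply/eqP => /esym z0.
have I0 : (\int[P]_x (f x)%:E = 0)%E by rewrite -EFin_expectation// z0.
have mfE : measurable_fun setT (fun x => (f x)%:E) by exact/measurable_EFinP.
have := (ae_eq_integral_abs P measurableT mfE).1.
under eq_integral do rewrite gee0_abs ?lee_fin ?(ltW (f0 _))//.
move=> /(_ I0) [N [mN N0 sub]].
have NT : N = setT.
  apply/seteqP; split => // z _; apply: sub => /= /(_ I) [] /eqP.
  by rewrite gt_eqF.
by move: N0; rewrite NT total_mass => /eqP; rewrite onee_eq0.
Qed.

End bounded_measurable.

Lemma bmeas_comp d d' (T : measurableType d) (T' : measurableType d')
    (R : realType) (Y : T -> T') (f : T' -> R) :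
  measurable_fun setT Y -> bmeas f -> bmeas (fun x => f (Y x)).
Proof.
by move=> mY [mf [C fC]]; split; [exact: measurableT_comp|exists C].
Qed.

Section image_law.
Context d d' (T : measurableType d) (T' : measurableType d') (R : realType).
Variables (P : probability T R) (Q : probability T' R) (Y : T -> T').
Hypothesis mY : measurable_fun setT Y.
Hypothesis lawY : forall A, measurable A -> P (Y @^-1` A) = Q A.

Lemma ge0_integral_law (f : T' -> \bar R) : measurable_fun setT f ->
  (forall y, 0 <= f y)%E -> (\int[P]_x f (Y x) = \int[Q]_y f y)%E.
Proof.
move=> mf f0.
have := @ge0_integral_pushforward _ _ _ _ R _ mY P setT f measurableT mf.
rewrite preimage_setT => <-; last by move=> y _; exact: f0.
by apply: eq_measure_integral => A mA _; exact: lawY.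
Qed.

Lemma expectation_law (f : T' -> R) : bmeas f ->
  \int[P]_x f (Y x) = \int[Q]_y f y.
Proof.
move=> bf; have [mf [C fC]] := bf.
have bc : bmeas (fun y => f y + C) by apply: bmeasD => //; exact: bmeas_cst.
(* adding the bound [C] reduces to nonnegative functions *)
apply: (@addIr _ C).
rewrite -{1}(expectation_cst P C) -{2}(expectation_cst Q C).
rewrite -!expectationD//; [|exact: bmeas_cst|exact: bmeas_comp|exact: bmeas_cst].
have E := @ge0_integral_law (fun y => (f y + C)%:E).
rewrite /Rintegral E//.
- by apply/measurable_EFinP; case: bc.
- move=> y; rewrite lee_fin -lerBlDr sub0r.
  by have := fC y; rewrite ler_norml => /andP[].
Qed.

End image_law.

Section density.
Context d (T : measurableType d) (R : realType).
Variables (P : probability T R) (L : T -> R).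
Hypotheses (mL : measurable_fun setT L) (L0 : forall x, 0 <= L x).
Hypotheses (Z0 : (0 < \int[P]_x (L x)%:E)%E) (Zoo : (\int[P]_x (L x)%:E < +oo)%E).
Import HBNNSimple.

(** For indicators this is the definition of [mdensity]; monotone convergence
    carries it from simple to nonnegative measurable functions. *)
Lemma integral_mdensity (f : T -> \bar R) : measurable_fun setT f ->
  (forall x, 0 <= f x)%E ->
  (\int[mdensity P L]_x f x = \int[P]_x (f x * (L x)%:E))%E.
Proof.
move=> mf f0.
have mLE : measurable_fun setT (fun x => (L x)%:E) by exact/measurable_EFinP.
pose f_ := nnsfun_approx measurableT mf.
transitivity (limn (fun n => \int[mdensity P L]_x (f_ n x)%:E)%E).
  rewrite -monotone_convergence//.
  - apply: eq_integral => y _; apply/esym/cvg_lim => //.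
    by apply: cvg_nnsfun_approx => // *; exact: f0.
  - by move=> n; exact/measurable_EFinP/measurable_funP.
  - by move=> n y _; rewrite lee_fin.
  - by move=> y _ m n mn; rewrite lee_fin; exact/lefP/nd_nnsfun_approx.
transitivity (limn (fun n => \int[P]_x ((f_ n x)%:E * (L x)%:E))%E); last first.
  rewrite -monotone_convergence//.
  - apply: eq_integral => y _; apply/cvg_lim => //; apply: cvgeZr => //.
    by apply: cvg_nnsfun_approx => // *; exact: f0.
  - move=> n; apply: emeasurable_funM => //.
    exact/measurable_EFinP/measurable_funP.
  - by move=> n y _; rewrite mule_ge0 ?lee_fin.
  - move=> y _ m n mn; rewrite lee_wpmul2r ?lee_fin//.
    exact/lefP/nd_nnsfun_approx.
congr (limn _); apply/funext => n.
rewrite integralT_nnsfun sintegralE.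
transitivity (\sum_(k \in range (f_ n))
    \int[P]_x ((k * \1_(f_ n @^-1` [set k]) x)%:E * (L x)%:E))%E; last first.
  rewrite -ge0_integral_fsum//.
  - apply: eq_integral => x _; rewrite fimfunE -fsumEFin//.
    rewrite ge0_mule_fsuml// => k.
    by rewrite nnfun_muleindic_ge0.
  - move=> k; apply: emeasurable_funM => //.
    exact/measurable_EFinP/measurable_funM.
  - by move=> k x _; rewrite mule_ge0 ?nnfun_muleindic_ge0// lee_fin.
apply: eq_fsbigr => k /set_mem [x _ <-].
rewrite /= /mdensity asboolT//.
under [RHS]eq_integral do rewrite EFinM -muleA.
rewrite ge0_integralZl//; last 3 first.
- apply: emeasurable_funM => //; exact/measurable_EFinP.
- by move=> y _; rewrite mule_ge0// lee_fin.
- by rewrite lee_fin.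
congr (_ * _)%E; rewrite [LHS]integral_mkcond; apply: eq_integral => y _.
rewrite patchE indicE; case: ifP => _; by rewrite ?mul1e ?mul0e.
Qed.

Lemma integral_posterior (f : T -> \bar R) : measurable_fun setT f ->
  (forall x, 0 <= f x)%E ->
  (\int[posterior P L]_x f x =
     ((fine (\int[P]_x (L x)%:E))^-1)%:E * \int[P]_x (f x * (L x)%:E))%E.
Proof.
move=> mf f0; set Z := fine _.
have Zpos : (0 < Z)%R by rewrite fine_gt0// Z0.
have ZV : (0 <= Z^-1)%R by rewrite invr_ge0 ltW.
transitivity (\int[mscale (NngNum ZV) (mdensity P L)]_x f x)%E.
  apply: eq_measure_integral => A mA _; rewrite [LHS]posteriorE//.
  by rewrite /= /mscale/= /mdensity asboolT.
by rewrite ge0_integral_mscale// integral_mdensity.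
Qed.

Lemma expectation_posterior (f : T -> R) : bmeas L -> bmeas f ->
  \int[posterior P L]_x f x = (\int[P]_x (f x * L x)) / \int[P]_x L x.
Proof.
move=> bL bf; have [mf [C fC]] := bf.
have bc : bmeas (fun y => f y + C) by apply: bmeasD => //; exact: bmeas_cst.
have Zpos : 0 < \int[P]_x L x by rewrite fine_gt0// Z0.
have bfL : bmeas (fun x => f x * L x) by exact: bmeasM.
(* adding the bound [C] reduces to nonnegative functions *)
apply: (@addIr _ C).
rewrite -{1}(expectation_cst (posterior P L) C).
rewrite -expectationD//; last exact: bmeas_cst.
have -> : \int[P]_x (f x * L x) / \int[P]_x L x + C =
   (\int[P]_x L x)^-1 * \int[P]_x ((f x + C) * L x).
  have -> : \int[P]_x ((f x + C) * L x) = \int[P]_x (f x * L x + C * L x).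
    by apply: eq_Rintegral => x _; rewrite mulrDl.
  rewrite expectationD//; last by apply: bmeasM => //; exact: bmeas_cst.
  rewrite expectationZ//; field; by rewrite gt_eqF.
apply: EFin_inj; rewrite EFinM !EFin_expectation//; last exact: bmeasM.
rewrite integral_posterior//.
- by apply/measurable_EFinP; case: bc.
- move=> y; rewrite lee_fin -lerBlDr sub0r.
  by have := fC y; rewrite ler_norml => /andP[].
Qed.

End density.

Lemma expectation_posterior_gt0 d (T : measurableType d) (R : realType)
    (P : probability T R) (L f : T -> R) :
  bmeas L -> (forall x, 0 < L x) -> bmeas f ->
  \int[posterior P L]_x f x = (\int[P]_x (f x * L x)) / \int[P]_x L x.
Proof.
move=> bL L0 bf; have [mL _] := bL.
apply: expectation_posterior => //; first by move=> x; exact: ltW.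
  by rewrite -EFin_expectation// lte_fin expectation_gt0.
by rewrite -EFin_expectation// ltry.
Qed.

(** * Centering in L^p *)

Section centering.
Context {R : realType} (p : R).

(** The centering inequality for a variable of mean [1] that takes the value [t2]
    with probability [(1 - t1) / (t2 - t1)] and the value [t1] otherwise. *)
Let two_sided (t1 t2 : R) : 1 < p -> t1 < 1 -> 1 < t2 ->
  (1 - t1) * (`|t2 - 1| `^ p - gamma_const p `^ p * `|t2| `^ p)
  + (t2 - 1) * (`|t1 - 1| `^ p - gamma_const p `^ p * `|t1| `^ p) <= 0.
Proof.
move=> p1 t11 t21; have p0 : 0 < p by lra.
have D0 : 0 < t2 - t1 by lra.
pose a := (1 - t1) / (t2 - t1).
have aD : a * (t2 - t1) = 1 - t1 by rewrite /a divfK// gt_eqF.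
have a0 : 0 < a by rewrite divr_gt0//; lra.
move: a aD a0 => a aD a0.
have bD : (1 - a) * (t2 - t1) = t2 - 1 by rewrite mulrBl aD; ring.
have b0 : 0 < 1 - a by rewrite -(pmulr_lgt0 _ D0) bD; lra.
have a01 : 0 < a < 1 by rewrite a0; lra.
have := gamma_fun_two_point p1 a01 (normr_ge0 t2) (normr_ge0 t1).
rewrite -{1}aD -{2}bD; set D := t2 - t1 in D0 aD bD *.
have -> : `|t2 - 1| = (1 - a) * D by rewrite -bD gtr0_norm// mulr_gt0.
have -> : `|t1 - 1| = a * D by rewrite distrC -aD gtr0_norm// mulr_gt0.
have ga : gamma_fun p a `^ p <= gamma_const p `^ p.
  rewrite ge0_ler_powR ?nnegrE ?(ltW p0)//.
  - by rewrite /gamma_fun mulr_ge0 ?powR_ge0.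
  - by have := gamma_ge1 p1; lra.
  - by apply: gamma_fun_le => //; rewrite !ltW//; lra.
have DD : D `^ p <= (`|t2| + `|t1|) `^ p.
  rewrite ge0_ler_powR ?nnegrE ?(ltW D0) ?(ltW p0) ?addr_ge0//.
  by rewrite /D; apply: le_trans (ler_normB _ _); rewrite ler_norm.
have EX (c : R) : 0 < c -> c `^ p = c * c `^ (p - 1).
  by move=> c0; rewrite mulr_powRB1// ltW.
rewrite (powRM p (ltW b0) (ltW D0)) (powRM p (ltW a0) (ltW D0)) (EX a)// (EX (1 - a))//.
set U1 := a `^ _; set U2 := (1 - a) `^ _; set DP := D `^ p in DD *.
set SP := (_ + _) `^ p in DD *; set X := `|t2| `^ p; set Y := `|t1| `^ p.
set GP := gamma_fun p a `^ p in ga *; set CP := gamma_const p `^ p in ga *.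
move=> H.
have h1 : a * (1 - a) * (U1 + U2) * DP <= a * (1 - a) * (U1 + U2) * SP.
  by rewrite ler_wpM2l// mulr_ge0 ?addr_ge0 ?powR_ge0// mulr_ge0 ?ltW.
have h2 : GP * (a * X + (1 - a) * Y) <= CP * (a * X + (1 - a) * Y).
  by rewrite ler_wpM2r// addr_ge0// mulr_ge0 ?powR_ge0// ltW.
have : D * (a * (1 - a) * (U1 + U2) * DP - CP * (a * X + (1 - a) * Y)) <= 0.
  by rewrite pmulr_rle0//; lra.
by apply: le_trans; rewrite le_eqVlt; apply/orP; left; apply/eqP; ring.
Qed.

(** Separation of the slopes at [1]: by the two-point inequality every slope of
    [t |-> |t - 1| ^ p - gamma ^ p |t| ^ p] between [1] and the right lies below
    every slope between [1] and the left, so that a line through [(1, 0)]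
    dominates the function. *)
Lemma gamma_tangent : 1 < p -> exists beta, forall t : R,
  `|t - 1| `^ p <= gamma_const p `^ p * `|t| `^ p + beta * (t - 1).
Proof.
move=> p1; pose F t := `|t - 1| `^ p - gamma_const p `^ p * `|t| `^ p.
pose S := [set F t / (t - 1) | t in [set t | 1 < t]].
have SP t1 t2 : t1 < 1 -> 1 < t2 -> F t2 / (t2 - 1) <= F t1 / (t1 - 1).
  move=> t11 t21; rewrite ler_pdivrMr ?subr_gt0//.
  rewrite -(ler_pM2r (_ : 0 < 1 - t1)) ?subr_gt0//.
  have -> : F t1 / (t1 - 1) * (t2 - 1) * (1 - t1) = - ((t2 - 1) * F t1).
    by field; rewrite subr_eq0 lt_eqF.
  by have := two_sided p1 t11 t21; rewrite -!/(F _) mulrC; lra.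
have S0 : S !=set0 by exists (F 2 / (2 - 1)), 2 => //=; lra.
have ubS : ubound S (F 0 / (0 - 1)) by move=> _ [t t1 <-]; exact: SP.
exists (sup S) => t; rewrite -lerBlDl -/(F t).
have [t1|t1|->] := ltgtP t 1.
- have h : sup S <= F t / (t - 1) by apply: ge_sup => // _ [u u1 <-]; exact: SP.
  by rewrite -(ler_ndivlMr _ _ (_ : t - 1 < 0)) ?subr_lt0.
- have h : F t / (t - 1) <= sup S.
    by apply: ub_le_sup; [exists (F 0 / (0 - 1))|exists t].
  by rewrite -ler_pdivrMr ?subr_gt0.
- rewrite /F subrr normr0 mulr0 normr1 powR1 powR0 ?gt_eqF//; last by lra.
  by rewrite mulr1 sub0r oppr_le0 powR_ge0.
Qed.

(** [gamma_const p] bounds the norm on [L^p] of the centering [h |-> h - E h]: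
    rescale [h] to have mean [1] and integrate [gamma_tangent], whose linear term
    then has mean [0]. *)
Lemma centering_bound d (T : measurableType d) (P : probability T R) (h : T -> R) :
  1 < p -> bmeas h ->
  \int[P]_x (`|h x - \int[P]_z h z| `^ p)
    <= gamma_const p `^ p * \int[P]_x (`|h x| `^ p).
Proof.
move=> p1 bh; have p0 : 0 <= p by lra.
set m := \int[P]_z h z.
have bhp := bmeas_norm_powR p0 bh.
have bhm : bmeas (fun x => `|h x - m| `^ p).
  by apply: bmeas_norm_powR => //; apply: bmeasB => //; exact: bmeas_cst.
rewrite -expectationZ//; have [m0|m0] := eqVneq m 0.
  apply: le_expectation => //; first by apply: bmeasM => //; exact: bmeas_cst.
  move=> x; rewrite m0 subr0 ler_peMl ?powR_ge0//.
  have -> : 1 = 1 `^ p :> R by rewrite powR1.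
  have := gamma_ge1 p1 => g1.
  by rewrite ge0_ler_powR ?nnegrE//; lra.
have [beta betaP] := gamma_tangent p1.
have b1 : bmeas (fun x => gamma_const p `^ p * `|h x| `^ p).
  by apply: bmeasM => //; exact: bmeas_cst.
have b2 : bmeas (fun x => `|m| `^ p * beta / m * (h x - m)).
  by apply: bmeasM; [exact: bmeas_cst|apply: bmeasB => //; exact: bmeas_cst].
have -> : \int[P]_x (gamma_const p `^ p * `|h x| `^ p) =
  \int[P]_x (gamma_const p `^ p * `|h x| `^ p + `|m| `^ p * beta / m * (h x - m)).
  have bc : bmeas (fun x => h x - m) by apply: bmeasB => //; exact: bmeas_cst.
  rewrite [RHS]expectationD// (expectationZ P _ bc) expectationB//; last exact: bmeas_cst.
  by rewrite expectation_cst subrr mulr0 addr0.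
apply: le_expectation => //; first exact: bmeasD.
move=> x; have -> : h x - m = m * (h x / m - 1) by field.
rewrite normrM powRM//.
have -> : h x = m * (h x / m) by field.
have -> : m * (h x / m) / m = h x / m by field.
rewrite [`|m * (h x / m)|]normrM powRM// mulrCA.
have -> : `|m| `^ p * beta / m * (m * (h x / m - 1)) = `|m| `^ p * (beta * (h x / m - 1)).
  by field.
by rewrite -mulrDr ler_wpM2l ?powR_ge0.
Qed.

End centering.

(** * The Hopf-Lax semigroup *)

Section power_inequalities.
Context {R : realType}.

(** Convexity of [x |-> x ^ p], from Young's inequality for [a] and
    [b ^ (p - 1)]. *)
Lemma powR_tangent (p a b : R) : 1 < p -> 0 <= a -> 0 <= b ->
  b `^ p - a `^ p <= p * b `^ (p - 1) * (b - a).
Proof.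
move=> p1 a0 b0; have p0 : 0 < p by lra.
have q0 : 0 < conj_exp p by have := conj_exp_gt1 p1; lra.
have := @conjugate_powR R a (b `^ (p - 1)) p (conj_exp p) a0 (powR_ge0 _ _) p0 q0 (conj_exp_addV p1).
have -> : (b `^ (p - 1)) `^ conj_exp p = b `^ p.
  by rewrite -powRrM; congr (_ `^ _); rewrite /conj_exp mulrCA mulfV ?mulr1// subr_eq0 gt_eqF.
have -> : (conj_exp p)^-1 = (p - 1) / p by rewrite /conj_exp invf_div.
have bE : b `^ p = b * b `^ (p - 1) by rewrite mulr_powRB1.
set B := b `^ (p - 1) in bE *; rewrite bE; set A := a `^ p.
move=> /(ler_wpM2l (ltW p0)).
have -> : p * (A / p + b * B * ((p - 1) / p)) = A + b * B * (p - 1).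
  by field; rewrite gt_eqF.
lra.
Qed.

Lemma powR_secant (p a b c delta : R) : 1 < p -> 0 <= a -> 0 <= b <= c -> 0 <= delta ->
  b <= a + delta -> b `^ p - a `^ p <= p * c `^ (p - 1) * delta.
Proof.
move=> p1 a0 /andP[b0 bc] d0 bad.
apply: le_trans (powR_tangent p1 a0 b0) _.
apply: (@le_trans _ _ (p * b `^ (p - 1) * delta)).
  by rewrite ler_wpM2l ?mulr_ge0 ?powR_ge0//; lra.
by rewrite ler_wpM2r// ler_wpM2l ?ge0_ler_powR ?nnegrE//; lra.
Qed.

(** Convexity of [t |-> t ^ (1 - p)], from [1 + x <= expR x] used twice. *)
Lemma powRN_tangent (p t h : R) : 1 < p -> 0 < t -> 0 < h ->
  (p - 1) * h * (t + h) `^ (- p) <= t `^ (1 - p) - (t + h) `^ (1 - p).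
Proof.
move=> p1 t0 h0; set s := t + h.
have s0 : 0 < s by rewrite /s; lra.
have E1 : s `^ (- p) = s `^ (1 - p) / s.
  rewrite -[s^-1]powR_inv1 ?(ltW s0)// -powRD_gt0//; congr (_ `^ _); ring.
have E2 : t `^ (1 - p) = s `^ (1 - p) * (s / t) `^ (p - 1).
  rewrite powRM ?invr_ge0 ?ltW// mulrA -powRD_gt0//.
  have -> : 1 - p + (p - 1) = 0 by ring.
  rewrite powRr0 mul1r -[t^-1]powR_inv1 ?(ltW t0)// -powRrM; congr (_ `^ _); ring.
have u0 : 0 < s / t by rewrite divr_gt0.
have lnu : 1 - t / s <= ln (s / t).
  have := expR_ge1Dx (- ln (s / t)).
  have -> : t / s = expR (- ln (s / t)) by rewrite expRN lnK ?posrE// invf_div.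
  lra.
have := expR_ge1Dx ((p - 1) * ln (s / t)); rewrite -powR_expR//.
have : (p - 1) * (1 - t / s) <= (p - 1) * ln (s / t) by rewrite ler_wpM2l//; lra.
have -> : 1 - t / s = h / s by rewrite /s; field; rewrite gt_eqF.
rewrite E1 E2; set U := _ `^ (p - 1) => H1 H2.
have -> : s `^ (1 - p) * U - s `^ (1 - p) = s `^ (1 - p) * (U - 1) by ring.
have -> : (p - 1) * h * (s `^ (1 - p) / s) = s `^ (1 - p) * ((p - 1) * (h / s)) by ring.
by rewrite ler_wpM2l ?powR_ge0//; lra.
Qed.

End power_inequalities.

Section hopf_lax.
Context {R : realType} {X : metricType R} (p : R).
Implicit Types (f : X -> R) (t : R).

(** The Hopf-Lax semigroup of the cost [r ^ p / t ^ (p - 1)]. *)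
Definition hopf_lax t f (x : X) : R :=
  inf [set f y + mdist x y `^ p / t `^ (p - 1) | y in [set: X]].

Local Notation cost t r := (r `^ p / t `^ (p - 1)).

Lemma cost_ge0 t r : 0 <= cost t r :> R.
Proof. by rewrite divr_ge0 ?powR_ge0. Qed.

Section bounded.
Variables (f : X -> R) (A : R).
Hypothesis fA : forall x, `|f x| <= A.

Let fA1 x : - A <= f x. Proof. by have := fA x; rewrite ler_norml => /andP[]. Qed.
Let fA2 x : f x <= A. Proof. by have := fA x; rewrite ler_norml => /andP[]. Qed.

Lemma hopf_lax_ge t x c :
  (forall y, c <= f y + cost t (mdist x y)) -> c <= hopf_lax t f x.
Proof.
move=> cf; apply: lb_le_inf; first by exists (f x + cost t (mdist x x)), x.
by move=> _ [y _ <-].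
Qed.

Lemma hopf_lax_le t x y : hopf_lax t f x <= f y + cost t (mdist x y).
Proof.
apply: ge_inf; last by exists y.
by exists (- A) => _ [z _ <-]; rewrite -[- A]addr0 lerD// cost_ge0.
Qed.

Lemma hopf_lax_adherent t x e : 0 < e ->
  exists y, f y + cost t (mdist x y) < hopf_lax t f x + e.
Proof.
move=> e0; have [] := @inf_adherent _ [set f y + cost t (mdist x y) | y in [set: X]] _ e0.
  split; first by exists (f x + cost t (mdist x x)), x.
  by exists (- A) => _ [z _ <-]; rewrite -[- A]addr0 lerD// cost_ge0.
by move=> _ [y _ <-] ?; exists y.
Qed.

Lemma hopf_lax_bounded t x : 1 < p -> `|hopf_lax t f x| <= A.
Proof.
move=> p1; rewrite ler_norml; apply/andP; split.
  by apply: hopf_lax_ge => y; rewrite -[- A]addr0 lerD// cost_ge0.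
apply: le_trans (hopf_lax_le t x x) _.
by rewrite mdistxx powR0 ?mul0r ?addr0//; apply: lt0r_neq0; lra.
Qed.

(** Almost minimisers lie in the ball of radius [radius t]: farther away the cost
    exceeds [A + A], a bound of the oscillation of [f], by more than [1]. *)
Let radius t := ((A + A + 1) * t `^ (p - 1)) `^ p^-1.

Let radiusP t x y e : 1 < p -> 0 < t -> e <= 1 ->
  f y + cost t (mdist x y) <= hopf_lax t f x + e -> mdist x y <= radius t.
Proof.
move=> p1 t0 e1 H; have p0 : 0 < p by lra.
have tp : 0 < t `^ (p - 1) by rewrite powR_gt0.
have : cost t (mdist x y) <= A + A + 1.
  have /(le_trans (ler_norm _)) := hopf_lax_bounded t x p1.
  by have := fA1 y; lra.
rewrite ler_pdivrMr// => H2.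
rewrite -[leLHS]powRr1 ?mdist_ge0//.
have -> : 1 = p * p^-1 by rewrite mulfV// gt_eqF.
rewrite powRrM ge0_ler_powR ?nnegrE ?powR_ge0 ?invr_ge0 ?(ltW p0)//.
exact: le_trans (powR_ge0 _ _) H2.
Qed.

Let cost_secant t a b c delta : 1 < p -> 0 < t -> 0 <= a -> 0 <= b <= c -> 0 <= delta ->
  b <= a + delta -> cost t b - cost t a <= p * (c / t) `^ (p - 1) * delta.
Proof.
move=> p1 t0 a0 bc d0 bad; rewrite -mulrBl.
have c0 : 0 <= c by case/andP: bc => /le_trans h /h.
rewrite powRM// ?invr_ge0 ?(ltW t0)//.
have -> : t^-1 `^ (p - 1) = (t `^ (p - 1))^-1.
  by rewrite -[t^-1]powR_inv1 ?(ltW t0)// -powRrM mulN1r powRN.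
have := powR_secant p1 a0 bc d0 bad.
rewrite -(ler_pM2r (_ : 0 < (t `^ (p - 1))^-1)) ?invr_gt0 ?powR_gt0//.
by move=> /le_trans; apply; rewrite le_eqVlt; apply/orP; left; apply/eqP; ring.
Qed.

Let hopf_lax_locally_lip t x x' : 1 < p -> 0 < t -> mdist x x' <= 1 ->
  hopf_lax t f x' - hopf_lax t f x <= p * ((radius t + 1) / t) `^ (p - 1) * mdist x x'.
Proof.
move=> p1 t0 xx'; apply/ler_addgt0Pl => e e0.
have m0 : 0 < Num.min e 1 by rewrite lt_min e0 ltr01.
have [y yP] := hopf_lax_adherent t x m0.
have dxy : mdist x y <= radius t.
  by apply: radiusP (ltW yP) => //; rewrite ge_min lexx orbT.
have tri : mdist x' y <= mdist x y + mdist x x'.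
  by rewrite (metric_sym x x') addrC metric_triangle.
have B : 0 <= mdist x' y <= radius t + 1 by rewrite mdist_ge0/=; lra.
have := cost_secant p1 t0 (mdist_ge0 x y) B (mdist_ge0 x x') tri.
have := hopf_lax_le t x' y.
have : Num.min e 1 <= e by rewrite ge_min lexx.
lra.
Qed.

Lemma hopf_lax_lipschitz t : 1 < p -> 0 < t -> exists2 C, 0 <= C &
  forall x x', `|hopf_lax t f x - hopf_lax t f x'| <= C * mdist x x'.
Proof.
move=> p1 t0; set L := p * ((radius t + 1) / t) `^ (p - 1).
have L0 : 0 <= L by rewrite mulr_ge0 ?powR_ge0//; lra.
exists (L + (`|A| + `|A|)) => [|x x']; first by rewrite !addr_ge0.
have d0 := mdist_ge0 x x'.
have [xx'|/ltW xx'] := leP (mdist x x') 1.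
  apply: (@le_trans _ _ (L * mdist x x')); last first.
    by rewrite ler_wpM2r// lerDl addr_ge0.
  rewrite ler_norml; apply/andP; split.
    by have := hopf_lax_locally_lip p1 t0 xx'; rewrite -/L; lra.
  by rewrite metric_sym; apply: hopf_lax_locally_lip => //; rewrite metric_sym.
apply: (@le_trans _ _ ((`|A| + `|A|) * mdist x x')); last first.
  by rewrite ler_wpM2r// lerDr.
apply: (@le_trans _ _ (`|A| + `|A|)); last by rewrite ler_peMr// addr_ge0.
rewrite (le_trans (ler_normB _ _))// lerD// (le_trans (hopf_lax_bounded _ _ p1))//;
  exact: ler_norm.
Qed.

(** The number [D] is the limit as [eta] tends to [0] of the largest distance
    from [x] to an [eta]-minimiser. *)
Let minimiser_distance t x : 1 < p -> 0 < t -> exists D, [/\ 0 <= D,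
  forall eta e, 0 < eta -> 0 < e ->
    exists2 y, f y + cost t (mdist x y) <= hopf_lax t f x + eta & D - e < mdist x y &
  forall e, 0 < e -> exists2 eta, 0 < eta <= 1 &
    forall y, f y + cost t (mdist x y) <= hopf_lax t f x + eta -> mdist x y <= D + e].
Proof.
move=> p1 t0.
pose S eta := [set mdist x y | y in [set y | f y + cost t (mdist x y) <= hopf_lax t f x + eta]].
have S0 eta : 0 < eta -> S eta !=set0.
  by move=> /(hopf_lax_adherent t x)[y /ltW yP]; exists (mdist x y), y.
have Sub eta : eta <= 1 -> has_ubound (S eta).
  by move=> e1; exists (radius t) => _ [y yP <-]; exact: radiusP yP.
pose M := [set sup (S eta) | eta in [set eta | 0 < eta <= 1]].
have sup0 eta : 0 < eta <= 1 -> 0 <= sup (S eta).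
  move=> /andP[e0 e1]; have [r Sr] := S0 _ e0.
  apply: (@le_trans _ _ r); first by case: Sr => y _ <-; exact: mdist_ge0.
  by apply: ub_le_sup => //; exact: Sub.
have M0 : M !=set0 by exists (sup (S 1)), 1 => //=; rewrite ltr01 lexx.
have Mlb : has_lbound M by exists 0 => _ [eta e01 <-]; exact: sup0.
exists (inf M); split.
- by apply: lb_le_inf => // _ [eta e01 <-]; exact: sup0.
- move=> eta e eta0 e0; pose eta' := Num.min eta 1.
  have e'01 : 0 < eta' <= 1 by rewrite lt_min eta0 ltr01 ge_min lexx orbT.
  have h : inf M <= sup (S eta') by apply: ge_inf => //; exists eta'.
  have /andP[e'0 e'1] := e'01.
  have [_ [y yP <-] yS] := sup_adherent e0 (conj (S0 _ e'0) (Sub _ e'1)).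
  exists y; last by lra.
  by apply: le_trans yP _; rewrite lerD2l ge_min lexx.
- move=> e e0; have [_ [eta e01 <-] etaM] := inf_adherent e0 (conj M0 Mlb).
  exists eta => // y yP; apply: le_trans (ltW etaM).
  apply: ub_le_sup; first by apply: Sub; case/andP: e01.
  by exists y.
Qed.

(** For [x'] close to [x], almost minimisers for [x'] are almost minimisers for
    [x]; so moving [x] changes the infimum at the rate of the cost at distance
    [D]. *)
Let local_slope t x D : 1 < p -> 0 < t -> 0 <= D ->
  (forall e, 0 < e -> exists2 eta, 0 < eta <= 1 &
    forall y, f y + cost t (mdist x y) <= hopf_lax t f x + eta -> mdist x y <= D + e) ->
  forall e, 0 < e -> exists2 d0, 0 < d0 &
    forall x', mdist x x' < d0 -> `|hopf_lax t f x' - hopf_lax t f x| <=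
      (e + p * ((D + (e + e)) / t) `^ (p - 1)) * mdist x x'.
Proof.
move=> p1 t0 D0 nearD e e0.
have [eta /andP[eta0 eta1] etaP] := nearD e e0.
set C := p * ((radius t + 1) / t) `^ (p - 1).
have C0 : 0 <= C by rewrite mulr_ge0 ?powR_ge0//; lra.
pose d0 := Num.min (Num.min e 1) (eta / (C + C + 1)).
have d00 : 0 < d0 by rewrite !lt_min e0 ltr01 divr_gt0//; lra.
exists d0 => // x'; set d := mdist x x'; rewrite !lt_min => /andP[/andP[de d1] deta].
have dge0 : 0 <= d by exact: mdist_ge0.
move: deta; rewrite ltr_pdivlMr; last by lra.
move=> deta.
have [d0'|dneq0] := eqVneq d 0.
  have xx' : x = x' by exact: mdist_positivity d0'.
  by rewrite -xx' subrr normr0 d0' mulr0.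
have dpos : 0 < d by rewrite lt_neqAle eq_sym dneq0.
have dd : 0 < d * d by rewrite mulr_gt0.
have dde : d * d <= e * d by rewrite ler_wpM2r// ltW.
have dd1 : d * d <= d by rewrite -[leRHS]mul1r ler_wpM2r// ltW.
set B := p * _ `^ _.
have mono c : 0 <= c <= D + (e + e) -> p * (c / t) `^ (p - 1) * d <= B * d.
  move=> /andP[c0 cD]; rewrite ler_wpM2r// ler_wpM2l//; first by lra.
  rewrite ge0_ler_powR ?nnegrE ?divr_ge0 ?(ltW t0)//; [lra|lra|].
  by rewrite ler_wpM2r// invr_ge0 ltW.
rewrite ler_norml; apply/andP; split; last first.
  have m0 : 0 < Num.min eta (d * d) by rewrite lt_min eta0.
  have [y /ltW yP] := hopf_lax_adherent t x m0.
  have m1 : Num.min eta (d * d) <= eta by rewrite ge_min lexx.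
  have m2 : Num.min eta (d * d) <= d * d by rewrite ge_min lexx orbT.
  have dxy : mdist x y <= D + e by apply: etaP; lra.
  have tri : mdist x' y <= mdist x y + d.
    by rewrite /d (metric_sym x x') addrC metric_triangle.
  have bc : 0 <= mdist x' y <= D + (e + e) by rewrite mdist_ge0/=; lra.
  have := cost_secant p1 t0 (mdist_ge0 x y) bc dge0 tri.
  rewrite -/B; have := hopf_lax_le t x' y; lra.
have [y /ltW yP] := hopf_lax_adherent t x' dd.
have dx'y : mdist x' y <= radius t by apply: radiusP yP => //; lra.
have tri : mdist x y <= mdist x' y + d by rewrite addrC metric_triangle.
have bc1 : 0 <= mdist x y <= radius t + 1 by rewrite mdist_ge0/=; lra.
have H1 := cost_secant p1 t0 (mdist_ge0 x' y) bc1 dge0 tri.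
have H2 := @hopf_lax_locally_lip t x x' p1 t0 (ltW d1).
rewrite -/C -/d in H1 H2.
have dxy : mdist x y <= D + e by apply: etaP; lra.
have bc : 0 <= mdist x y <= D + (e + e) by rewrite mdist_ge0/=; lra.
have := cost_secant p1 t0 (mdist_ge0 x' y) bc dge0 tri.
rewrite -/B; have := hopf_lax_le t x y; lra.
Qed.

(** Testing the infimum defining [hopf_lax (t + h) f x] with minimisers at time
    [t] that realise the distance [D]. *)
Let time_decrease t h x D : 1 < p -> 0 < t -> 0 < h -> 0 <= D ->
  (forall eta e, 0 < eta -> 0 < e ->
    exists2 y, f y + cost t (mdist x y) <= hopf_lax t f x + eta & D - e < mdist x y) ->
  (p - 1) * D `^ p * h * (t + h) `^ (- p) <= hopf_lax t f x - hopf_lax (t + h) f x.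
Proof.
move=> p1 t0 h0 D0 DP.
have s0 : 0 < t + h by lra.
set c := t `^ (1 - p) - (t + h) `^ (1 - p).
have costE u r : 0 < u -> cost u r = r `^ p * u `^ (1 - p).
  by move=> u0; rewrite -powRN opprB.
have tan := powRN_tangent p1 t0 h0; rewrite -/c in tan.
have c0 : 0 <= c.
  by apply: le_trans tan; rewrite !mulr_ge0 ?powR_ge0//; lra.
suff: D `^ p * c <= hopf_lax t f x - hopf_lax (t + h) f x.
  apply: le_trans.
  have := ler_wpM2l (powR_ge0 D p) tan; apply: le_trans.
  by rewrite le_eqVlt; apply/orP; left; apply/eqP; ring.
apply/ler_addgt0Pl => eps eps0.
have e20 : 0 < eps / 2 by lra.
have k0 : 0 <= p * D `^ (p - 1) * c by rewrite !mulr_ge0 ?powR_ge0//; lra.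
have [e e0 eP] : exists2 e, 0 < e & D `^ p * c - eps / 2 <= (Num.max 0 (D - e)) `^ p * c.
  have k1 : 0 < p * D `^ (p - 1) * c + 1 by lra.
  have [e eE] : exists e, e * (p * D `^ (p - 1) * c + 1) = eps / 2.
    by exists (eps / 2 / (p * D `^ (p - 1) * c + 1)); rewrite divfK// gt_eqF.
  have e0 : 0 < e by rewrite -(pmulr_lgt0 _ k1) eE.
  exists e => //.
  have m0 : 0 <= Num.max 0 (D - e) by rewrite le_max lexx.
  have mD : D - Num.max 0 (D - e) <= e.
    have : D - e <= Num.max 0 (D - e) by rewrite le_max lexx orbT.
    lra.
  have := powR_tangent p1 m0 D0 => /(ler_wpM2r c0).
  have := ler_wpM2l k0 mD; lra.
have [y yP Dy] := DP (eps / 2) e e20 e0.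
have := hopf_lax_le (t + h) x y; rewrite !costE// in yP *.
have : (Num.max 0 (D - e)) `^ p * c <= mdist x y `^ p * c.
  rewrite ler_wpM2r// ge0_ler_powR ?nnegrE ?mdist_ge0//; [lra| |].
    by rewrite le_max lexx.
  by rewrite ge_max mdist_ge0 ltW.
rewrite [X in _ <= X -> _]mulrBr; lra.
Qed.

(** The Hamilton-Jacobi inequality: one number [D], the distance to the farthest
    almost minimisers, bounds the slope in space from above by
    [p * (D / t) ^ (p - 1)] and the decrease in time from below by the rate
    [(p - 1) * (D / t) ^ p], which is [legendre_const p] times the [q]-th power of
    that slope. *)
Lemma hopf_lax_hamilton_jacobi t x : 1 < p -> 0 < t -> exists D, [/\ 0 <= D,
  (forall e, 0 < e -> exists2 d0, 0 < d0 &
    forall x', mdist x x' < d0 -> `|hopf_lax t f x' - hopf_lax t f x| <=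
      (e + p * ((D + (e + e)) / t) `^ (p - 1)) * mdist x x') &
  forall h, 0 < h ->
    (p - 1) * D `^ p * h * (t + h) `^ (- p) <= hopf_lax t f x - hopf_lax (t + h) f x].
Proof.
move=> p1 t0; have [D [D0 D1 D2]] := minimiser_distance x p1 t0.
by exists D; split => // [|h h0]; [exact: local_slope|exact: time_decrease].
Qed.

End bounded.
End hopf_lax.

(** * Measurability, and the Poincare inequality for the semigroup *)

Section metric_measurability.
Context {R : realType} {X : completeMetricType R}.

Lemma lipschitz_measurable (f : X -> R) (C : R) :
  (forall x y, `|f x - f y| <= C * mdist x y) ->
  measurable_fun [set: borel X] (f : borel X -> R).
Proof.
move=> lf; have cf : continuous f.
  move=> x; apply/cvgrPdist_lt => e e0.
  apply/nbhs_ballP; exists (e / (`|C| + 1)) => /=; first by rewrite divr_gt0// ltr_pwDr.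
  move=> y; rewrite ballEmdist/= ltr_pdivlMr ?ltr_pwDr// => h.
  apply: le_lt_trans (lf x y) _; apply: le_lt_trans h.
  rewrite mulrDr mulr1 (le_trans (ler_wpM2r (mdist_ge0 _ _) (ler_norm C)))//.
  by rewrite mulrC lerDl mdist_ge0.
apply: (measurability _ (RGenOInfty.measurableE R)) => _ [_ [a ->] <-].
rewrite setTI; apply: sub_sigma_algebra.
by apply: open_comp; [move=> x _; exact: cf|rewrite set_itvoy; exact: open_gt].
Qed.

Lemma mdist_lipschitz (a x y : X) : `|mdist x a - mdist y a| <= 1 * mdist x y.
Proof.
rewrite mul1r ler_norml; apply/andP; split.
  by have := metric_triangle y x a; rewrite (metric_sym y x); lra.
by have := metric_triangle x y a; lra.
Qed.

Lemma measurable_mdist (a : X) : measurable_fun [set: borel X] (fun x : borel X => mdist (x : X) a).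
Proof. by apply: (@lipschitz_measurable _ 1) => x y; exact: mdist_lipschitz. Qed.

Lemma separable_dense_seq (a : X) : separable X ->
  exists u : nat -> X, forall x e, 0 < e -> exists n, mdist x (u n) < e.
Proof.
move=> [D /pfcard_geP[D0|[u]] dD].
  have [x [_]] := dD [set: X] (ex_intro _ a I) openT.
  by rewrite D0.
exists u => x e e0.
have xB : (ball x e)^° x by exact: nbhsx_ballx.
have [y [/interior_subset + Dy]] := dD _ (ex_intro _ x xB) (@open_interior _ _).
have [n _ <-] := @surj _ _ _ _ u _ Dy.
by rewrite ballEmdist => ?; exists n.
Qed.

(** Separability makes the distance measurable for the product sigma-algebra:
    [mdist x y < r] holds exactly when [mdist x d + mdist y d < r] for some [d] of
    a dense sequence. *)
Lemma measurable_mdist2 (a : X) : separable X ->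
  measurable_fun [set: (borel X * borel X)%type]
    (fun z : (borel X * borel X)%type => mdist (z.1 : X) (z.2 : X)).
Proof.
move=> /(separable_dense_seq a)[u uP] mT.
apply: (measurability _ (RGenInftyO.measurableE R)) => // _ [_ [r ->] <-].
rewrite setTI.
have -> : (fun z : (borel X * borel X)%type => mdist (z.1 : X) (z.2 : X)) @^-1` `]-oo, r[ =
  \bigcup_n [set z : (borel X * borel X)%type | mdist (z.1 : X) (u n) + mdist (z.2 : X) (u n) < r].
  apply/seteqP; split => [[x y]|[x y] [n _]] /=; last first.
    rewrite in_itv/= => h; apply: le_lt_trans h.
    by rewrite (metric_sym y) metric_triangle.
  rewrite in_itv/= => h.
  have e0 : 0 < (r - mdist x y) / 2 by lra.
  have [n xn] := uP x _ e0; exists n => //=.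
  have := metric_triangle y x (u n); rewrite (metric_sym y x); lra.
apply: bigcupT_measurable => n.
have m1 : measurable_fun setT (fun z : (borel X * borel X)%type => mdist (z.1 : X) (u n) + mdist (z.2 : X) (u n)).
  apply: measurable_funD.
    exact: (measurableT_comp (measurable_mdist (u n)) measurable_fst).
  exact: (measurableT_comp (measurable_mdist (u n)) measurable_snd).
rewrite -[X in measurable X]setTI.
have := m1 measurableT `]-oo, r[%classic (measurable_itv _).
by rewrite [X in measurable (_ `&` X)](_ : _ = [set z | mdist z.1 (u n) + mdist z.2 (u n) < r]).
Qed.

Lemma lip_const_le (f : X -> R) (C : R) : 0 <= C ->
  (forall x y, `|f x - f y| <= C * mdist x y) -> (lip_const f <= C%:E)%E.
Proof.
move=> C0 lf; rewrite /lip_const ge_max lee_fin C0/=.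
apply: ge_ereal_sup => _ [[x y] /= xy <-].
by rewrite lee_fin ler_pdivrMr// mdist_gt0.
Qed.

Lemma lip_constP (f : X -> R) : (lip_const f < +oo)%E ->
  forall x y, `|f x - f y| <= fine (lip_const f) * mdist x y.
Proof.
move=> lf x y; have [->|xy] := eqVneq x y.
  by rewrite subrr normr0 mdistxx mulr0.
have l0 : (0 <= lip_const f)%E by rewrite /lip_const le_max lexx.
rewrite -ler_pdivrMr ?mdist_gt0// -lee_fin fineK ?ge0_fin_numE//.
rewrite /lip_const le_max; apply/orP; right.
by apply: ereal_sup_ubound; exists (x, y).
Qed.

End metric_measurability.

(** The integral of a nonnegative function is the supremum over the simple
    functions below it, hence monotone on all functions.  The integral of the local
    slope, a limit superior over uncountably many points, is bounded in this
    way. *)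
Lemma le_integral_minorant d (T : measurableType d) (R : realType)
    (mu : {measure set T -> \bar R}) (f g : T -> \bar R) :
  (forall x, 0 <= f x)%E -> (forall x, f x <= g x)%E ->
  (\int[mu]_x f x <= \int[mu]_x g x)%E.
Proof.
move=> f0 fg; have g0 x : (0 <= g x)%E by exact: le_trans (f0 x) (fg x).
rewrite !ge0_integralTE//; apply: ereal_sup_le => _ [h hf <-].
by exists h => // x; exact: le_trans (hf x) (fg x).
Qed.

Lemma powR_near {R : realType} (a r eps : R) : 0 < a -> 0 <= r -> 0 < eps ->
  exists2 e, 0 < e & forall s, 0 <= s -> `|r - s| <= e -> s `^ a <= r `^ a + eps.
Proof.
move=> a0 r0 eps0.
have /cvgrPdist_le /(_ _ eps0) := @continuous_norm_powR R a a0 r.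
move=> /nbhs_normP[e /= e0 He]; exists (e / 2); first by lra.
move=> s s0 rs; have /He : ball_ Num.Def.normr r e s by rewrite /=; lra.
rewrite /= distrC !(ger0_norm r0) (ger0_norm s0) => h.
have := ler_norm (s `^ a - r `^ a); lra.
Qed.

Section hopf_lax_poincare.
Context {R : realType} {X : completeMetricType R} (p : R).
Local Notation q := (conj_exp p).
Local Notation c := (legendre_const p).
Variables (f : X -> R) (A : R).
Hypothesis fA : forall x, `|f x| <= A.
Local Notation Q t := (hopf_lax p t f).

Let local_lip_ge0 (g : X -> R) x : (0 <= local_lip g x)%E.
Proof.
rewrite /local_lip; case: asboolP => // nx; apply: limf_esup_ge0.
  move=> x0; apply: nx; split; first by rewrite inE.
  exists [set x]; last by rewrite setIT.
  apply: (@filterS _ (nbhs x) _ _ _ _ x0) => y /= yx.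
  by apply: contrapT => /eqP/yx.
by move=> y; rewrite lee_fin divr_ge0// mdist_ge0.
Qed.

(** The two halves of [hopf_lax_hamilton_jacobi] combined.  The factor
    [((t + h) / t) ^ p] compares the decrease over a positive time [h] with the rate
    at time [t]. *)
Lemma local_lip_hopf_lax t h x : 1 < p -> 0 < t -> 0 < h ->
  (local_lip (Q t) x `^ q <=
    (c^-1 * ((t + h) / t) `^ p / h * (Q t x - Q (t + h) x))%:E)%E.
Proof.
move=> p1 t0 h0.
have [D [D0 slope decrease]] := hopf_lax_hamilton_jacobi fA x p1 t0.
have p10 : 0 < p - 1 by lra.
have q0 : 0 < q by have := conj_exp_gt1 p1; lra.
have Dt0 : 0 <= D / t by rewrite divr_ge0// ltW.
have loc : (local_lip (Q t) x <= (p * (D / t) `^ (p - 1))%:E)%E.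
  rewrite /local_lip; case: asboolP => [_|nx].
    by rewrite lee_fin mulr_ge0 ?powR_ge0//; lra.
  apply/lee_addgt0Pr => eps eps0.
  have eps20 : 0 < eps / (2 * p) by rewrite divr_gt0//; lra.
  have [e1 e10 e1P] := powR_near p10 Dt0 eps20.
  pose e := Num.min (eps / 2) (e1 * t / 2).
  have e0 : 0 < e by rewrite lt_min !divr_gt0// ?mulr_gt0//.
  have [d0 d00 d0P] := slope e e0.
  rewrite /limf_esup; apply: ereal_inf_le.
  exists (ereal_sup [set (`|Q t y - Q t x| / mdist y x)%:E | y in [set y | mdist x y < d0 /\ y != x]]).
    exists [set y | mdist x y < d0 /\ y != x] => //.
    apply/nbhs_ballP; exists d0 => //= y; rewrite ballEmdist/= => ? ?; split => //.
  apply: ge_ereal_sup => _ [y /= [xy yx] <-].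
  rewrite -EFinD lee_fin ler_pdivrMr ?mdist_gt0// (metric_sym y x).
  apply: le_trans (d0P y xy) _; rewrite ler_wpM2r ?mdist_ge0//.
  have ee1 : e <= eps / 2 by rewrite ge_min lexx.
  have ee2 : e <= e1 * t / 2 by rewrite ge_min lexx orbT.
  have : ((D + (e + e)) / t) `^ (p - 1) <= (D / t) `^ (p - 1) + eps / (2 * p).
    apply: e1P; first by rewrite divr_ge0 ?(ltW t0)//; lra.
    have -> : `|D / t - (D + (e + e)) / t| = (e + e) / t.
      by rewrite -mulrBl opprD addNKr mulNr normrN ger0_norm// divr_ge0 ?addr_ge0 ?ltW.
    rewrite ler_pdivrMr//; lra.
  have p0 : 0 <= p by lra.
  have pE : p * (eps / (2 * p)) = eps / 2 by field; apply: lt0r_neq0; lra.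
  move=> /(ler_wpM2l p0); rewrite mulrDr pE; lra.
have := gt0_ler_poweR (ltW q0) _ _ loc.
rewrite !in_itv/= !leey !andbT local_lip_ge0 lee_fin mulr_ge0 ?powR_ge0//; last by lra.
move=> /(_ isT isT)/le_trans; apply; rewrite lee_fin.
have p0 : 0 <= p by lra.
rewrite powRM ?powR_ge0// -powRrM.
have -> : (p - 1) * q = p by rewrite /conj_exp mulrCA mulfV ?mulr1// gt_eqF.
have c0 := legendre_const_gt0 p1.
have pc : p `^ q = (p - 1) / c.
  rewrite /legendre_const powRN invfM invrK mulrA mulfV ?mul1r// gt_eqF//.
have h1 := decrease h h0.
rewrite pc -(ler_pM2l h0) -(ler_pM2l c0).
have s0 : 0 < t + h by lra.
have sp0 : 0 < (t + h) `^ p by rewrite powR_gt0.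
have tp0 : 0 < t `^ p by rewrite powR_gt0.
have E1 : c * (h * ((p - 1) / c * (D / t) `^ p)) = (p - 1) * D `^ p * h / t `^ p.
  rewrite powRM// ?invr_ge0 ?(ltW t0)//.
  have -> : t^-1 `^ p = (t `^ p)^-1.
    by rewrite -[t^-1]powR_inv1 ?(ltW t0)// -powRrM mulN1r powRN.
  by field; rewrite !gt_eqF.
have E2 : c * (h * (c^-1 * ((t + h) / t) `^ p / h * (Q t x - Q (t + h) x))) =
  (t + h) `^ p / t `^ p * (Q t x - Q (t + h) x).
  rewrite powRM ?(ltW s0) ?invr_ge0 ?(ltW t0)//.
  have -> : t^-1 `^ p = (t `^ p)^-1.
    by rewrite -[t^-1]powR_inv1 ?(ltW t0)// -powRrM mulN1r powRN.
  by field; rewrite !gt_eqF.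
rewrite E1 E2.
have := ler_wpM2l (divr_ge0 (ltW sp0) (ltW tp0)) h1.
apply: le_trans; rewrite powRN le_eqVlt; apply/orP; left; apply/eqP.
by field; rewrite !gt_eqF.
Qed.

Lemma hopf_lax_decreasing t h x : 1 < p -> 0 < t -> 0 < h -> Q (t + h) x <= Q t x.
Proof.
move=> p1 t0 h0.
have [D [D0 _ /(_ h h0)]] := hopf_lax_hamilton_jacobi fA x p1 t0.
have : 0 <= (p - 1) * D `^ p * h * (t + h) `^ (- p).
  by rewrite !mulr_ge0 ?powR_ge0// ?(ltW h0)//; lra.
lra.
Qed.

Lemma bmeas_hopf_lax t : 1 < p -> 0 < t -> bmeas (Q t : borel X -> R).
Proof.
move=> p1 t0; split; last by exists A => x; exact: hopf_lax_bounded.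
by have [C C0 CP] := hopf_lax_lipschitz fA p1 t0; exact: lipschitz_measurable CP.
Qed.

(** The Poincare inequality applied to [Q t], with the slope bounded by the
    difference quotient of the semigroup; [eta] pays for a constant [a] that only
    approaches the infimum. *)
Lemma poincare_hopf_lax (nu : probability (borel X) R) (B t h eta : R) :
  1 < p -> 0 < t -> 0 < h -> 0 < eta -> (poincare_const q nu < B%:E)%E ->
  exists a, \int[nu]_y (`|Q t y - a| `^ q) <=
    B * (c^-1 * ((t + h) / t) `^ p / h * \int[nu]_y (Q t y - Q (t + h) y)) + eta.
Proof.
move=> p1 t0 h0 eta0 /ereal_inf_lt[_ [C [C0 CP] <-] /ltW CB].
have q0 : 0 <= q by have := conj_exp_gt1 p1; lra.
have bQ s : 0 < s -> bmeas (Q s : borel X -> R) by exact: bmeas_hopf_lax.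
have bQ2 : bmeas (fun y : borel X => Q t y - Q (t + h) y) by apply: bmeasB; apply: bQ; lra.
have [L L0 LP] := hopf_lax_lipschitz fA p1 t0.
have bfun : bounded_fun (Q t : X -> R).
  exists A; split; first exact: num_real.
  by move=> M AM x _ /=; rewrite (le_trans (hopf_lax_bounded fA t x p1))// ltW.
have := CP _ bfun (le_lt_trans (lip_const_le L0 LP) (ltry _)).
set k := c^-1 * _ / h.
have k0 : 0 <= k.
  by rewrite !mulr_ge0 ?invr_ge0 ?powR_ge0 ?(ltW (legendre_const_gt0 p1))// ltW.
have I0 : 0 <= \int[nu]_y (Q t y - Q (t + h) y).
  by apply: Rintegral_ge0 => y _; rewrite subr_ge0 hopf_lax_decreasing.
have bk : bmeas (fun y : borel X => k * (Q t y - Q (t + h) y)).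
  by apply: bmeasM => //; exact: bmeas_cst.
have le1 : (\int[nu]_x (local_lip (Q t) x `^ q) <=
  (k * \int[nu]_y (Q t y - Q (t + h) y))%:E)%E.
  rewrite -expectationZ// EFin_expectation//.
  by apply: le_integral_minorant => x; [exact: poweR_ge0|exact: local_lip_hopf_lax].
move=> H.
have : (C%:E * \int[nu]_x (local_lip (Q t) x `^ q) <
    (B * (k * \int[nu]_y (Q t y - Q (t + h) y)) + eta)%:E)%E.
  apply: (@le_lt_trans _ _ (C%:E * (k * \int[nu]_y (Q t y - Q (t + h) y))%:E)%E).
    by rewrite lee_wpmul2l.
  rewrite -EFinM lte_fin.
  have := ler_wpM2r (mulr_ge0 k0 I0) CB; lra.
move=> /(le_lt_trans H)/ereal_inf_lt[_ [a _ <-]].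
rewrite -EFin_expectation; last first.
  by apply: bmeas_norm_powR => //; apply: bmeasB; [exact: bQ|exact: bmeas_cst].
by rewrite lte_fin => /ltW; exists a.
Qed.

End hopf_lax_poincare.

(** * Finite transport problems *)

Section farkas.
Context {F : realFieldType} {W : lmodType F}.
Implicit Types (f g : W -> F) (x y : W).

Definition is_linear f := forall (a : F) x y, f (a *: x + y) = a * f x + f y.

Let linB f a x y : is_linear f -> f (x - a *: y) = f x - a * f y.
Proof. by move=> lf; rewrite addrC -scaleNr lf mulNr addrC. Qed.

Let linZ f a x : is_linear f -> f (a *: x) = a * f x.
Proof.
move=> lf; have f0 : f 0 = 0.
  by have := lf (-1) 0 0; rewrite scaler0 addr0 mulN1r addNr.
by have := lf a x 0; rewrite addr0 f0 addr0.
Qed.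

(** If the constraint [i] matters, some [x1] satisfies the other constraints and
    violates the conclusion; then [f i x1 > 0], and projecting along [x1] onto
    the kernel of [f i] removes the constraint. *)
Lemma farkas (T : eqType) (s : seq T) (f : T -> W -> F) g :
  uniq s -> (forall i, is_linear (f i)) -> is_linear g ->
  (forall x, (forall i, i \in s -> f i x <= 0) -> g x <= 0) ->
  exists2 l : T -> F, forall i, 0 <= l i &
    forall x, g x = \sum_(i <- s) l i * f i x.
Proof.
elim: s f g => [|i s IH] f g /=.
  move=> _ _ lg h; exists (fun=> 0) => // x; rewrite big_nil.
  apply/eqP; rewrite eq_le h//= -oppr_le0 -mulN1r -linZ//.
  exact: h.
move=> /andP[iNs us] lf lg h.
have [h'|/existsNP[x0 /not_implyP[x0s /negP]]] :=
    pselect (forall x, (forall j, j \in s -> f j x <= 0) -> g x <= 0).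
  have [l l0 lE] := IH f g us lf lg h'.
  exists (fun j => if j == i then 0 else l j) => [j|x]; first by case: ifP.
  rewrite big_cons eqxx mul0r add0r lE; apply: eq_big_seq => j js.
  by case: eqP => // ji; rewrite -ji js in iNs.
rewrite -ltNge => gx0.
have fx0 : 0 < f i x0.
  rewrite ltNge; apply/negP => fx0; move: gx0; rewrite ltNge => /negP; apply.
  by apply: h => j; rewrite inE => /predU1P[->//|]; exact: x0s.
pose x1 := (f i x0)^-1 *: x0.
have fx1 : f i x1 = 1 by rewrite linZ// mulVf// gt_eqF.
have fsx1 j : j \in s -> f j x1 <= 0.
  by move=> js; rewrite linZ// pmulr_rle0 ?invr_gt0// x0s.
have gx1 : 0 < g x1 by rewrite linZ// pmulr_rgt0// invr_gt0.
pose proj (u : W -> F) x := u x - f i x * u x1.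
have lproj u : is_linear u -> is_linear (proj u).
  by move=> lu a x y; rewrite /proj lu lf; ring.
have [||x hx|l l0 lE] := IH (fun j => proj (f j)) (proj g) us.
- by move=> j; exact: lproj.
- exact: lproj.
- rewrite /proj -linB//; apply: h => j; rewrite inE => /predU1P[->|js].
    by rewrite linB// fx1 mulr1 subrr.
  by rewrite linB//; exact: hx.
pose li := g x1 - \sum_(j <- s) l j * f j x1.
exists (fun j => if j == i then li else l j) => [j|x].
  case: ifP => // _; rewrite /li subr_ge0 (@le_trans _ _ 0)// ?(ltW gx1)//.
  rewrite big_seq; apply: sumr_le0 => k ks.
  by rewrite mulr_ge0_le0// fsx1.
rewrite big_cons eqxx.
have -> : \sum_(j <- s) (if j == i then li else l j) * f j x = \sum_(j <- s) l j * f j x.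
  apply: eq_big_seq => j js.
  by case: eqP => // ji; rewrite -ji js in iNs.
have := lE x; rewrite /proj => /(canRL (subrK _)) ->.
have -> : \sum_(j <- s) l j * (f j x - f i x * f j x1) =
    \sum_(j <- s) l j * f j x - f i x * \sum_(j <- s) l j * f j x1.
  by rewrite mulr_sumr -sumrB; apply: eq_bigr => j _; ring.
by rewrite /li; ring.
Qed.

End farkas.

(** Linear programming duality for a finite transport problem; the multipliers
    given by [farkas] form the transport plan. *)
Lemma finite_transport_duality (F : realFieldType) (I J : finType)
    (mu : I -> F) (nu : J -> F) (c : I -> J -> F) (C : F) :
  (forall (phi : I -> F) (psi : J -> F),
    (forall i j, psi j - phi i <= c i j) ->
    \sum_j psi j * nu j - \sum_i phi i * mu i <= C) ->
  exists P : I -> J -> F, [/\ forall i j, 0 <= P i j,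
    forall i, \sum_j P i j = mu i, forall j, \sum_i P i j = nu j &
    \sum_i \sum_j c i j * P i j <= C].
Proof.
move=> dual; pose W := {ffun (I + J + unit) -> F^o}.
pose phi (x : W) i : F := x (inl (inl i)).
pose psi (x : W) j : F := x (inl (inr j)).
pose tt_ (x : W) : F := x (inr tt).
pose g (x : W) : F := \sum_j psi x j * nu j - \sum_i phi x i * mu i - C * tt_ x.
pose f (k : option (I * J)) (x : W) : F :=
  if k is Some (i, j) then psi x j - phi x i - c i j * tt_ x else - tt_ x.
pose s : seq (option (I * J)) := None :: map Some (enum {: I * J}).
have us : uniq s.
  rewrite /s/= map_inj_uniq ?enum_uniq ?andbT; last by move=> ? ? [].
  by apply/negP => /mapP[].
have sP k : k \in s.
  rewrite inE; case: k => [k|//]; rewrite orFb.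
  by apply/mapP; exists k => //; rewrite mem_enum.
have ffE (a : F) (x y : W) k : (a *: x + y) k = a * (x k : F) + (y k : F) :> F.
  by rewrite !ffunE.
have lf k : is_linear (f k).
  by move=> a x y; case: k => [[i j]|]; rewrite /f /psi /phi /tt_ !ffE /=; ring.
have lg : is_linear g.
  move=> a x y; rewrite /g /psi /phi /tt_ ffE.
  have -> : \sum_j (a *: x + y) (inl (inr j)) * nu j =
      a * (\sum_j x (inl (inr j)) * nu j) + \sum_j y (inl (inr j)) * nu j.
    by rewrite mulr_sumr -big_split; apply: eq_bigr => j _; rewrite ffE/=; ring.
  have -> : \sum_i (a *: x + y) (inl (inl i)) * mu i =
      a * (\sum_i x (inl (inl i)) * mu i) + \sum_i y (inl (inl i)) * mu i.
    by rewrite mulr_sumr -big_split; apply: eq_bigr => j _; rewrite ffE/=; ring.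
  ring.
(* [tt_ x] homogenises the constraints: a pair of potentials with [tt_ x > 0] is
   feasible after division by [tt_ x] *)
have [x hx|l l0 lE] := @farkas F W _ s f g us lf lg.
  have t0 : 0 <= tt_ x by have := hx None (sP _); rewrite /f oppr_le0.
  have hP i j : psi x j - phi x i <= c i j * tt_ x.
    by rewrite -subr_le0; exact: hx (Some (i, j)) (sP _).
  rewrite /g; have [tz|tnz] := eqVneq (tt_ x) 0; last first.
    have tp : 0 < tt_ x by rewrite lt_neqAle eq_sym tnz.
    rewrite subr_le0 -ler_pdivrMr//.
    have := dual (fun i => phi x i / tt_ x) (fun j => psi x j / tt_ x).
    have -> : \sum_j psi x j / tt_ x * nu j = (\sum_j psi x j * nu j) / tt_ x.
      by rewrite mulr_suml; apply: eq_bigr => j _; ring.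
    have -> : \sum_i phi x i / tt_ x * mu i = (\sum_i phi x i * mu i) / tt_ x.
      by rewrite mulr_suml; apply: eq_bigr => j _; ring.
    rewrite -mulrBl; apply => i j.
    by rewrite -mulrBl ler_pdivrMr.
  (* a direction of recession: adding [N] times it to the feasible pair
     [(0, - m)] would make the dual value exceed [C] *)
  rewrite tz mulr0 subr0 leNgt; apply/negP.
  set S := _ - _ => S0; pose m := \sum_i \sum_j `|c i j|.
  have mP i j : - m <= c i j.
    rewrite lerNl (le_trans (ler_norm _))// normrN /m (bigD1 i)//= (bigD1 j)//=.
    by rewrite -addrA lerDl addr_ge0// sumr_ge0// => k _; rewrite sumr_ge0.
  pose k := \sum_j (- m) * nu j.
  pose N := (`|C - k| + 1) / S.
  have N0 : 0 <= N by rewrite divr_ge0 ?(ltW S0)// addr_ge0.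
  have := dual (fun i => N * phi x i) (fun j => N * psi x j - m).
  have -> : \sum_j (N * psi x j - m) * nu j = N * (\sum_j psi x j * nu j) + k.
    by rewrite /k mulr_sumr -big_split; apply: eq_bigr => j _ /=; ring.
  have -> : \sum_i N * phi x i * mu i = N * (\sum_i phi x i * mu i).
    by rewrite mulr_sumr; apply: eq_bigr => j _ /=; ring.
  have NS : N * (\sum_j psi x j * nu j) + k - N * (\sum_i phi x i * mu i) = `|C - k| + 1 + k.
    by rewrite addrAC -mulrBr -/S /N divfK// gt_eqF.
  rewrite NS => /(_ _)/wrap[i j|]; last first.
    have := ler_norm (C - k); lra.
  rewrite addrAC -mulrBr; have := ler_wpM2l N0 (hP i j).
  by rewrite tz mulr0 mulr0; have := mP i j; lra.
pose P i j := l (Some (i, j)).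
have lEP x : g x = l None * - tt_ x + \sum_i \sum_j P i j * (psi x j - phi x i - c i j * tt_ x).
  rewrite lE /s big_cons/= big_map big_enum/=; congr (_ + _).
  by rewrite pair_bigA/=; apply: eq_bigr => -[i j] _.
have ind (K : finType) (k0 : K) (h : K -> F) : \sum_k (k == k0)%:R * h k = h k0.
  rewrite (bigD1 k0)//= eqxx mul1r big1 ?addr0// => k /negPf ->.
  by rewrite mul0r.
exists P; split => [i j|i0|j0|]; first exact: l0.
- have := lEP [ffun k => if k is inl (inl i) then (i == i0)%:R else 0].
  rewrite /g /psi /phi /tt_ !ffunE.
  rewrite [X in X - _ - _]big1; last by move=> j _; rewrite ffunE mul0r.
  under eq_bigr do rewrite ffunE.
  rewrite ind mulr0 subr0 sub0r oppr0 mulr0 add0r.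
  under eq_bigr => i _.
    under eq_bigr do rewrite !ffunE mulr0 subr0 sub0r mulrN mulrC -mulrN.
    rewrite -mulr_sumr; over.
  rewrite ind sumrN => /oppr_inj <- //.
- have := lEP [ffun k => if k is inl (inr j) then (j == j0)%:R else 0].
  rewrite /g /psi /phi /tt_ !ffunE.
  rewrite [X in _ - X - _]big1; last by move=> i _; rewrite ffunE mul0r.
  under eq_bigr do rewrite ffunE.
  rewrite ind mulr0 !subr0 oppr0 mulr0 add0r => ->.
  apply: eq_bigr => i _.
  under [RHS]eq_bigr do rewrite !ffunE mulr0 !subr0 mulrC.
  by rewrite ind.
- have := lEP [ffun k => if k is inr _ then 1 else 0].
  rewrite /g /psi /phi /tt_ !ffunE.
  rewrite big1; last by move=> i _; rewrite ffunE mul0r.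
  rewrite [X in _ - X - _]big1; last by move=> i _; rewrite ffunE mul0r.
  under eq_bigr => i _.
    under eq_bigr => j _ do rewrite !ffunE subr0 sub0r mulr1 mulrN mulrC.
    rewrite sumrN; over.
  rewrite sumrN.
  by have := l0 None; lra.
Qed.

(** * Discretisation of the space *)

(** Splitting a displacement into two legs of durations [s] and [t] does not lower
    the action; the tangent of [r |-> r ^ p] at the mean speed [v] bounds the
    action of both legs from below. *)
Lemma powR_div_subadditive {R : realType} (p x y s t : R) : 1 < p ->
  0 <= x -> 0 <= y -> 0 < s -> 0 < t ->
  (x + y) `^ p / (s + t) `^ (p - 1) <= x `^ p / s `^ (p - 1) + y `^ p / t `^ (p - 1).
Proof.
move=> p1 x0 y0 s0 t0; have st0 : 0 < s + t by rewrite addr_gt0.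
pose v := (x + y) / (s + t).
have v0 : 0 <= v by rewrite divr_ge0 ?(ltW st0)// addr_ge0.
have vE : v * (s + t) = x + y by rewrite /v divfK// gt_eqF.
have E (r z : R) : 0 < r -> 0 <= z -> z `^ p / r `^ (p - 1) = r * (z / r) `^ p.
  move=> r0 z0; rewrite powRM ?invr_ge0 ?(ltW r0)//.
  rewrite -[r^-1]powR_inv1 ?(ltW r0)// -powRrM mulN1r -powRN mulrCA.
  congr (_ * _); rewrite -[X in X * _](powRr1 (ltW r0)) -powRD_gt0//.
  by congr (_ `^ _); ring.
rewrite !E ?addr_ge0// -/v.
have T (r z : R) : 0 < r -> 0 <= z ->
    r * v `^ p + p * v `^ (p - 1) * (z - r * v) <= r * (z / r) `^ p.
  move=> r0 z0; have zr : 0 <= z / r by rewrite divr_ge0// ltW.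
  have := powR_tangent p1 zr v0 => /(ler_wpM2l (ltW r0)).
  have -> : r * (p * v `^ (p - 1) * (v - z / r)) = p * v `^ (p - 1) * (r * v - z).
    by field; rewrite gt_eqF.
  rewrite mulrBr mulrBr; lra.
have Tx := T s x s0 x0; have Ty := T t y t0 y0.
have Z : p * v `^ (p - 1) * (x - s * v) + p * v `^ (p - 1) * (y - t * v) = 0.
  rewrite -mulrDr; have -> : x - s * v + (y - t * v) = x + y - v * (s + t) by ring.
  by rewrite vE subrr mulr0.
lra.
Qed.

Lemma powR_div_subadditive3 {R : realType} (p x y z s : R) : 1 < p ->
  0 <= x -> 0 <= y -> 0 <= z -> 0 < s ->
  (x + y + z) `^ p / (1 + 2 * s) `^ (p - 1) <=
    x `^ p / s `^ (p - 1) + y `^ p + z `^ p / s `^ (p - 1).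
Proof.
move=> p1 x0 y0 z0 s0.
have -> : 1 + 2 * s = (s + 1) + s by ring.
apply: le_trans (powR_div_subadditive p1 (addr_ge0 x0 y0) z0 (addr_gt0 s0 ltr01) s0) _.
rewrite lerD2r; apply: le_trans (powR_div_subadditive p1 x0 y0 s0 ltr01) _.
by rewrite powR1 divr1.
Qed.

Section finite_valued.
Context d (T : measurableType d) (R : realType) (P : probability T R).
Context (K : finType) (idx : T -> K).
Hypothesis midx : forall k, measurable (idx @^-1` [set k]).

Let sum_indic (h : K -> R) x : h (idx x) = \sum_k h k * \1_(idx @^-1` [set k]) x.
Proof.
rewrite (bigD1 (idx x))//= indicE mem_set// mulr1 big1 ?addr0// => k kx.
rewrite indicE memNset ?mulr0// => /= xk; by rewrite xk eqxx in kx.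
Qed.

Lemma measurable_finite_valued (h : K -> R) : measurable_fun setT (fun x => h (idx x)).
Proof.
rewrite (_ : (fun x => _) = (fun x => \sum_(k <- index_enum K) h k * \1_(idx @^-1` [set k]) x)).
  by apply: measurable_sum => k; apply: measurable_funM.
by apply/funext => x; exact: sum_indic.
Qed.

Lemma bmeas_finite_valued (h : K -> R) : bmeas (fun x => h (idx x)).
Proof.
split; first exact: measurable_finite_valued.
exists (\sum_k `|h k|) => x.
by rewrite (bigD1 (idx x))//= lerDl sumr_ge0.
Qed.

Lemma ge0_integral_finite_valued (h : K -> R) (E : set T) : measurable E ->
  (forall k, 0 <= h k) ->
  (\int[P]_(x in E) (h (idx x))%:E = \sum_k (h k)%:E * P (E `&` idx @^-1` [set k]))%E.
Proof.
move=> mE h0.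
under eq_integral do rewrite sum_indic -sumEFin.
rewrite ge0_integral_sum//.
- apply: eq_bigr => k _; under eq_integral do rewrite EFinM.
  rewrite ge0_integralZl//; first by rewrite integral_indic// setIC.
    exact/measurable_EFinP.
  by rewrite lee_fin.
- by move=> k; apply/measurable_EFinP; apply: measurable_funM.
- by move=> k x _; rewrite lee_fin mulr_ge0.
Qed.

Lemma expectation_finite_valued (h : K -> R) :
  \int[P]_x h (idx x) = \sum_k h k * fine (P (idx @^-1` [set k])).
Proof.
have fP k : P (idx @^-1` [set k]) \is a fin_num by exact: fin_num_measure.
have pos (g : K -> R) : (forall k, 0 <= g k) ->
    \int[P]_x g (idx x) = \sum_k g k * fine (P (idx @^-1` [set k])).
  move=> g0; rewrite /Rintegral ge0_integral_finite_valued// -sum_fine.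
    by apply: eq_bigr => k _; rewrite setTI fineM.
  by move=> k _; rewrite setTI fin_numM.
pose c := \sum_k `|h k|.
have hc k : 0 <= h k + c.
  rewrite -lerBlDr sub0r lerNl /c (bigD1 k)//= (le_trans (ler_norm _))//.
  by rewrite normrN lerDl sumr_ge0.
have bh := bmeas_finite_valued h.
have bc := @bmeas_cst _ T R c.
have c0 : 0 <= c by rewrite sumr_ge0.
have := pos _ hc; rewrite expectationD// (pos (fun=> c))//.
under [X in _ = X -> _]eq_bigr do rewrite mulrDl.
by rewrite big_split/= => /addIr.
Qed.

End finite_valued.

Lemma bmeas_max0 d (T : measurableType d) (R : realType) (g : T -> R) :
  bmeas g -> bmeas (fun x => Num.max 0 (g x)).
Proof.
move=> [mg [C gC]]; split; first exact: measurable_maxr.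
exists C => x; rewrite ger0_norm ?le_max ?lexx// ge_max.
by rewrite (le_trans (normr_ge0 _) (gC x))/= (le_trans (ler_norm _)).
Qed.

Lemma expectation_le_integral d (T : measurableType d) (R : realType)
    (P : probability T R) (g D : T -> R) (e : R) :
  bmeas g -> measurable_fun setT D -> (forall x, 0 <= D x) ->
  (forall x, g x <= D x) -> (\int[P]_x (D x)%:E <= e%:E)%E -> \int[P]_x g x <= e.
Proof.
move=> bg mD D0 gD De.
have bm := bmeas_max0 bg.
apply: (@le_trans _ _ (\int[P]_x Num.max 0 (g x))).
  by apply: le_expectation => // x; rewrite le_max lexx orbT.
rewrite -lee_fin EFin_expectation//; apply: le_trans De.
apply: le_integral_minorant => x; rewrite lee_fin ?le_max ?lexx//.
by rewrite ge_max D0 gD.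
Qed.

Section discretisation.
Context {R : realType} {X : completeMetricType R} (p : R) (a : X) (u : nat -> X).

Definition first_close (r : R) n (x : X) : nat :=
  find (fun k => mdist x (u k) < r) (iota 0 n).

Lemma first_close_le r n x : (first_close r n x <= n)%N.
Proof. by rewrite -[leqRHS](size_iota 0) find_size. Qed.

Lemma first_close_lt r n x : (first_close r n x < n)%N ->
  mdist x (u (first_close r n x)) < r.
Proof.
move=> h; have /(nth_find 0%N) : has (fun k => mdist x (u k) < r) (iota 0 n).
  by rewrite has_find size_iota.
by rewrite nth_iota.
Qed.

Let first_close_geP r n k x : (k <= n)%N ->
  (k <= first_close r n x)%N <-> forall j, (j < k)%N -> r <= mdist x (u j).
Proof.
move=> kn; split => [kf j jk|h].
  rewrite leNgt; apply/negP => xj.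
  have /(before_find 0%N) := leq_trans jk kf.
  by rewrite nth_iota ?(leq_trans jk)// add0n xj.
rewrite leqNgt; apply/negP => fk.
have := first_close_lt (leq_trans fk kn).
by rewrite ltNge h.
Qed.

Lemma first_close_eventually r x : (exists k, mdist x (u k) < r) ->
  exists N, forall n, (N <= n)%N -> (first_close r n x < n)%N.
Proof.
move=> [k xk]; exists k.+1 => n kn; rewrite ltn_neqAle first_close_le andbT.
apply/eqP => fn; have := (first_close_geP r x (leqnn n)).1; rewrite fn leqnn.
by move=> /(_ isT k kn); rewrite leNgt xk.
Qed.

Lemma measurable_first_close r n k :
  measurable [set x : borel X | first_close r n (x : X) = k].
Proof.
have mge j : measurable [set x : borel X | r <= mdist (x : X) (u j)].
  have := @measurable_mdist R X (u j) measurableT _ (measurable_itv `[r, +oo[).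
  rewrite setTI [X in measurable X](_ : _ = [set x : borel X | r <= mdist (x : X) (u j)])//.
  by apply/seteqP; split => x /=; rewrite in_itv/= andbT.
have mk l : (l <= n)%N -> measurable [set x : borel X | (l <= first_close r n (x : X))%N].
  move=> ln; rewrite [X in measurable X](_ : _ =
    \bigcap_(j in [set j | (j < l)%N]) [set x : borel X | r <= mdist (x : X) (u j)]).
    exact: bigcap_measurableType.
  by apply/seteqP; split => x /= /first_close_geP; [exact|move=> h; apply/h].
have [nk|kn] := ltnP n k.
  rewrite [X in measurable X](_ : _ = set0)//; apply/seteqP; split => x //= fk.
  by have := first_close_le r n x; rewrite fk leqNgt nk.
have [kn'|] := ltnP k n.
  rewrite [X in measurable X](_ : _ = [set x : borel X | (k <= first_close r n (x : X))%N]
     `\` [set x : borel X | (k.+1 <= first_close r n (x : X))%N]).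
    by apply: measurableD; exact: mk.
  apply/seteqP; split => x /=; first by move=> ->; rewrite leqnn ltnn.
  by move=> [kf /negP]; rewrite -leqNgt => fk; apply/eqP; rewrite eqn_leq fk.
move=> nk; have -> : k = n by apply/eqP; rewrite eqn_leq kn.
rewrite [X in measurable X](_ : _ = [set x : borel X | (n <= first_close r n (x : X))%N]).
  exact: mk.
apply/seteqP; split => x /=; first by move=> ->.
by move=> h; apply/eqP; rewrite eqn_leq h first_close_le.
Qed.

(** The last index stands for the remainder, where none of the first [n] points is
    close; the remainder is represented by the reference point [a]. *)
Definition cell_index r n (x : X) : 'I_n.+1 := inord (first_close r n x).

Definition cell_point n (i : 'I_n.+1) : X := if (i < n)%N then u i else a.

Lemma measurable_cell_index r n k :
  measurable ((cell_index r n : borel X -> 'I_n.+1) @^-1` [set k]).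
Proof.
rewrite [X in measurable X](_ : _ = [set x : borel X | first_close r n (x : X) = k]).
  exact: measurable_first_close.
have fn x : (first_close r n x < n.+1)%N by rewrite ltnS first_close_le.
apply/seteqP; split => x /=; rewrite /cell_index; first by move=> <-; rewrite inordK.
by move=> fk; apply/val_inj; rewrite /= inordK.
Qed.

Lemma measurable_mdist_cell r n :
  measurable_fun [set: borel X] (fun x : borel X => mdist (x : X) (cell_point (cell_index r n x)) `^ p).
Proof.
apply: (measurableT_comp (measurable_powR _)) => //.
have -> : (fun x : borel X => mdist (x : X) (cell_point (cell_index r n x))) =
  (fun x => \sum_(k <- index_enum 'I_n.+1) \1_((cell_index r n : borel X -> 'I_n.+1) @^-1` [set k]) x
     * mdist (x : X) (cell_point k)).
  apply/funext => x; rewrite (bigD1_seq (cell_index r n x)) ?mem_index_enum ?index_enum_uniq//=.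
  rewrite indicE mem_set// mul1r big1 ?addr0// => k kx.
  by rewrite indicE memNset ?mul0r// => /= xk; rewrite xk eqxx in kx.
apply: measurable_sum => k; apply: measurable_funM; last exact: measurable_mdist.
by apply: measurable_indic; exact: measurable_cell_index.
Qed.

Hypothesis dense_u : forall x e, 0 < e -> exists n, mdist x (u n) < e.

(** In the small cells the error is at most [r ^ p].  On the remainder it is
    dominated by the [p]-th moment, and by density the remainder shrinks to the
    empty set. *)
Lemma cell_error_cvg (mu : probability (borel X) R) (r : R) :
  1 < p -> 0 < r -> finite_moment a p mu ->
  forall e, 0 < e -> \forall n \near \oo,
    (\int[mu]_x (mdist (x : X) (cell_point (cell_index r n x)) `^ p)%:E <= (r `^ p + e)%:E)%E.
Proof.
move=> p1 r0 fm e e0; have p0 : 0 < p by lra.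
pose g n (x : borel X) : \bar R :=
  (if (first_close r n (x : X) < n)%N then 0 else mdist (x : X) a `^ p)%:E.
have mda : measurable_fun setT (fun x : borel X => mdist (x : X) a `^ p).
  by apply: (measurableT_comp (measurable_powR _)) => //; exact: measurable_mdist.
have mg n : measurable_fun setT (g n).
  apply/measurable_EFinP; apply: measurable_fun_ifT => //.
  apply: (@measurable_fun_bool _ _ _ _ false).
  rewrite setTI [X in measurable X](_ : _ = [set x : borel X | first_close r n (x : X) = n]).
    exact: measurable_first_close.
  apply/seteqP; split => x /=; last by move=> ->; rewrite ltnn.
  move=> /negbT; rewrite -leqNgt => h; apply/eqP.
  by rewrite eqn_leq h first_close_le.
have g0 n x : (0 <= g n x)%E by rewrite lee_fin; case: ifP => // _; exact: powR_ge0.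
have gcvg : (\int[mu]_x g n x @[n --> \oo] --> 0)%E.
  have [] := @dominated_convergence _ _ R mu setT measurableT g (fun=> 0%E)
    (fun x => (mdist (x : X) a `^ p)%:E) mg.
  - exact: measurable_cst.
  - apply: aeW => x _; have [N NP] := first_close_eventually (dense_u x r0).
    by apply: cvg_near_cst; exists N => // n /= Nn; rewrite /g NP.
  - apply/integrableP; split; first exact/measurable_EFinP.
    by under eq_integral do rewrite gee0_abs ?lee_fin ?powR_ge0//.
  - apply: aeW => x n _; rewrite gee0_abs// lee_fin.
    by case: ifP => // _; exact: powR_ge0.
  by move=> _ _; rewrite integral0.
have : \forall n \near \oo, (\int[mu]_x g n x <= e%:E)%E.
  move/fine_cvgP : gcvg => [fin /cvgrPdist_le/(_ _ e0)]; rewrite /=.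
  apply: filterS2 fin => n fn /=; rewrite sub0r normrN => h.
  by rewrite -[leLHS]fineK// lee_fin (le_trans (ler_norm _)).
apply: filterS => n h.
apply: (@le_trans _ _ (\int[mu]_x ((r `^ p)%:E + g n x))%E).
  apply: le_integral_minorant => x; first by rewrite lee_fin powR_ge0.
  rewrite /g -EFinD lee_fin /cell_point /cell_index inordK ?ltnS ?first_close_le//.
  case: ifPn => [fn|fn]; last by rewrite lerDr powR_ge0.
  rewrite addr0 ge0_ler_powR ?nnegrE ?mdist_ge0 ?(ltW p0) ?(ltW r0)//.
  exact/ltW/first_close_lt.
rewrite ge0_integralD//; last by move=> x _; rewrite lee_fin powR_ge0.
by rewrite integral_cst// [X in (_ * X)%E](_ : _ = 1%E) ?mule1 ?EFinD ?leeD2l//; exact: probability_setT.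
Qed.

End discretisation.

(** * Kantorovich duality *)

Section coupling_of_plan.
Context d (T : measurableType d) (R : realType) (mu nu : probability T R).
Context (K : finType) (idx : T -> K).
Hypothesis midx : forall k, measurable (idx @^-1` [set k]).
Variable P : K -> K -> R.
Hypothesis P0 : forall i j, 0 <= P i j.
Let m i := fine (mu (idx @^-1` [set i])).
Let n j := fine (nu (idx @^-1` [set j])).
Hypothesis Pm : forall i, \sum_j P i j = m i.
Hypothesis Pn : forall j, \sum_i P i j = n j.

Let density (ij : K * K) : R := P ij.1 ij.2 / (m ij.1 * n ij.2).
Let idx2 (z : (T * T)%type) : K * K := (idx z.1, idx z.2).

Let m0 i : 0 <= m i. Proof. by rewrite /m fine_ge0. Qed.
Let n0 j : 0 <= n j. Proof. by rewrite /n fine_ge0. Qed.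

Let density0 ij : 0 <= density ij.
Proof. by rewrite divr_ge0// mulr_ge0. Qed.

Let idx2E i j : idx2 @^-1` [set (i, j)] = (idx @^-1` [set i]) `*` (idx @^-1` [set j]).
Proof. by apply/seteqP; split => [[x y] [] //|[x y] [/= <- <-]]. Qed.

Let midx2 ij : measurable (idx2 @^-1` [set ij]).
Proof. by case: ij => i j; rewrite idx2E; exact: measurableX. Qed.

(** When a cell has mass [0] the plan puts no mass in its row or column, so the
    conventional value [0] of the quotient is the right one. *)
Let density_mass i j : density (i, j) * (m i * n j) = P i j.
Proof.
rewrite /density/=; have [/eqP|mn] := eqVneq (m i * n j) 0; last by rewrite divfK.
have Pz (F : K -> R) k : (forall k, 0 <= F k) -> \sum_k F k = 0 -> F k = 0.
  move=> F0 /eqP; rewrite psumr_eq0// => /allP/(_ k); rewrite mem_index_enum.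
  by move=> /(_ isT)/eqP.
rewrite mulf_eq0 => /orP[]/eqP z.
  by rewrite (Pz (P i) j)// ?Pm// mul0r mul0r.
by rewrite (Pz (P ^~ j) i)// ?Pn// mul0r mul0r.
Qed.

Let integral_density (E : set (T * T)) : measurable E ->
  (\int[(mu \x nu)%E]_(z in E) (density (idx2 z))%:E =
   \sum_i \sum_j (density (i, j))%:E * (mu \x nu) (E `&` idx2 @^-1` [set (i, j)]))%E.
Proof.
move=> mE; rewrite (@ge0_integral_finite_valued _ _ _ (mu \x nu)%E)//.
by rewrite pair_bigA; apply: eq_bigr => -[i j].
Qed.

Let prod_cell (A B : set T) i j : measurable A -> measurable B ->
  ((mu \x nu) ((A `*` B) `&` idx2 @^-1` [set (i, j)]) =
    mu (A `&` idx @^-1` [set i]) * nu (B `&` idx @^-1` [set j]))%E.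
Proof.
by move=> mA mB; rewrite idx2E -setXI product_measure1E//; exact: measurableI.
Qed.

Let sum_cells (Q : probability T R) (A : set T) : measurable A ->
  (\sum_i Q (A `&` idx @^-1` [set i]) = Q A)%E.
Proof.
move=> mA; have := @ge0_integral_finite_valued _ _ _ Q _ _ midx (fun=> 1) A mA (fun=> ler01).
by rewrite integral_cst// mul1e => ->; apply: eq_bigr => i _; rewrite mul1e.
Qed.

Let fin (Q : probability T R) (A : set T) i : measurable A ->
  Q (A `&` idx @^-1` [set i]) = (fine (Q (A `&` idx @^-1` [set i])))%:E.
Proof. by move=> mA; rewrite fineK//; apply: fin_num_measure; exact: measurableI. Qed.

Let cell0 (Q : probability T R) (A : set T) i : measurable A ->
  fine (Q (idx @^-1` [set i])) = 0 -> fine (Q (A `&` idx @^-1` [set i])) = 0.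
Proof.
move=> mA z; apply/eqP; rewrite eq_le fine_ge0// andbT -z fine_le//.
- by apply: fin_num_measure; exact: measurableI.
- exact: fin_num_measure.
- by apply: le_measure; rewrite ?inE//; exact: measurableI.
Qed.

Let marginal1 (A : set T) : measurable A ->
  (\int[(mu \x nu)%E]_(z in A `*` setT) (density (idx2 z))%:E = mu A)%E.
Proof.
move=> mA; rewrite integral_density; last exact: measurableX.
rewrite -(sum_cells mu mA); apply: eq_bigr => i _.
transitivity (\sum_j (P i j / m i * fine (mu (A `&` idx @^-1` [set i])))%:E)%E.
  apply: eq_bigr => j _; rewrite prod_cell// setTI fin//.
  rewrite -[nu _]fineK ?fin_num_measure// -/(n j) -!EFinM; congr EFin.
  rewrite -density_mass; have [z|nz] := eqVneq (m i) 0.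
    by rewrite /= !(@cell0 mu A i mA z) !(mul0r, mulr0).
  by field.
rewrite sumEFin -mulr_suml -mulr_suml Pm [RHS]fin//; congr EFin.
have [z|nz] := eqVneq (m i) 0; last by rewrite mulfV// mul1r.
by rewrite (cell0 mA z) mulr0.
Qed.

Let marginal2 (B : set T) : measurable B ->
  (\int[(mu \x nu)%E]_(z in setT `*` B) (density (idx2 z))%:E = nu B)%E.
Proof.
move=> mB; rewrite integral_density; last exact: measurableX.
rewrite -(sum_cells nu mB) exchange_big/=; apply: eq_bigr => j _.
transitivity (\sum_i (P i j / n j * fine (nu (B `&` idx @^-1` [set j])))%:E)%E.
  apply: eq_bigr => i _; rewrite prod_cell// setTI fin//.
  rewrite -[mu _]fineK ?fin_num_measure// -/(m i) -!EFinM; congr EFin.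
  rewrite -density_mass; have [z|nz] := eqVneq (n j) 0.
    by rewrite /= !(@cell0 nu B j mB z) !(mul0r, mulr0).
  by field.
rewrite sumEFin -mulr_suml -mulr_suml Pn [RHS]fin//; congr EFin.
have [z|nz] := eqVneq (n j) 0; last by rewrite mulfV// mul1r.
by rewrite (cell0 mB z) mulr0.
Qed.

(** Inside each product of two cells the plan is spread proportionally to the
    product measure. *)
Lemma coupling_of_plan : exists pi : probability (T * T)%type R, [/\
  forall A, measurable A -> pushforward pi fst A = mu A,
  forall A, measurable A -> pushforward pi snd A = nu A &
  forall c : K -> K -> R, \int[pi]_z c (idx z.1) (idx z.2) = \sum_i \sum_j c i j * P i j].
Proof.
pose L (z : (T * T)%type) := density (idx2 z).
have bL : bmeas L by exact: bmeas_finite_valued.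
have mL : measurable_fun setT L by case: bL.
have L0 z : 0 <= L z by exact: density0.
have Z1 : (\int[(mu \x nu)%E]_z (L z)%:E = 1)%E.
  by have := marginal1 measurableT; rewrite setXTT => ->; exact: probability_setT.
have Z0 : (0 < \int[(mu \x nu)%E]_z (L z)%:E)%E by rewrite Z1.
have Zy : (\int[(mu \x nu)%E]_z (L z)%:E < +oo)%E by rewrite Z1 ltry.
pose pi : probability (T * T)%type R := posterior (mu \x nu)%E L.
have piE E : pi E = (\int[(mu \x nu)%E]_(z in E) (L z)%:E)%E.
  by rewrite [LHS]posteriorE// Z1 invr1 mul1e.
exists pi; split => [A mA|A mA|c].
- rewrite /pushforward [LHS]piE -marginal1//; congr (integral _ _ _).
  by apply/seteqP; split => -[x y] //= [].
- rewrite /pushforward [LHS]piE -marginal2//; congr (integral _ _ _).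
  by apply/seteqP; split => -[x y] //= [].
- rewrite (@expectation_finite_valued _ _ _ pi _ idx2 midx2 (fun ij => c ij.1 ij.2)).
  rewrite [RHS]pair_bigA/=; apply: eq_bigr => -[i j] _ /=; congr (_ * _).
  rewrite piE integral_density// (bigD1 i)//= (bigD1 j)//= setIid.
  rewrite [X in (_ + X + _)%E]big1 ?adde0; last first.
    move=> k kj; rewrite [X in (_ * (_ \x _)%E X)%E](_ : _ = set0) ?measure0 ?mule0//.
    by apply/seteqP; split => // z /= [-> [/esym/eqP]]; rewrite (negPf kj).
  rewrite [X in (_ + X)%E]big1 ?adde0; last first.
    move=> k ki; apply: big1 => l _.
    rewrite [X in (_ * (_ \x _)%E X)%E](_ : _ = set0) ?measure0 ?mule0//.
    by apply/seteqP; split => // z /= [-> [/esym/eqP]]; rewrite (negPf ki).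
  rewrite idx2E product_measure1E//.
  rewrite [X in (_ * (X * _))%E](_ : _ = (m i)%:E); last first.
    by rewrite /m fineK// fin_num_measure.
  rewrite [X in (_ * (_ * X))%E](_ : _ = (n j)%:E); last first.
    by rewrite /n fineK// fin_num_measure.
  exact: density_mass.
Qed.

End coupling_of_plan.

Section kantorovich.
Context {R : realType} {X : completeMetricType R} (p : R).
Variables (mu nu : probability (borel X) R) (C : R).
(** The dual Kantorovich problem has value at most [C]. *)
Hypothesis dual : forall (f : X -> R), bmeas (f : borel X -> R) ->
  \int[nu]_y hopf_lax p 1 f y - \int[mu]_x f x <= C.

Section cells.
Context (K : finType) (idx : X -> K) (x_ : K -> X) (e s : R).
Hypothesis midx : forall k, measurable ((idx : borel X -> K) @^-1` [set k]).
Hypothesis merr : measurable_fun setT (fun x : borel X => mdist (x : X) (x_ (idx x)) `^ p).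
Hypothesis mu_err : (\int[mu]_x (mdist (x : X) (x_ (idx x)) `^ p)%:E <= e%:E)%E.
Hypothesis nu_err : (\int[nu]_x (mdist (x : X) (x_ (idx x)) `^ p)%:E <= e%:E)%E.

Let a := (1 + 2 * s) `^ (p - 1).
Let err x : R := mdist x (x_ (idx x)) `^ p / s `^ (p - 1).

(** Going from [x] to [w] by way of [y] and [z] takes the times [s], [1] and [s];
    the total time [1 + 2 * s] is the origin of the factor [a]. *)
Let three_legs (x y z w : X) : 1 < p -> 0 < s ->
  mdist x w `^ p / a <= mdist x y `^ p / s `^ (p - 1) + mdist y z `^ p + mdist z w `^ p / s `^ (p - 1).
Proof.
move=> p1 s0; apply: le_trans (powR_div_subadditive3 p1 _ _ _ s0); rewrite ?mdist_ge0//.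
rewrite ler_wpM2r ?invr_ge0 ?powR_ge0// ge0_ler_powR ?nnegrE ?addr_ge0 ?mdist_ge0//; first by lra.
apply: le_trans (metric_triangle x y w) _.
by rewrite -addrA lerD2l metric_triangle.
Qed.

Let err_integral (Q : probability (borel X) R) : 0 < s ->
  (\int[Q]_x (mdist (x : X) (x_ (idx x)) `^ p)%:E <= e%:E ->
   \int[Q]_x (err x)%:E <= (e / s `^ (p - 1))%:E)%E.
Proof.
move=> s0 Qe; under eq_integral do rewrite /err mulrC EFinM.
rewrite ge0_integralZl//.
- by rewrite mulrC EFinM lee_wpmul2l// lee_fin invr_ge0 powR_ge0.
- exact/measurable_EFinP.
- by move=> x _; rewrite lee_fin powR_ge0.
- by rewrite lee_fin invr_ge0 powR_ge0.
Qed.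

Let measurable_err : measurable_fun setT (err : borel X -> R).
Proof. by apply: measurable_funM. Qed.

Let err_ge0 x : 0 <= err x. Proof. by rewrite divr_ge0 ?powR_ge0. Qed.

(** A competitor for the dual problem on [X] is made from potentials on the cells:
    the function [z |-> max_j (psi j - d(z, x_j) ^ p) / a], evolved by the
    semigroup during the time [s].  The result is at most [phi i / a + err] in the
    cell [i], and after another unit of time it is still at least
    [psi j / a - err] in the cell [j]. *)
Lemma discrete_dual_bound (phi psi : K -> R) : 1 < p -> 0 < s ->
  (forall i j, psi j - phi i <= mdist (x_ i) (x_ j) `^ p) ->
  \sum_j psi j * fine (nu ((idx : borel X -> K) @^-1` [set j]))
  - \sum_i phi i * fine (mu ((idx : borel X -> K) @^-1` [set i]))
  <= a * (C + (e / s `^ (p - 1) + e / s `^ (p - 1))).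
Proof.
move=> p1 s0 cphi.
have a0 : 0 < a by rewrite powR_gt0//; lra.
pose m := \sum_i `|phi i| + \sum_j `|psi j|.
have mphi i : `|phi i| <= m.
  rewrite /m (bigD1 i)//= -addrA lerDl addr_ge0 ?sumr_ge0//.
have mpsi j : `|psi j| <= m.
  by rewrite /m addrC (bigD1 j)//= -addrA lerDl addr_ge0 ?sumr_ge0.
have m0 : 0 <= m by rewrite addr_ge0 ?sumr_ge0.
pose g (z : X) : R := (\big[Num.max/- m]_j (psi j - mdist z (x_ j) `^ p)) / a.
have g_ge z j : (psi j - mdist z (x_ j) `^ p) / a <= g z.
  by rewrite ler_wpM2r ?invr_ge0 ?(ltW a0)// le_bigmax.
have g_bound z : `|g z| <= m / a.
  rewrite normrM (ger0_norm (_ : 0 <= a^-1)) ?invr_ge0 ?(ltW a0)//.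
  rewrite ler_wpM2r ?invr_ge0 ?(ltW a0)// ler_norml; apply/andP; split.
    exact: bigmax_ge_id.
  apply: bigmax_le => [|j _]; first by lra.
  rewrite lerBlDr (le_trans (ler_norm _))// (le_trans (mpsi j))//.
  by rewrite lerDl powR_ge0.
have g_phi i : g (x_ i) <= phi i / a.
  rewrite ler_wpM2r ?invr_ge0 ?(ltW a0)//; apply: bigmax_le => [|j _].
    by have := mphi i; rewrite ler_norml => /andP[].
  by have := cphi i j; lra.
pose f := hopf_lax p s g.
have bf : bmeas (f : borel X -> R) by exact: bmeas_hopf_lax.
have f_bound x : `|f x| <= m / a by exact: hopf_lax_bounded.
have f_le x : f x - phi (idx x) / a <= err x.
  have := hopf_lax_le p g_bound s x (x_ (idx x)); rewrite -/f -/(err x).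
  by have := g_phi (idx x); lra.
have f_ge y : psi (idx y) / a - hopf_lax p 1 f y <= err y.
  suff: psi (idx y) / a - err y <= hopf_lax p 1 f y by lra.
  apply: hopf_lax_ge => x; rewrite powR1 divr1.
  suff: psi (idx y) / a - err y - mdist y x `^ p <= f x by lra.
  apply: hopf_lax_ge => z.
  have := three_legs z x y (x_ (idx y)) p1 s0; rewrite -/(err y).
  rewrite (metric_sym z x) (metric_sym x y); have := g_ge z (idx y).
  rewrite mulrBl; lra.
have bQ : bmeas (hopf_lax p 1 f : borel X -> R) by exact: bmeas_hopf_lax.
have bphi := @bmeas_finite_valued _ _ R _ _ midx (fun k => phi k / a).
have bpsi := @bmeas_finite_valued _ _ R _ _ midx (fun k => psi k / a).
have H1 := expectation_le_integral (bmeasB bf bphi) measurable_err err_ge0 f_le (err_integral s0 mu_err).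
have H2 := expectation_le_integral (bmeasB bpsi bQ) measurable_err err_ge0 f_ge (err_integral s0 nu_err).
rewrite expectationB// in H1; rewrite expectationB// in H2.
have H3 := dual bf.
have E (Q : probability (borel X) R) (h : K -> R) :
    \int[Q]_x (h (idx x) / a) = (\sum_k h k * fine (Q ((idx : borel X -> K) @^-1` [set k]))) / a.
  rewrite (@expectation_finite_valued _ _ R Q _ _ midx (fun k => h k / a)) mulr_suml.
  by apply: eq_bigr => k _; rewrite mulrAC.
rewrite !E in H1 H2.
rewrite -ler_pdivrMl// mulrC mulrBl; lra.
Qed.

(** The plan given by linear programming transports the cells; [err] pays for the
    displacements inside the cells at both ends. *)
Lemma coupling_of_cells eps : 1 < p -> 0 < s ->
  a * (a * (C + (e / s `^ (p - 1) + e / s `^ (p - 1))) + (e / s `^ (p - 1) + e / s `^ (p - 1))) <= eps ->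
  measurable_fun [set: (borel X * borel X)%type]
    (fun z : (borel X * borel X)%type => mdist (z.1 : X) (z.2 : X)) ->
  exists2 pi, couplings mu nu pi & (\int[pi]_z (mdist (z.1 : X) (z.2 : X) `^ p)%:E <= eps%:E)%E.
Proof.
move=> p1 s0 Heps md.
have a0 : 0 < a by rewrite powR_gt0//; lra.
have [P [P0 Pm Pn cost]] := finite_transport_duality
  (fun phi psi => @discrete_dual_bound phi psi p1 s0).
have [pi [pi1 pi2 piE]] := coupling_of_plan midx P0 Pm Pn.
exists pi; first by move=> A mA; rewrite pi1// pi2.
pose c (z : (borel X * borel X)%type) := mdist (x_ (idx z.1)) (x_ (idx z.2)) `^ p.
have midx2 : forall ij : K * K, measurable ((fun z : (borel X * borel X)%type => (idx z.1, idx z.2)) @^-1` [set ij]).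
  move=> [i j]; rewrite [X in measurable X](_ : _ =
    ((idx : borel X -> K) @^-1` [set i]) `*` ((idx : borel X -> K) @^-1` [set j])).
    exact: measurableX.
  by apply/seteqP; split => [[x y] [] //|[x y] [/= <- <-]].
have bc : bmeas c.
  exact: (@bmeas_finite_valued _ _ R _ _ midx2 (fun ij => mdist (x_ ij.1) (x_ ij.2) `^ p)).
have c0 z : 0 <= c z by exact: powR_ge0.
have Ic : (\int[pi]_z (c z)%:E <= (a * (C + (e / s `^ (p - 1) + e / s `^ (p - 1))))%:E)%E.
  by rewrite -EFin_expectation// lee_fin (piE (fun i j => mdist (x_ i) (x_ j) `^ p)).
have I1 : (\int[pi]_z (err z.1)%:E <= (e / s `^ (p - 1))%:E)%E.
  rewrite (@ge0_integral_law _ _ _ _ R pi mu fst measurable_fst pi1 (fun x => (err x)%:E)).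
  - exact: err_integral.
  - exact/measurable_EFinP.
  - by move=> x; rewrite lee_fin.
have I2 : (\int[pi]_z (err z.2)%:E <= (e / s `^ (p - 1))%:E)%E.
  rewrite (@ge0_integral_law _ _ _ _ R pi nu snd measurable_snd pi2 (fun x => (err x)%:E)).
  - exact: err_integral.
  - exact/measurable_EFinP.
  - by move=> x; rewrite lee_fin.
have mc : measurable_fun setT c by case: bc.
have me1 : measurable_fun setT (fun z : (borel X * borel X)%type => err z.1).
  exact: (measurableT_comp measurable_err measurable_fst).
have me2 : measurable_fun setT (fun z : (borel X * borel X)%type => err z.2).
  exact: (measurableT_comp measurable_err measurable_snd).
apply: (@le_trans _ _ (\int[pi]_z (a%:E * ((c z)%:E + ((err z.1)%:E + (err z.2)%:E))))%E).
  apply: le_integral_minorant => z; first by rewrite lee_fin powR_ge0.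
  rewrite -!EFinD -EFinM lee_fin mulrC -ler_pdivrMr//.
  have := three_legs z.1 (x_ (idx z.1)) (x_ (idx z.2)) z.2 p1 s0.
  by rewrite (metric_sym (x_ (idx z.2)) z.2) -/(err z.1) -/(err z.2) -/(c z); lra.
rewrite ge0_integralZl//; last 3 first.
- by apply: emeasurable_funD; [|apply: emeasurable_funD]; exact/measurable_EFinP.
- by move=> z _; rewrite -!EFinD lee_fin !addr_ge0.
- by rewrite lee_fin ltW.
rewrite ge0_integralD//; last 4 first.
- by move=> z _; rewrite lee_fin.
- exact/measurable_EFinP.
- by move=> z _; rewrite -EFinD lee_fin addr_ge0.
- by apply: emeasurable_funD; exact/measurable_EFinP.
rewrite ge0_integralD//; last 4 first.
- by move=> z _; rewrite lee_fin.
- exact/measurable_EFinP.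
- by move=> z _; rewrite lee_fin.
- exact/measurable_EFinP.
apply: (@le_trans _ _ (a%:E * ((a * (C + (e / s `^ (p - 1) + e / s `^ (p - 1))))%:E +
   ((e / s `^ (p - 1))%:E + (e / s `^ (p - 1))%:E)))%E).
  apply: lee_wpmul2l; first by rewrite lee_fin ltW.
  exact: leeD Ic (leeD I1 I2).
by rewrite -!EFinD -EFinM lee_fin.
Qed.

End cells.

(** Kantorovich duality, in the direction that produces couplings: partition the
    space into finitely many small cells and a remainder of small moment, and
    solve the resulting finite problem by linear programming. *)
Lemma kantorovich_coupling (x0 : X) eps : 1 < p -> separable X ->
  finite_moment x0 p mu -> finite_moment x0 p nu -> 0 < eps ->
  exists2 pi, couplings mu nu pi &
    (\int[pi]_z (mdist (z.1 : X) (z.2 : X) `^ p)%:E <= (C + eps)%:E)%E.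
Proof.
move=> p1 sepX mmu mnu eps0; have p0 : 0 < p by lra.
have [u uP] := separable_dense_seq x0 sepX.
have C0 : 0 <= C.
  have b0 : bmeas ((fun=> 0) : borel X -> R) by exact: bmeas_cst.
  apply: le_trans (dual b0); rewrite expectation_cst subr0.
  apply: Rintegral_ge0 => y _; apply: hopf_lax_ge => x.
  by rewrite add0r cost_ge0.
(* [s] is chosen so that the factor [a] is at most [1 + eta], and [e] so that the
   errors [e / s ^ (p - 1)] inside the cells equal [eps / 24] *)
pose eta := Num.min 1 (eps / (8 * (C + 1))).
have eta0 : 0 < eta by rewrite lt_min ltr01 divr_gt0// mulr_gt0//; lra.
have eta1 : eta <= 1 by rewrite ge_min lexx.
have etaC : eta * (8 * (C + 1)) <= eps.
  by rewrite -ler_pdivlMr ?mulr_gt0//; [rewrite ge_min lexx orbT|lra].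
have p10 : 0 < p - 1 by lra.
have [s' s'0 s'P] := powR_near p10 ler01 eta0.
pose s := s' / 2.
have s0 : 0 < s by rewrite /s; lra.
set a := (1 + 2 * s) `^ (p - 1).
have a1 : a <= 1 + eta.
  have := s'P (1 + 2 * s); rewrite powR1; apply; first by lra.
  by rewrite opprD addNKr normrN ger0_norm /s; lra.
have a0 : 0 <= a by exact: powR_ge0.
pose e' := eps / 24.
have sp0 : 0 < s `^ (p - 1) by rewrite powR_gt0.
pose e := e' * s `^ (p - 1).
have e0 : 0 < e by rewrite mulr_gt0// /e'; lra.
have e20 : 0 < e / 2 by lra.
pose r := (e / 2) `^ p^-1.
have r0 : 0 < r by rewrite powR_gt0.
have rE : r `^ p + e / 2 = e.
  by rewrite -powRrM mulVf ?gt_eqF// powRr1; lra.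
have : \forall n \near \oo,
    (\int[mu]_x (mdist (x : X) (cell_point x0 u (cell_index u r n x)) `^ p)%:E <= e%:E)%E /\
    (\int[nu]_x (mdist (x : X) (cell_point x0 u (cell_index u r n x)) `^ p)%:E <= e%:E)%E.
  near=> n; split; near: n; rewrite -rE; exact: cell_error_cvg.
move=> [n _ /(_ n (leqnn n))[mue nue]].
apply: (@coupling_of_cells _ (cell_index u r n) (cell_point x0 u (n := n)) e s
  (@measurable_cell_index _ _ u r n) (@measurable_mdist_cell _ _ p x0 u r n) mue nue _ p1 s0);
  last exact: measurable_mdist2.
rewrite -/a /e mulfK ?gt_eqF//.
have e'0 : 0 <= e' by rewrite /e'; lra.
have Ce : 0 <= C + (e' + e') by lra.
have h1 : a * (C + (e' + e')) <= (1 + eta) * (C + (e' + e')) by rewrite ler_wpM2r.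
have h2 : a * (a * (C + (e' + e')) + (e' + e')) <=
    (1 + eta) * ((1 + eta) * (C + (e' + e')) + (e' + e')).
  apply: ler_pM => //; last by rewrite lerD2r.
  by rewrite addr_ge0 ?mulr_ge0//; lra.
apply: le_trans h2 _.
have k1 : eta * eta <= eta by rewrite -[leRHS]mulr1 ler_wpM2l// ltW.
have k2 : eta * eta * C <= eta * C by rewrite ler_wpM2r.
have k3 : eta * e' <= e' by rewrite -[leRHS]mul1r ler_wpM2r.
have k4 : eta * eta * e' <= e' by rewrite (le_trans _ k3)// ler_wpM2r.
have k5 : 0 <= eta by rewrite ltW.
have : e' = eps / 24 by [].
have -> : (1 + eta) * ((1 + eta) * (C + (e' + e')) + (e' + e')) =
  C + 2 * (eta * C) + eta * eta * C + 4 * e' + 6 * (eta * e') + 2 * (eta * eta * e') by ring.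
lra.
Unshelve. all: by end_near. Qed.

End kantorovich.

(** * The exponential interpolation *)

Lemma norm_expRB1 {R : realType} (x c : R) : `|x| <= c -> `|expR x - 1| <= `|x| * expR c.
Proof.
move=> xc; apply: (@le_trans _ _ (`|x| * expR `|x|)); last first.
  by rewrite ler_wpM2l// ler_expR.
have [x0|/ltW x0] := leP 0 x.
  rewrite ger0_norm; last by rewrite subr_ge0 -expR0 ler_expR.
  rewrite (ger0_norm x0); have := expR_ge1Dx (- x).
  move=> /(ler_wpM2l (expR_ge0 x)); rewrite mulrDr -expRD subrr expR0; lra.
rewrite ler0_norm; last by rewrite subr_le0 -expR0 ler_expR.
rewrite (ler0_norm x0); have := expR_ge1Dx x.
have : 1 <= expR (- x) by rewrite -expR0 ler_expR oppr_ge0.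
move=> /(ler_wpM2l (_ : 0 <= - x)); rewrite oppr_ge0 => /(_ x0); lra.
Qed.

Section exponential_tilt.
Context d (T : measurableType d) (R : realType) (p : R).
Local Notation q := (conj_exp p).
Local Notation gamma := (gamma_const p).

Variables (Q : probability T R) (k : T -> R) (C0 h : R).
Hypotheses (bk : bmeas k) (kC : forall z, `|k z| <= C0) (h0 : 0 < h).
Local Notation N := (\int[Q]_z expR (h * k z)).
Local Notation rho := (fun z => expR (h * k z) / \int[Q]_z expR (h * k z)).

Let bc (r : R) : bmeas (fun _ : T => r). Proof. exact: bmeas_cst. Qed.

Let bE : bmeas (fun z => expR (h * k z)).
Proof. by apply: bmeas_expR; exact: bmeasM. Qed.

Let hk z : `|h * k z| <= h * C0.
Proof. by rewrite normrM (gtr0_norm h0) ler_wpM2l// ltW. Qed.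

Let tilt_upper z : expR (h * k z) <= expR (h * C0).
Proof. by rewrite ler_expR (le_trans (ler_norm _)). Qed.

Let tilt_lower z : expR (- (h * C0)) <= expR (h * k z).
Proof. by rewrite ler_expR lerNl (le_trans (ler_norm _))// normrN. Qed.

Let mass_upper : N <= expR (h * C0).
Proof. by rewrite -[leRHS](expectation_cst Q); exact: le_expectation. Qed.

Let mass_lower : expR (- (h * C0)) <= N.
Proof. by rewrite -[leLHS](expectation_cst Q); exact: le_expectation. Qed.

Let mass_gt0 : 0 < N.
Proof. by rewrite (lt_le_trans _ mass_lower)// expR_gt0. Qed.

Let brho : bmeas rho. Proof. exact: bmeasM. Qed.

Let expectation_rho : \int[Q]_z rho z = 1.
Proof.
transitivity (\int[Q]_z (N^-1 * expR (h * k z))).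
  by apply: eq_Rintegral => z _; rewrite mulrC.
by rewrite expectationZ// mulVf// gt_eqF.
Qed.

Let rho_lower z : expR (- (2 * h * C0)) <= rho z.
Proof.
rewrite ler_pdivlMr//; apply: (le_trans _ (tilt_lower z)).
apply: le_trans (ler_wpM2l (expR_ge0 _) mass_upper) _.
rewrite -expRD ler_expR; lra.
Qed.

Let bkp : 0 <= p -> bmeas (fun z => `|k z| `^ p).
Proof. by move=> p0; exact: bmeas_norm_powR. Qed.

(** [rho - 1] is the centering of [expR (h k) - 1], up to the factor [N]. *)
Let rho_deviation : 1 < p -> \int[Q]_z (`|rho z - 1| `^ p) <=
  (h * gamma * expR (2 * h * C0)) `^ p * \int[Q]_z (`|k z| `^ p).
Proof.
move=> p1; have p0 : 0 <= p by lra.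
have g0 : 0 <= gamma by exact: le_trans ler01 (gamma_ge1 p1).
pose phi z := expR (h * k z) - 1.
have bphi : bmeas phi by exact: bmeasB.
have Ephi : \int[Q]_z phi z = N - 1 by rewrite expectationB// expectation_cst.
have NV0 : 0 <= N^-1 by rewrite invr_ge0 ltW.
have bcen : bmeas (fun z => `|phi z - \int[Q]_z phi z| `^ p).
  by apply: bmeas_norm_powR => //; exact: bmeasB.
have -> : \int[Q]_z (`|rho z - 1| `^ p) =
    N^-1 `^ p * \int[Q]_z (`|phi z - \int[Q]_z phi z| `^ p).
  rewrite -expectationZ//; apply: eq_Rintegral => z _.
  rewrite -powRM// Ephi; congr (_ `^ _).
  rewrite -[X in _ = X * _](ger0_norm NV0) -normrM; congr (`| _ |).
  by rewrite /phi; field; rewrite gt_eqF.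
have I0 : 0 <= \int[Q]_z (`|k z| `^ p).
  by apply: Rintegral_ge0 => z _; exact: powR_ge0.
have E0 : 0 <= expR (h * C0) by exact: expR_ge0.
have hE0 : 0 <= h * expR (h * C0) by rewrite mulr_ge0// ltW.
have h2 : \int[Q]_z (`|phi z| `^ p) <= (h * expR (h * C0)) `^ p * \int[Q]_z (`|k z| `^ p).
  rewrite -(expectationZ Q _ (bkp p0)); apply: le_expectation.
  - exact: bmeas_norm_powR.
  - by apply: bmeasM; [exact: bc|exact: bkp].
  - move=> z; rewrite -powRM//.
    rewrite ge0_ler_powR ?nnegrE ?mulr_ge0 ?(ltW h0)//.
    have := norm_expRB1 (hk z); rewrite normrM (gtr0_norm h0) /phi.
    by move=> /le_trans; apply; rewrite mulrAC.
have h3 : N^-1 `^ p <= expR (h * C0) `^ p.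
  rewrite ge0_ler_powR ?nnegrE//.
  by rewrite -[leRHS]invrK lef_pV2 ?posrE ?invr_gt0 ?expR_gt0// -expRN.
apply: (@le_trans _ _ (expR (h * C0) `^ p * (gamma `^ p * ((h * expR (h * C0)) `^ p * \int[Q]_z (`|k z| `^ p))))).
  apply: ler_pM h3 _; [exact: powR_ge0| |].
    by apply: Rintegral_ge0 => z _; exact: powR_ge0.
  apply: le_trans (centering_bound Q p1 bphi) _.
  by rewrite ler_wpM2l// powR_ge0.
rewrite le_eqVlt; apply/orP; left; apply/eqP.
rewrite mulrA -(powRM p E0 g0) mulrA -(powRM p (mulr_ge0 E0 g0) hE0).
congr (_ `^ _ * _); have -> : 2 * h * C0 = h * C0 + h * C0 by ring.
by rewrite expRD; ring.
Qed.

(** The increment is [E ((g - c) (rho - 1)) - E ((g - g') rho)] with [rho] the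
    density of the tilted measure. Young's inequality splits the first term, and
    the centering of [rho - 1] brings in the constant [gamma]. *)
Lemma tilt_step (g g' : T -> R) (s c : R) :
  1 < p -> bmeas g -> bmeas g' -> 0 < s -> (forall z, g' z <= g z) ->
  (\int[Q]_z (g' z * expR (h * k z))) / N - \int[Q]_z g z <=
  s `^ p * ((h * gamma * expR (2 * h * C0)) `^ p * \int[Q]_z (`|k z| `^ p))
  + legendre_const p * s `^ (- q) * \int[Q]_z (`|g z - c| `^ q)
  - expR (- (2 * h * C0)) * \int[Q]_z (g z - g' z).
Proof.
move=> p1 bg bg' s0 gg'.
have p0 : 0 <= p by lra.
have q0 : 0 <= q by have := conj_exp_gt1 p1; lra.
have bgc : bmeas (fun z => `|g z - c| `^ q).
  by apply: bmeas_norm_powR => //; exact: bmeasB.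
have br1 : bmeas (fun z => rho z - 1) by exact: bmeasB.
have brp : bmeas (fun z => `|rho z - 1| `^ p) by exact: bmeas_norm_powR.
have bgc1 : bmeas (fun z => g z - c) by exact: bmeasB.
have bprod : bmeas (fun z => (g z - c) * (rho z - 1)) by exact: bmeasM.
have bdiff : bmeas (fun z => g z - g' z) by exact: bmeasB.
have bdr : bmeas (fun z => (g z - g' z) * rho z) by exact: bmeasM.
have bgr : bmeas (fun z => g' z * rho z) by exact: bmeasM.
have Erho1 : \int[Q]_z (rho z - 1) = 0.
  by rewrite (expectationB Q brho (bc 1)) expectation_rho expectation_cst subrr.
have split : (\int[Q]_z (g' z * expR (h * k z))) / N - \int[Q]_z g z =
    \int[Q]_z ((g z - c) * (rho z - 1)) - \int[Q]_z ((g z - g' z) * rho z).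
  have -> : (\int[Q]_z (g' z * expR (h * k z))) / N = \int[Q]_z (g' z * rho z).
    rewrite mulrC -expectationZ//; last exact: bmeasM.
    by apply: eq_Rintegral => z _; ring.
  rewrite -(expectationB Q bgr bg) -(expectationB Q bprod bdr).
  transitivity (\int[Q]_z ((g' z * rho z - g z) - c * (rho z - 1))).
    rewrite (expectationB Q (bmeasB bgr bg) (bmeasM (bc c) br1)).
    by rewrite (expectationZ Q c br1) Erho1 mulr0 subr0.
  by apply: eq_Rintegral => z _; ring.
rewrite split; apply: lerB.
  apply: (@le_trans _ _ (\int[Q]_z (s `^ p * `|rho z - 1| `^ p +
      legendre_const p * s `^ (- q) * `|g z - c| `^ q))).
    apply: le_expectation => //; first by apply: bmeasD; apply: bmeasM.
    move=> z; apply: le_trans (ler_norm _) _; rewrite normrM mulrC.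
    exact: young_legendre_scale.
  rewrite (expectationD Q (bmeasM (bc _) brp) (bmeasM (bc _) bgc)).
  rewrite (expectationZ Q _ brp) (expectationZ Q _ bgc) lerD2r.
  by rewrite ler_wpM2l ?powR_ge0// rho_deviation.
rewrite -(expectationZ Q _ bdiff); apply: le_expectation => //; first exact: bmeasM.
by move=> z; rewrite mulrC ler_wpM2l ?subr_ge0.
Qed.

End exponential_tilt.

Section interpolation.
Context d (T : measurableType d) (R : realType) (X : completeMetricType R) (p : R).
Local Notation q := (conj_exp p).
Local Notation gamma := (gamma_const p).
Variables (P : probability T R) (nu : probability (borel X) R) (Y : T -> borel X).
Hypothesis mY : measurable_fun setT Y.
Hypothesis lawY : forall A, measurable A -> P (Y @^-1` A) = nu A.
Variables (u v : T -> R) (a b M : R).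
Hypotheses (bu : bmeas u) (bv : bmeas v).
Hypothesis uab : forall z, a <= u z <= a + M.
Hypothesis vab : forall z, b <= v z <= b + M.
Variables (f : X -> R) (A : R).
Hypothesis fA : forall x, `|f x| <= A.
Variables (B kappa tau : R).
Hypothesis B0 : 0 < B.
Hypothesis poincare : (poincare_const q nu < B%:E)%E.
Hypothesis uv_p : \int[P]_z (`|u z - v z| `^ p) <= kappa.

Definition tilt (t : R) (z : T) := expR (- (u z + t * (v z - u z))).

Let mid t := a + t * (b - a).

Lemma bmeas_tilt t : bmeas (tilt t).
Proof.
apply: bmeas_expR; apply: bmeasN; apply: bmeasD => //.
by apply: bmeasM; [exact: bmeas_cst|exact: bmeasB].
Qed.

#[local] Hint Resolve bmeas_tilt : core.

Let tilt_bounds t z : 0 <= t <= 1 ->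
  expR (- (mid t + M)) <= tilt t z <= expR (- mid t).
Proof.
move=> /andP[t0 t1]; have /andP[u1 u2] := uab z; have /andP[v1 v2] := vab z.
have t1' : 0 <= 1 - t by lra.
have := ler_wpM2l t0 v1; have := ler_wpM2l t0 v2.
have := ler_wpM2l t1' u1; have := ler_wpM2l t1' u2.
by move=> *; rewrite !ler_expR /mid; apply/andP; split; lra.
Qed.

Definition tilted t : probability T R := posterior P (tilt t).

Let tilt_mass t : 0 <= t <= 1 ->
  expR (- (mid t + M)) <= \int[P]_z tilt t z <= expR (- mid t).
Proof.
move=> t01; apply/andP; split.
  rewrite -[leLHS](expectation_cst P); apply: le_expectation => //.
    exact: bmeas_cst.
  by move=> z; have /andP[] := tilt_bounds z t01.
rewrite -[leRHS](expectation_cst P); apply: le_expectation => //.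
  exact: bmeas_cst.
by move=> z; have /andP[] := tilt_bounds z t01.
Qed.

Let tilt_mass_gt0 t : 0 < \int[P]_z tilt t z.
Proof. by apply: expectation_gt0 => // z; exact: expR_gt0. Qed.

Let expectation_tilted t (g : T -> R) : bmeas g ->
  \int[tilted t]_z g z = (\int[P]_z (g z * tilt t z)) / \int[P]_z tilt t z.
Proof. by move=> bg; apply: expectation_posterior_gt0 => // z; exact: expR_gt0. Qed.

(** The normalised weight is at most [expR M], as the exponent oscillates by at
    most [M]. *)
Lemma le_tilted t (g : T -> R) : 0 <= t <= 1 -> bmeas g -> (forall z, 0 <= g z) ->
  \int[tilted t]_z g z <= expR M * \int[P]_z g z.
Proof.
move=> t01 bg g0; rewrite expectation_tilted// ler_pdivrMr//.
have /andP[m1 m2] := tilt_mass t01.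
have I0 : 0 <= \int[P]_z g z by apply: Rintegral_ge0.
apply: (@le_trans _ _ (expR (- mid t) * \int[P]_z g z)).
  rewrite -expectationZ//; apply: le_expectation => //.
  - exact: bmeasM.
  - by apply: bmeasM => //; exact: bmeas_cst.
  - by move=> z; rewrite mulrC ler_wpM2r//; have /andP[] := tilt_bounds z t01.
have -> : expR (- mid t) = expR M * expR (- (mid t + M)).
  by rewrite -expRD; congr expR; ring.
by rewrite mulrAC ler_wpM2l// mulr_ge0 ?expR_ge0.
Qed.

(** The upper and lower bounds of the density of [tilted t] differ by the factor
    [expR M], so that inequalities between integrals of nonnegative functions
    survive the tilting at this price. *)
Let le_tilted2 t (g g' : T -> R) : 0 <= t <= 1 -> bmeas g -> bmeas g' ->
  (forall z, 0 <= g z) -> (forall z, 0 <= g' z) ->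
  forall r eta, 0 <= r -> \int[P]_z g z <= r * \int[P]_z g' z + eta -> 0 <= eta ->
  \int[tilted t]_z g z <= expR M * (r * \int[tilted t]_z g' z) + expR M * eta.
Proof.
move=> t01 bg bg' g0 g'0 r eta r0 gg' eta0.
have /andP[m1 m2] := tilt_mass t01; have Z0 := tilt_mass_gt0 t.
set Z := \int[P]_z tilt t z in m1 m2 Z0.
have E1 : expR (- mid t) = expR M * expR (- (mid t + M)).
  by rewrite -expRD; congr expR; ring.
have H1 : \int[P]_z (g z * tilt t z) <= expR (- mid t) * \int[P]_z g z.
  rewrite -expectationZ//; apply: le_expectation => //.
  - exact: bmeasM.
  - by apply: bmeasM => //; exact: bmeas_cst.
  - by move=> z; rewrite mulrC ler_wpM2r//; have /andP[] := tilt_bounds z t01.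
have H2 : expR (- (mid t + M)) * \int[P]_z g' z <= \int[P]_z (g' z * tilt t z).
  rewrite -expectationZ//; apply: le_expectation => //.
  - by apply: bmeasM => //; exact: bmeas_cst.
  - exact: bmeasM.
  - by move=> z; rewrite mulrC ler_wpM2l//; have /andP[] := tilt_bounds z t01.
rewrite !expectation_tilted// -/Z ler_pdivrMr// mulrDl.
have -> : expR M * (r * (\int[P]_z (g' z * tilt t z) / Z)) * Z =
    expR M * (r * \int[P]_z (g' z * tilt t z)) by field; rewrite gt_eqF.
apply: le_trans H1 _.
apply: (@le_trans _ _ (expR (- mid t) * (r * \int[P]_z g' z + eta))).
  by rewrite ler_wpM2l// expR_ge0.
rewrite mulrDr E1; apply: lerD.
  rewrite -mulrA ler_wpM2l ?expR_ge0// mulrCA.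
  by rewrite ler_wpM2l// mulrC.
by rewrite -!mulrA ler_wpM2l ?expR_ge0// mulrC ler_wpM2l.
Qed.

Let time t := tau + (1 - tau) * t.

(** The Hopf-Lax evolution of [f] tested against the second marginal of the
    exponential interpolation between the weights [expR (- u)] and
    [expR (- v)]. *)
Definition pairing t := \int[tilted t]_z hopf_lax p (time t) f (Y z).

(** With [kappa = K ^ p * W ^ p] this is [V ^ p / (1 - tau) ^ (p - 1)], where
    [V = gamma * K * B ^ (1/q) * expR M * W] is the length of the second leg. *)
Let Lambda := (expR M * B) `^ (p - 1) * gamma `^ p * (expR M * kappa) / (1 - tau) `^ (p - 1).

Let k z := u z - v z.

Let bk : bmeas k. Proof. exact: bmeasB. Qed.

Let tiltD t h z : tilt (t + h) z = expR (h * k z) * tilt t z.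
Proof. by rewrite /tilt /k -expRD; congr expR; ring. Qed.

Let tilted_add t h (g : T -> R) : bmeas g -> \int[tilted (t + h)]_z g z =
  (\int[tilted t]_z (g z * expR (h * k z))) / \int[tilted t]_z expR (h * k z).
Proof.
move=> bg; have bE : bmeas (fun z => expR (h * k z)).
  by apply: bmeas_expR; apply: bmeasM => //; exact: bmeas_cst.
rewrite !expectation_tilted//; last exact: bmeasM.
have -> : \int[P]_z (g z * expR (h * k z) * tilt t z) = \int[P]_z (g z * tilt (t + h) z).
  by apply: eq_Rintegral => z _; rewrite tiltD mulrA.
have E : \int[P]_z (expR (h * k z) * tilt t z) = \int[P]_z tilt (t + h) z.
  by apply: eq_Rintegral => z _; rewrite tiltD.
have := tilt_mass_gt0 (t + h); rewrite E.
move: (\int[P]_z tilt (t + h) z) (tilt_mass_gt0 t) => Z' Z0 Z'0.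
by field; rewrite !gt_eqF.
Qed.

(** The value of [s] in [tilt_step] makes the Poincare term cancel against the
    decrease of the Hopf-Lax semigroup. *)
Let pairing_step_bound C0 t h : 1 < p -> 0 < tau < 1 -> (forall z, `|k z| <= C0) ->
  0 <= t -> 0 < h -> t + h <= 1 ->
  let h' := (1 - tau) * h in
  let lambda := ((time t + h') / time t) `^ p in
  let E := expR (2 * h * C0) in
  pairing (t + h) - pairing t <=
    (expR M * B * lambda * E / h') `^ (p - 1) * ((h * gamma * E) `^ p * (expR M * kappa)).
Proof.
move=> p1 /andP[tau0 tau1] kC t0 h0 th1 /=; set h' := (1 - tau) * h.
set lambda := (_ / time t) `^ p; set E := expR (2 * h * C0).
have t01 : 0 <= t <= 1 by rewrite t0; lra.
have h'0 : 0 < h' by rewrite mulr_gt0//; lra.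
have theta0 : 0 < time t.
  by rewrite /time ltr_pwDl// mulr_ge0//; lra.
have timeD : time (t + h) = time t + h' by rewrite /time /h'; ring.
have q0 : 0 < q by have := conj_exp_gt1 p1; lra.
have c0 := legendre_const_gt0 p1.
have lambda0 : 0 < lambda by rewrite powR_gt0// divr_gt0//; lra.
have E0 : 0 < E by exact: expR_gt0.
set S := expR M * B * lambda * E / h'.
have S0 : 0 < S by rewrite divr_gt0// !mulr_gt0// expR_gt0.
have SV0 : 0 < S^-1 by rewrite invr_gt0.
pose s := S `^ q^-1.
have s0 : 0 < s by exact: powR_gt0.
have sq : s `^ (- q) = S^-1.
  by rewrite /s -powRrM mulrN mulVf ?gt_eqF// powR_inv1// ltW.
have sp : s `^ p = S `^ (p - 1) by rewrite /s -powRrM mul_conj_expV.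
pose g z := hopf_lax p (time t) f (Y z).
pose g' z := hopf_lax p (time t + h') f (Y z).
have theta'0 : 0 < time t + h' by rewrite addr_gt0.
have bQ r : 0 < r -> bmeas (hopf_lax p r f : borel X -> R).
  by move=> r0; exact: (bmeas_hopf_lax fA).
have bg : bmeas g by apply: (bmeas_comp mY); exact: bQ.
have bg' : bmeas g' by apply: (bmeas_comp mY); exact: bQ.
have gg' z : g' z <= g z by exact: (hopf_lax_decreasing fA).
have bgg' : bmeas (fun z => g z - g' z) by exact: bmeasB.
have gg'0 z : 0 <= g z - g' z by rewrite subr_ge0.
have Ek : \int[tilted t]_z (`|k z| `^ p) <= expR M * kappa.
  have bkp : bmeas (fun z => `|k z| `^ p) by apply: bmeas_norm_powR => //; lra.
  apply: le_trans (le_tilted t01 bkp (fun z => powR_ge0 _ _)) _.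
  by rewrite ler_wpM2l// expR_ge0.
have pE : pairing (t + h) - pairing t =
    (\int[tilted t]_z (g' z * expR (h * k z))) / \int[tilted t]_z expR (h * k z)
    - \int[tilted t]_z g z.
  by rewrite /pairing timeD tilted_add.
apply/ler_addgt0Pr => eta eta0.
pose eta' := eta / (legendre_const p * S^-1 * expR M).
have cSM0 : 0 < legendre_const p * S^-1 * expR M.
  exact: mulr_gt0 (mulr_gt0 c0 SV0) (expR_gt0 _).
have eta'0 : 0 < eta' by rewrite divr_gt0.
have [c] := poincare_hopf_lax fA p1 theta0 h'0 eta'0 poincare.
rewrite -/lambda.
set r := (legendre_const p)^-1 * lambda / h'.
have r0 : 0 <= r.
  by apply: divr_ge0 (ltW h'0); apply: mulr_ge0 (ltW lambda0); rewrite invr_ge0 ltW.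
have bgc : bmeas (fun y : borel X => `|hopf_lax p (time t) f y - c| `^ q).
  apply: bmeas_norm_powR; first exact: ltW.
  by apply: bmeasB; [exact: bQ|exact: bmeas_cst].
have bgcT : bmeas (fun z => `|g z - c| `^ q) by exact: (bmeas_comp mY bgc).
rewrite -(expectation_law mY lawY bgc).
rewrite -(expectation_law mY lawY (bmeasB (bQ _ theta0) (bQ _ theta'0))) => PI.
rewrite [B * _]mulrA in PI.
have Br0 : 0 <= B * r by rewrite mulr_ge0// ltW.
have := le_tilted2 t01 bgcT bgg' (fun z => powR_ge0 _ _) gg'0 Br0 PI (ltW eta'0).
have := tilt_step (tilted t) bk kC h0 c p1 bg bg' s0 gg'.
rewrite -pE sq sp -/E expRN -/E.
move: Ek; set Ik := \int[tilted t]_z (`|k z| `^ p).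
set Ig := \int[tilted t]_z (`|_| `^ q).
set Id := \int[tilted t]_z (g z - g' z).
move: (pairing (t + h) - pairing t) => incr Ek H1 H2; apply: le_trans H1 _.
have cS0 : 0 <= legendre_const p * S^-1 by exact: ltW (mulr_gt0 c0 SV0).
have K1 : legendre_const p * S^-1 * Ig <= E^-1 * Id + eta.
  apply: le_trans (ler_wpM2l cS0 H2) _.
  rewrite mulrDr; apply: lerD.
    rewrite le_eqVlt; apply/orP; left; apply/eqP; rewrite /S /r.
    by field; rewrite !gt_eqF ?expR_gt0.
  by rewrite mulrA /eta' mulrC divfK// gt_eqF.
have K2 : S `^ (p - 1) * ((h * gamma * E) `^ p * Ik) <=
    S `^ (p - 1) * ((h * gamma * E) `^ p * (expR M * kappa)).
  by rewrite ler_wpM2l ?powR_ge0// ler_wpM2l ?powR_ge0.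
by rewrite -addrA lerD// lerBlDl.
Qed.

Let kappa_ge0 : 0 <= kappa.
Proof. by apply: le_trans uv_p; apply: Rintegral_ge0 => z _; exact: powR_ge0. Qed.

Let expR_powR (x r : R) : expR x `^ r = expR (r * x).
Proof. by rewrite powR_expR ?expR_gt0// expRK. Qed.

(** The bound of [pairing_step_bound] is [h * Lambda] up to powers of [lambda] and of
    [expR (2 * h * C0)], which are both [1 + O(h)]. *)
Lemma pairing_step : 1 < p -> 0 < tau < 1 -> exists D, forall t h,
  0 <= t -> 0 < h -> t + h <= 1 ->
  pairing (t + h) - pairing t <= h * (Lambda * expR (h * D)).
Proof.
move=> p1 tau01; have /andP[tau0 tau1] := tau01; have [_ [C0 kC]] := bk.
exists (p * (p - 1) / tau + 2 * C0 * (2 * p - 1)) => t h t0 h0 th1.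
apply: le_trans (pairing_step_bound p1 tau01 kC t0 h0 th1) _.
have p0 : 0 < p by lra.
have p10 : 0 <= p - 1 by lra.
have tau10 : 0 < 1 - tau by lra.
have theta_tau : tau <= time t by rewrite /time lerDl mulr_ge0// ltW.
have theta0 : 0 < time t by exact: lt_le_trans theta_tau.
have g0 : 0 <= gamma by exact: le_trans ler01 (gamma_ge1 p1).
set h' := (1 - tau) * h; have h'0 : 0 < h' by rewrite mulr_gt0.
set lambda := ((time t + h') / time t) `^ p.
have lambda0 : 0 <= lambda by exact: powR_ge0.
have lambda_le : lambda `^ (p - 1) <= expR (p * (p - 1) / tau * h).
  have le1 : (time t + h') / time t <= expR (h / tau).
    apply: le_trans (expR_ge1Dx _); rewrite mulrDl mulfV ?gt_eqF// lerD2l.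
    apply: (@le_trans _ _ (h / time t)).
      by rewrite ler_wpM2r ?invr_ge0 ?(ltW theta0)// /h' ler_piMl ?(ltW h0)//; lra.
    by rewrite ler_wpM2l ?(ltW h0)// lef_pV2.
  have le2 : lambda <= expR (h / tau) `^ p.
    have n0 : 0 <= (time t + h') / time t.
      by apply: divr_ge0 (ltW theta0); apply: addr_ge0; exact: ltW.
    exact: (ge0_ler_powR (ltW p0) n0 (expR_ge0 _) le1).
  have := ge0_ler_powR p10 lambda0 (powR_ge0 _ _) le2.
  rewrite -powRrM expR_powR => /le_trans; apply.
  by rewrite ler_expR le_eqVlt; apply/orP; left; apply/eqP; ring.
set E := expR (2 * h * C0).
have E0 : 0 < E by exact: expR_gt0.
have EE : E `^ (p - 1) * E `^ p = expR (2 * C0 * (2 * p - 1) * h).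
  by rewrite !expR_powR -expRD; congr expR; ring.
have MB0 : 0 <= expR M * B by rewrite mulr_ge0 ?expR_ge0// ltW.
have hp : h `^ p = h * h `^ (p - 1) by rewrite mulr_powRB1// ltW.
have h'p : (h'^-1) `^ (p - 1) = ((1 - tau) `^ (p - 1) * h `^ (p - 1))^-1.
  rewrite -powRM ?(ltW tau10) ?(ltW h0)// -[h'^-1]powR_inv1 ?(ltW h'0)//.
  by rewrite -powRrM mulN1r powRN.
have hp0 : 0 < h `^ (p - 1) by exact: powR_gt0.
have taup0 : 0 < (1 - tau) `^ (p - 1) by exact: powR_gt0.
have -> : (expR M * B * lambda * E / h') `^ (p - 1) * ((h * gamma * E) `^ p * (expR M * kappa)) =
    h * (Lambda * (lambda `^ (p - 1) * (E `^ (p - 1) * E `^ p))).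
  rewrite (@powRM _ (expR M * B * lambda * E) h'^-1); last 2 first.
  - exact: mulr_ge0 (mulr_ge0 MB0 lambda0) (ltW E0).
  - by rewrite invr_ge0 ltW.
  rewrite (@powRM _ (expR M * B * lambda) E); last 2 first.
  - exact: mulr_ge0 MB0 lambda0.
  - exact: ltW.
  rewrite (@powRM _ (expR M * B) lambda)// h'p.
  rewrite (@powRM _ (h * gamma) E) ?mulr_ge0 ?(ltW h0) ?(ltW E0)//.
  rewrite (@powRM _ h gamma) ?(ltW h0)// hp /Lambda.
  move: (_ `^ (p - 1)) (lambda `^ _) (E `^ (p - 1)) (h `^ (p - 1)) hp0 ((1 - tau) `^ (p - 1)) taup0 (gamma `^ p) (E `^ p).
  move=> x1 x2 x3 x4 x40 x5 x50 x6 x7.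
  by field; rewrite !gt_eqF.
have L0 : 0 <= Lambda.
  apply: divr_ge0; last exact: powR_ge0.
  apply: mulr_ge0; first by apply: mulr_ge0; exact: powR_ge0.
  exact: mulr_ge0 (expR_ge0 _) kappa_ge0.
rewrite ler_wpM2l ?(ltW h0)// ler_wpM2l// EE.
apply: (@le_trans _ _ (expR (p * (p - 1) / tau * h) * expR (2 * C0 * (2 * p - 1) * h))).
  by rewrite ler_wpM2r// expR_ge0.
by rewrite -expRD ler_expR le_eqVlt; apply/orP; left; apply/eqP; ring.
Qed.

Let add_increments (x1 x2 x3 L r s : R) :
  x1 - x2 <= s * L -> x2 - x3 <= r * L -> x1 - x3 <= (r + s) * L.
Proof. by move=> h1 h2; rewrite mulrDl; lra. Qed.

(** Summing [pairing_step] over [n.+1] equal steps leaves the factor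
    [expR (D / n.+1)], which tends to [1]. *)
Lemma pairing_increment : 1 < p -> 0 < tau < 1 -> pairing 1 - pairing 0 <= Lambda.
Proof.
move=> p1 tau01; have [D step] := pairing_step p1 tau01.
have stepN (n : nat) (i : nat) : (i <= n.+1)%N ->
    pairing (i%:R / n.+1%:R) - pairing 0 <= i%:R / n.+1%:R * (Lambda * expR (n.+1%:R^-1 * D)).
  elim: i => [_|i IH i_n]; first by rewrite !mul0r subrr.
  have n0 : 0 < n.+1%:R :> R by rewrite ltr0n.
  have := IH (ltnW i_n).
  have := step (i%:R / n.+1%:R) n.+1%:R^-1.
  have E : i%:R / n.+1%:R + n.+1%:R^-1 = i.+1%:R / n.+1%:R :> R.
    by rewrite -[i.+1]addn1 natrD mulrDl mul1r.
  rewrite E divr_ge0// invr_gt0 n0 ler_pdivrMr// mul1r ler_nat i_n.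
  move=> /(_ isT isT isT) h1 h2; rewrite -E; apply: add_increments h2.
  by rewrite E.
have stepN1 n : pairing 1 - pairing 0 <= Lambda * expR (n.+1%:R^-1 * D).
  by have := stepN n n.+1 (leqnn _); rewrite mulfV ?mul1r// pnatr_eq0.
have cD : (fun n => n.+1%:R^-1 * D) @ \oo --> 0 * D.
  by apply: cvgM; [exact: cvg_harmonic|exact: cvg_cst].
have cv : Lambda * expR (n.+1%:R^-1 * D) @[n --> \oo] --> Lambda * expR (0 * D).
  apply: cvgM; first exact: cvg_cst.
  exact: (cvg_comp _ _ cD (@continuous_expR R (0 * D))).
rewrite mul0r expR0 mulr1 in cv.
rewrite -(cvg_lim _ cv)//; apply: limr_ge.
  by apply/cvg_ex; exists Lambda.
by apply: nearW => n; exact: stepN1.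
Qed.

End interpolation.

(** * From couplings of the priors to the posteriors *)

Section transfer.
Context d d' (T : measurableType d) (T' : measurableType d') (R : realType).
Variables (P : probability T R) (Q : probability T' R) (Y : T -> T').
Hypothesis mY : measurable_fun setT Y.
Hypothesis lawY : forall A, measurable A -> P (Y @^-1` A) = Q A.

Lemma ae_law (S : set T') : {ae Q, forall y, S y} -> {ae P, forall x, S (Y x)}.
Proof.
move=> [N [mN N0 sub]]; exists (Y @^-1` N); split.
- by rewrite -[X in measurable X]setTI; exact: mY.
- by rewrite [LHS]lawY.
- by move=> x Sx; exact: sub.
Qed.

Lemma eq_expectation_ae (f g : T -> R) : bmeas f -> bmeas g ->
  {ae P, forall x, f x = g x} -> \int[P]_x f x = \int[P]_x g x.
Proof.
move=> [mf _] [mg _] fg; congr fine; apply: ae_eq_integral => //.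
- exact/measurable_EFinP.
- exact/measurable_EFinP.
- by apply: filterS fg => x -> _.
Qed.

(** Reweighting by a function of [Y] commutes with taking the law of [Y]. *)
Lemma expectation_posterior_law (L : T -> R) (L' f : T' -> R) :
  bmeas L -> (forall x, 0 < L x) -> bmeas L' -> (forall y, 0 < L' y) ->
  {ae P, forall x, L x = L' (Y x)} -> bmeas f ->
  \int[posterior P L]_x f (Y x) = \int[posterior Q L']_y f y.
Proof.
move=> bL L0 bL' L'0 LL' bf.
have bfY := bmeas_comp mY bf; have bLY := bmeas_comp mY bL'.
rewrite !expectation_posterior_gt0//.
rewrite (eq_expectation_ae bL bLY LL') (expectation_law mY lawY bL').
rewrite (eq_expectation_ae (bmeasM bfY bL) (bmeasM bfY bLY)); last first.
  by apply: filterS LL' => x ->.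
by rewrite (expectation_law mY lawY (bmeasM bf bL')).
Qed.

End transfer.

(** The number [a] is the essential infimum, which is finite because [f] is
    nonnegative and takes finite values. *)
Lemma ess_osc_interval d (T : measurableType d) (R : realType)
    (mu : probability T R) (f : T -> R) (M : R) : (forall x, 0 <= f x) ->
  (ess_sup mu (EFin \o f) - ess_inf mu (EFin \o f) <= M%:E)%E ->
  exists a, {ae mu, forall x, a <= f x <= a + M}.
Proof.
move=> f0; set s := ess_sup _ _; set i := ess_inf _ _ => sM.
have muT : (0 < mu setT)%E by rewrite [X in (_ < X)%E](_ : _ = 1%E)//; exact: probability_setT.
have ae_proper := ae_properfilter_algebraOfSetsType muT.
have i0 : (0 <= i)%E by apply/ess_infP; apply: nearW => x; rewrite lee_fin.
have ile := @ess_inf_le _ _ _ mu (EFin \o f); rewrite -/i in ile.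
have sge := @ess_sup_ge _ _ _ mu (EFin \o f); rewrite -/s in sge.
have [r ir] : exists r, i = r%:E.
  move: i0 ile; case: (i) => [r _ _|_ h|//]; first by exists r.
  by have [x] := filter_ex h; rewrite /= leye_eq.
exists r; move: sM; rewrite ir leeBlDr// => sM.
near=> x; apply/andP; split.
  by rewrite -lee_fin -ir; near: x.
rewrite -lee_fin addrC EFinD; apply: le_trans sM.
by near: x.
Unshelve. all: by end_near. Qed.

Section posterior_transport.
Context {R : realType} {X : completeMetricType R} (p : R).
Local Notation q := (conj_exp p).
Local Notation gamma := (gamma_const p).
Variables (sepX : separable X) (xstar : X) (Phi : X -> R).
Hypothesis Phi_ge0 : forall x, 0 <= Phi x.
Hypothesis lipPhi : (lip_const Phi < +oo)%E.
Local Notation L := (fun x : X => expR (- Phi x)).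
Local Notation K := (fine (lip_const Phi)).

Let mPhi : measurable_fun setT (Phi : borel X -> R).
Proof. by apply: lipschitz_measurable; exact: lip_constP. Qed.

Let bL : bmeas (L : borel X -> R).
Proof.
split; first by apply: measurableT_comp => //; exact: measurableT_comp.
by exists 1 => x; rewrite ger0_norm ?expR_ge0// -expR0 ler_expR oppr_le0.
Qed.

Let L0 (x : borel X) : 0 < L x. Proof. exact: expR_gt0. Qed.

Let K0 : 0 <= K.
Proof. by rewrite fine_ge0// /lip_const le_max lexx. Qed.

Lemma finite_moment_posterior (mu : probability (borel X) R) :
  finite_moment xstar p mu -> finite_moment xstar p (posterior mu L).
Proof.
move=> fm; rewrite /finite_moment; have [mL _] := bL.
have Lint : (0 < \int[mu]_x (L x)%:E)%E.
  by rewrite -EFin_expectation// lte_fin expectation_gt0.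
have Linf : (\int[mu]_x (L x)%:E < +oo)%E by rewrite -EFin_expectation// ltry.
have md : measurable_fun setT (fun x : borel X => (mdist (x : X) xstar `^ p)%:E).
  apply/measurable_EFinP; apply: (measurableT_comp (measurable_powR _)) => //.
  exact: measurable_mdist.
have -> := integral_posterior mL (fun x => expR_ge0 _) Lint Linf md
  (fun x => powR_ge0 _ _ : (0 <= (mdist (x : X) xstar `^ p)%:E)%E).
rewrite lte_mul_pinfty ?lee_fin ?invr_ge0 ?fine_ge0 ?(ltW Lint)//.
apply: le_lt_trans fm; apply: le_integral_minorant => x.
  by rewrite -EFinM lee_fin mulr_ge0 ?powR_ge0 ?expR_ge0.
rewrite -EFinM lee_fin ler_piMr ?powR_ge0//.
by rewrite -expR0 ler_expR oppr_le0.
Qed.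

Section coupling.
Variables (mu nu : probability (borel X) R) (pi : probability (borel X * borel X)%type R).
Variables (a b M B w tau : R).
Hypothesis pi_mu_nu : couplings mu nu pi.
Hypothesis M0 : 0 <= M.
Hypothesis aPhi : {ae mu, forall x, a <= Phi x <= a + M}.
Hypothesis bPhi : {ae nu, forall x, b <= Phi x <= b + M}.
Hypothesis piw : (\int[pi]_z (mdist (z.1 : X) (z.2 : X) `^ p)%:E <= w%:E)%E.
Hypothesis B0 : 0 < B.
Hypothesis poincare : (poincare_const q nu < B%:E)%E.

(** Truncating the potential to its essential range changes the weights on a null
    set only, and makes the bounds on the exponent hold everywhere. *)
Let clamp c r := Num.max c (Num.min r (c + M)).
Let u (z : (borel X * borel X)%type) := clamp a (Phi z.1).
Let v (z : (borel X * borel X)%type) := clamp b (Phi z.2).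

Let clamp_bounds c r : c <= clamp c r <= c + M.
Proof.
by rewrite /clamp le_max lexx/= ge_max lerDl M0/= ge_min lexx orbT.
Qed.

Let clamp_id c r : c <= r <= c + M -> clamp c r = r.
Proof. by move=> /andP[h1 h2]; rewrite /clamp min_l// max_r. Qed.

Let bmeas_clamp c : bmeas (fun x : borel X => clamp c (Phi x)).
Proof.
split.
  apply: measurable_maxr => //; exact: measurable_minr.
exists (`|c| + `|M|) => x; have /andP[h1 h2] := clamp_bounds c (Phi x).
have := ler_norm c; have := ler_norm (- c); rewrite normrN.
have := ler_norm M; have := normr_ge0 M.
by move=> *; rewrite ler_norml; apply/andP; split; lra.
Qed.

Let bu : bmeas u. Proof. exact: (bmeas_comp measurable_fst (bmeas_clamp a)). Qed.
Let bv : bmeas v. Proof. exact: (bmeas_comp measurable_snd (bmeas_clamp b)). Qed.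

Let law1 A : measurable A -> pi (fst @^-1` A) = mu A.
Proof. by move=> mA; have [] := pi_mu_nu mA. Qed.

Let law2 A : measurable A -> pi (snd @^-1` A) = nu A.
Proof. by move=> mA; have [] := pi_mu_nu mA. Qed.

Let uPhi : {ae pi, forall z, u z = Phi z.1}.
Proof.
have := ae_law measurable_fst law1 aPhi; apply: filterS => z; exact: clamp_id.
Qed.

Let vPhi : {ae pi, forall z, v z = Phi z.2}.
Proof.
have := ae_law measurable_snd law2 bPhi; apply: filterS => z; exact: clamp_id.
Qed.

Let mdist2 : measurable_fun setT
  (fun z : (borel X * borel X)%type => mdist (z.1 : X) (z.2 : X) `^ p).
Proof.
by apply: (measurableT_comp (measurable_powR _)) => //; exact: measurable_mdist2.
Qed.

Let uv_p : 1 < p -> \int[pi]_z (`|u z - v z| `^ p) <= K `^ p * w.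
Proof.
move=> p1; have p0 : 0 <= p by lra.
have buv : bmeas (fun z => `|u z - v z| `^ p).
  by apply: bmeas_norm_powR => //; exact: bmeasB.
rewrite -lee_fin EFin_expectation// EFinM.
apply: (@le_trans _ _ (\int[pi]_z ((K `^ p)%:E * (mdist (z.1 : X) (z.2 : X) `^ p)%:E))%E).
  apply: ae_ge0_le_integral => //.
  - by apply/measurable_EFinP; case: buv.
  - by move=> z _; rewrite -EFinM lee_fin mulr_ge0 ?powR_ge0.
  - by apply: emeasurable_funM => //; exact/measurable_EFinP.
  - near=> z => _; rewrite -EFinM lee_fin.
    have -> : u z = Phi z.1 by near: z.
    have -> : v z = Phi z.2 by near: z.
    rewrite -powRM ?mdist_ge0// ge0_ler_powR ?nnegrE ?mulr_ge0 ?mdist_ge0//.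
    exact: lip_constP.
rewrite ge0_integralZl//.
- by rewrite lee_wpmul2l// lee_fin powR_ge0.
- exact/measurable_EFinP.
- by move=> z _; rewrite lee_fin powR_ge0.
- by rewrite lee_fin powR_ge0.
Unshelve. all: by end_near. Qed.

Let bQ (f : X -> R) t : 1 < p -> 0 < t -> bmeas (f : borel X -> R) ->
  bmeas (hopf_lax p t f : borel X -> R).
Proof. by move=> p1 t0 [_ [A fA]]; exact: bmeas_hopf_lax fA _ _ _. Qed.

(** The first leg: [Q tau f y - f x] is at most [d(x, y) ^ p / tau ^ (p - 1)], and
    the weight at [t = 0] depends on [x] only, so that the first marginal of the
    tilted coupling is the posterior of [mu]. *)
Let start (f : X -> R) : 1 < p -> 0 < tau < 1 -> bmeas (f : borel X -> R) ->
  pairing p pi snd u v f tau 0 - \int[posterior mu L]_x f x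
    <= expR M * (w / tau `^ (p - 1)).
Proof.
move=> p1 /andP[tau0 tau1] bf; have p0 : 0 <= p by lra.
have [_ [A fA]] := bf.
have bf1 : bmeas (fun z : (borel X * borel X)%type => f z.1).
  exact: (bmeas_comp measurable_fst bf).
have bQ2 : bmeas (fun z : (borel X * borel X)%type => hopf_lax p tau f z.2).
  exact: (bmeas_comp measurable_snd (bQ p1 tau0 bf)).
have -> : \int[posterior mu L]_x f x = \int[tilted pi u v 0]_z f z.1.
  apply/esym; apply: (expectation_posterior_law measurable_fst law1) => //.
  - exact: bmeas_tilt.
  - by move=> z; exact: expR_gt0.
  - by apply: filterS uPhi => z uz; rewrite /tilt mul0r addr0 uz.
rewrite /pairing mulr0 addr0 -expectationB//.
have bD : bmeas (fun z : (borel X * borel X)%type => Num.max 0 (hopf_lax p tau f z.2 - f z.1)).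
  exact: (bmeas_max0 (bmeasB bQ2 bf1)).
apply: (@le_trans _ _ (\int[tilted pi u v 0]_z Num.max 0 (hopf_lax p tau f z.2 - f z.1))).
  apply: le_expectation => //; first exact: bmeasB.
  by move=> z; rewrite le_max lexx orbT.
have := @le_tilted _ _ R pi u v a b M bu bv _ _ 0 _ _ bD.
move=> /(_ _ _ _ _)/le_trans; apply.
- by move=> z; exact: clamp_bounds.
- by move=> z; exact: clamp_bounds.
- by rewrite lexx ler01.
- by move=> z; rewrite le_max lexx.
rewrite ler_wpM2l ?expR_ge0//.
have tp0 : 0 <= (tau `^ (p - 1))^-1 by rewrite invr_ge0 powR_ge0.
apply: (@expectation_le_integral _ _ _ pi _
  (fun z : (borel X * borel X)%type => mdist (z.1 : X) (z.2 : X) `^ p / tau `^ (p - 1))) => //.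
- exact: measurable_funM.
- by move=> z; rewrite cost_ge0.
- move=> z; rewrite ge_max cost_ge0/=.
  have := hopf_lax_le p fA tau z.2 z.1; rewrite (metric_sym z.2) => h.
  by rewrite lerBlDl.
under eq_integral do rewrite mulrC EFinM.
rewrite ge0_integralZl//.
- by rewrite mulrC EFinM lee_wpmul2l.
- exact/measurable_EFinP.
- by move=> z _; rewrite lee_fin powR_ge0.
Qed.

(** At [t = 1] the weight depends on [y] only. *)
Let finish (f : X -> R) : 1 < p -> bmeas (f : borel X -> R) ->
  pairing p pi snd u v f tau 1 = \int[posterior nu L]_y hopf_lax p 1 f y.
Proof.
move=> p1 bf; rewrite /pairing mulr1 addrC subrK.
apply: (expectation_posterior_law measurable_snd law2) => //.
- exact: bmeas_tilt.
- by move=> z; exact: expR_gt0.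
- by apply: filterS vPhi => z vz; rewrite /tilt mul1r addrC subrK vz.
- exact: bQ.
Qed.

(** The two legs together, at the level of the dual problem for the posteriors. *)
Lemma posterior_dual_bound (f : X -> R) : 1 < p -> 0 < tau < 1 -> bmeas (f : borel X -> R) ->
  \int[posterior nu L]_y hopf_lax p 1 f y - \int[posterior mu L]_x f x <=
  expR M * w / tau `^ (p - 1) +
  (expR M * B) `^ (p - 1) * gamma `^ p * (expR M * (K `^ p * w)) / (1 - tau) `^ (p - 1).
Proof.
move=> p1 tau01 bf; have [_ [A fA]] := bf.
have H1 := start p1 tau01 bf; have H2 := finish p1 bf.
have H3 := @pairing_increment _ _ R X p pi nu snd measurable_snd law2 u v a b M bu bv
  (fun z => clamp_bounds a (Phi z.1)) (fun z => clamp_bounds b (Phi z.2)) f A fA B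
  (K `^ p * w) tau B0 poincare (uv_p p1) p1 tau01.
rewrite mulrA in H1; rewrite H2 in H3.
have := lerD H3 H1; rewrite addrA subrK.
by rewrite [X in _ <= X -> _]addrC.
Qed.

End coupling.
End posterior_transport.

(** * The Wasserstein estimate *)

Section wasserstein_bounds.
Context {R : realType} {X : completeMetricType R} (p : R).
Local Notation q := (conj_exp p).
Local Notation gamma := (gamma_const p).

Lemma wasserstein_le (mu nu : probability (borel X) R) (c : R) : 0 < p -> 0 <= c ->
  (forall eps, 0 < eps -> exists2 pi, couplings mu nu pi &
    (\int[pi]_z (mdist (z.1 : X) (z.2 : X) `^ p)%:E <= (c `^ p + eps)%:E)%E) ->
  (wasserstein p mu nu <= c%:E)%E.
Proof.
move=> p0 c0 H; rewrite /wasserstein.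
set S := [set _ | _ in _].
have S0 : (0 <= ereal_inf S)%E.
  apply: le_ereal_inf_tmp => _ [pi _ <-].
  by apply: integral_ge0 => z _; rewrite lee_fin powR_ge0.
have Sc : (ereal_inf S <= (c `^ p)%:E)%E.
  apply/lee_addgt0Pr => eps eps0; have [pi pic le_pi] := H _ eps0.
  by apply: le_trans le_pi; apply: ereal_inf_lbound; exists pi.
have -> : c%:E = ((c `^ p)%:E `^ p^-1)%E.
  by rewrite poweR_EFin -powRrM mulfV ?gt_eqF// powRr1.
have pV0 : 0 <= p^-1 by rewrite invr_ge0 ltW.
by apply: (gt0_ler_poweR pV0) => //; rewrite in_itv/= ?S0 ?leey ?lee_fin ?powR_ge0.
Qed.

(** The best way of splitting the unit of time between a leg of length [A] and a
    leg of length [V] is proportional to the lengths. *)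
Lemma split_time (A V : R) : 1 < p -> 0 < A -> 0 < V ->
  A `^ p / (A / (A + V)) `^ (p - 1) + V `^ p / (1 - A / (A + V)) `^ (p - 1) = (A + V) `^ p.
Proof.
move=> p1 A0 V0; have S0 : 0 < A + V by rewrite addr_gt0.
have p0 : 0 < p by lra.
have -> : 1 - A / (A + V) = V / (A + V) by field; rewrite gt_eqF.
have E (x : R) : 0 < x -> x `^ p / (x / (A + V)) `^ (p - 1) = x * (A + V) `^ (p - 1).
  move=> x0; rewrite -(mulr_powRB1 (ltW x0) p0) powRM ?invr_ge0 ?(ltW x0) ?(ltW S0)//.
  have -> : (A + V)^-1 `^ (p - 1) = ((A + V) `^ (p - 1))^-1.
    by rewrite -[(A + V)^-1]powR_inv1 ?(ltW S0)// -powRrM mulN1r powRN.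
  by field; rewrite !gt_eqF ?powR_gt0.
by rewrite !E// -mulrDl mulr_powRB1// ltW.
Qed.

Variables (sepX : separable X) (xstar : X) (Phi : X -> R).
Hypothesis Phi_ge0 : forall x, 0 <= Phi x.
Hypothesis lipPhi : (lip_const Phi < +oo)%E.
Local Notation L := (fun x : X => expR (- Phi x)).
Local Notation K := (fine (lip_const Phi)).

Let K0 : 0 <= K.
Proof. by rewrite fine_ge0// /lip_const le_max lexx. Qed.

Lemma wasserstein_posterior_coupling (mu nu : probability (borel X) R)
    (pi : probability (borel X * borel X)%type R) (a b M B w : R) :
  1 < p -> 0 <= M -> 0 < B -> 0 <= w -> couplings mu nu pi ->
  finite_moment xstar p mu -> finite_moment xstar p nu ->
  {ae mu, forall x, a <= Phi x <= a + M} ->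
  {ae nu, forall x, b <= Phi x <= b + M} ->
  (\int[pi]_z (mdist (z.1 : X) (z.2 : X) `^ p)%:E <= w%:E)%E ->
  (poincare_const q nu < B%:E)%E ->
  (wasserstein p (posterior mu L) (posterior nu L) <=
    ((expR (M / p) + gamma * K * B `^ q^-1 * expR M) * w `^ p^-1)%:E)%E.
Proof.
move=> p1 M0 B0 w0 pic fmu fnu aPhi bPhi piw poinc.
have p0 : 0 < p by lra.
have g0 : 0 <= gamma by exact: le_trans ler01 (gamma_ge1 p1).
pose W := w `^ p^-1.
have W0 : 0 <= W by exact: powR_ge0.
have Wp : W `^ p = w by rewrite -powRrM mulVf ?gt_eqF// powRr1.
pose A0 := expR (M / p) * W.
pose V0 := gamma * K * B `^ q^-1 * expR M * W.
have expRp (x r : R) : expR x `^ r = expR (r * x).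
  by rewrite powR_expR ?expR_gt0// expRK.
have A0_ge0 : 0 <= A0 by rewrite mulr_ge0 ?expR_ge0.
have gKB0 : 0 <= gamma * K * B `^ q^-1.
  by apply: mulr_ge0; [exact: mulr_ge0|exact: powR_ge0].
have V0_ge0 : 0 <= V0 by rewrite /V0 mulr_ge0// mulr_ge0// expR_ge0.
have A0p : A0 `^ p = expR M * w.
  by rewrite powRM ?expR_ge0// Wp expRp mulrCA mulfV ?mulr1// gt_eqF.
have V0p : V0 `^ p = (expR M * B) `^ (p - 1) * gamma `^ p * (expR M * (K `^ p * w)).
  rewrite (powRM p (mulr_ge0 gKB0 (expR_ge0 M)) W0) (powRM p gKB0 (expR_ge0 M)).
  rewrite (powRM p (mulr_ge0 g0 K0) (powR_ge0 _ _)) (powRM p g0 K0) Wp.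
  rewrite -powRrM mul_conj_expV// (powRM _ (expR_ge0 M) (ltW B0)).
  have -> : expR M `^ p = expR M * expR M `^ (p - 1).
    by rewrite mulr_powRB1 ?expR_ge0.
  by ring.
apply/lee_addgt0Pr => e e0; rewrite -EFinD.
(* [e / 2] keeps both lengths positive, as [split_time] requires *)
pose A := A0 + e / 2; pose V := V0 + e / 2.
have e20 : 0 < e / 2 by rewrite divr_gt0.
have Agt0 : 0 < A by rewrite ltr_pwDr.
have Vgt0 : 0 < V by rewrite ltr_pwDr.
have AV0 : 0 < A + V by rewrite addr_gt0.
have -> : (expR (M / p) + gamma * K * B `^ q^-1 * expR M) * w `^ p^-1 + e = A + V.
  by rewrite /A /V /A0 /V0 /W; lra.
apply: wasserstein_le => // [|eps eps0]; first exact: ltW.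
apply: (@kantorovich_coupling _ _ p _ _ _ _ xstar) => //; last 2 first.
- exact: finite_moment_posterior.
- exact: finite_moment_posterior.
move=> f bf; pose tau := A / (A + V).
have tau01 : 0 < tau < 1.
  by rewrite divr_gt0//= ltr_pdivrMr// mul1r ltrDl.
apply: le_trans (posterior_dual_bound sepX xstar Phi_ge0 lipPhi pic M0 aPhi bPhi piw B0 poinc p1 tau01 bf) _.
rewrite -(split_time p1 Agt0 Vgt0) -/tau -V0p -A0p.
have /andP[tau0 tau1] := tau01.
by apply: lerD; rewrite ler_wpM2r ?invr_ge0 ?powR_ge0// ge0_ler_powR ?nnegrE ?(ltW p0) ?(ltW Agt0) ?(ltW Vgt0)// lerDl ltW.
Qed.

(** [B] and the cost of the coupling are approached from above, where the infima
    defining the Poincare constant and the distance are attained approximately; the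
    continuity of powers gives the bound in the limit. *)
Lemma wasserstein_posterior_le (mu nu : probability (borel X) R) (B M : R) :
  1 < p -> 0 <= B -> 0 <= M ->
  prior_class xstar p B M Phi mu -> prior_class xstar p B M Phi nu ->
  (wasserstein p (posterior mu L) (posterior nu L) <=
    (expR (M / p) + gamma * K * B `^ q^-1 * expR M)%:E * wasserstein p mu nu)%E.
Proof.
move=> p1 B0 M0 [fmu _ oscmu] [fnu poinc oscnu].
have [a aPhi] := @ess_osc_interval _ (borel X) R mu Phi M Phi_ge0 oscmu.
have [b bPhi] := @ess_osc_interval _ (borel X) R nu Phi M Phi_ge0 oscnu.
have p0 : 0 < p by lra.
have pV0 : 0 < p^-1 by rewrite invr_gt0.
have qV0 : 0 < q^-1 by rewrite invr_gt0; have := conj_exp_gt1 p1; lra.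
have g0 : 0 <= gamma by exact: le_trans ler01 (gamma_ge1 p1).
set c := expR (M / p) + _.
have c0 : 0 < c.
  rewrite ltr_pwDl ?expR_gt0// mulr_ge0 ?expR_ge0// mulr_ge0 ?powR_ge0//.
  exact: mulr_ge0.
have coupling_le pi w : 0 <= w -> couplings mu nu pi ->
    (\int[pi]_z (mdist (z.1 : X) (z.2 : X) `^ p)%:E <= w%:E)%E ->
    (wasserstein p (posterior mu L) (posterior nu L) <= (c * w `^ p^-1)%:E)%E.
  move=> w0 pic piw; apply/lee_addgt0Pr => e e0; rewrite -EFinD.
  pose D := gamma * K * expR M * w `^ p^-1.
  have D0 : 0 <= D.
    by apply: mulr_ge0 (powR_ge0 _ _); apply: mulr_ge0 (expR_ge0 _); exact: mulr_ge0.
  have eD0 : 0 < e / (D + 1) by rewrite divr_gt0// ltr_wpDl.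
  have [h h0 hP] := powR_near qV0 B0 eD0.
  have Bh : (B + h) `^ q^-1 <= B `^ q^-1 + e / (D + 1).
    by apply: hP; [rewrite addr_ge0// ltW|rewrite opprD addNKr normrN gtr0_norm].
  have Bh0 : 0 < B + h by rewrite ltr_wpDl.
  have poinc' : (poincare_const q nu < (B + h)%:E)%E.
    by apply: le_lt_trans poinc _; rewrite lte_fin ltrDl.
  apply: le_trans (wasserstein_posterior_coupling p1 M0 Bh0 w0 pic fmu fnu aPhi bPhi piw poinc') _.
  rewrite lee_fin.
  have eE : D * (e / (D + 1)) <= e.
    by rewrite mulrCA ler_piMr ?(ltW e0)// ler_pdivrMr ?mul1r ?lerDl// ltr_wpDl.
  have := ler_wpM2l D0 Bh; rewrite /D /c.
  set x := (B + h) `^ _; set y := B `^ _; set z := w `^ _; set k := e / _.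
  rewrite mulrDr; move: eE; rewrite -/k /D -/z; set Dk := _ * k.
  move=> h1 h2.
  have -> : (expR (M / p) + gamma * K * x * expR M) * z =
    expR (M / p) * z + gamma * K * expR M * z * x by ring.
  have -> : (expR (M / p) + gamma * K * y * expR M) * z + e =
    expR (M / p) * z + (gamma * K * expR M * z * y + e) by ring.
  by rewrite lerD2l (le_trans h2)// lerD2l.
rewrite {2}/wasserstein; set S := [set _ | _ in _].
have S0 : (0 <= ereal_inf S)%E.
  apply: le_ereal_inf_tmp => _ [pi _ <-].
  by apply: integral_ge0 => z _; rewrite lee_fin powR_ge0.
move: S0; case ES : (ereal_inf S) => [r| |//] S0; last first.
  by rewrite (eqy_poweR pV0 erefl) gt0_muley ?lte_fin// leey.
rewrite poweR_EFin -EFinM; apply/lee_addgt0Pr => e e0; rewrite -EFinD.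
have ec0 : 0 < e / c by rewrite divr_gt0.
have [h h0 hP] := powR_near pV0 S0 ec0.
have : (ereal_inf S < (r + h)%:E)%E by rewrite ES lte_fin ltrDl.
move=> /ereal_inf_lt[_ [pi pic <-] /ltW le_pi].
have r0 : 0 <= r by rewrite -lee_fin.
have rh0 : 0 <= r + h by rewrite addr_ge0// ltW.
apply: le_trans (coupling_le pi (r + h) rh0 pic le_pi) _; rewrite lee_fin.
have rh : (r + h) `^ p^-1 <= r `^ p^-1 + e / c.
  by apply: hP => //; rewrite opprD addNKr normrN gtr0_norm.
have := ler_wpM2l (ltW c0) rh.
by rewrite mulrDr [c * (e / c)]mulrC divfK// gt_eqF.
Qed.

End wasserstein_bounds.

Theorem theorem5p2 (R : realType) (X : completeMetricType R)
    (sepX : separable X) (xstar : X)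
    (Phi : X -> R) (Phi_ge0 : forall x, 0 <= Phi x)
    (lipPhi : (lip_const Phi < +oo)%E) (infPhi : inf (range Phi) = 0)
    (p : R) (p_gt1 : 1 < p) :
  let L := fun x => expR (- Phi x) in
  let K := fine (lip_const Phi) in
  let p' := conj_exp p in
  [/\ forall B M : R, 0 <= B -> 0 <= M ->
        forall mu nu : probability (borel X) R,
          prior_class xstar p B M Phi mu -> prior_class xstar p B M Phi nu ->
          (wasserstein p (posterior mu L) (posterior nu L) <=
             (expR (M / p)
              + gamma_const p * K * B `^ p'^-1 * expR M)%:E
             * wasserstein p mu nu)%E,
      (* the supremum defining gamma_const is a maximum *)
      exists2 s : R, 0 <= s <= 1 & gamma_const p = gamma_fun p s,
      gamma_const p < 2
    & p = 2 -> gamma_const p = 1].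
Proof.
move=> L K p'; split.
- by move=> B M B0 M0 mu nu; exact: wasserstein_posterior_le.
- exact: gamma_const_max.
- exact: gamma_lt2.
- by move=> ->; exact: gamma_const2.
Qed.
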